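(* Let $d\ge 3$ and $N\ge 3$. Let $\mathcal{V}_{\mathrm{int}}$ be the set of configurations $\mathcal{L}=(\Pi_i,P_i,C_i)_{i=1}^3\in(\mathcal{P}_d)^3$ that are suited for degree $d$ in $\mathbb{P}^N$ and such that $P_1\notin\Pi_2\cup\Pi_3$, $P_2\ne P_3$, and the line $\langle P_2,P_3\rangle$ is contained in $\Pi_2\cap\Pi_3$. Then $\mathcal{V}_{\mathrm{int}}$ is irreducible of dimension $$3N+(N-1)+2(N-2)+\binom{N+d-3}{N-3}+\sum_{k=1}^{d-1}\binom{N+d-k-4}{N-3}-1.$$
   Context: The base field is $\mathbb{C}$. A hypersurface $C$ of degree $d$ in a projective space $\Pi$ is a good $P$-cone of degree $d$ if it is a cone with vertex $P$ (i.e. it has multiplicity $d$ at $P$) and is smooth outside $P$. $\mathcal{P}_d$ is the space of triples $(\Pi,P,C)$ with $\Pi$ a hyperplane in $\mathbb{P}^N$, $P$ a point of $\Pi$ and $C$ a good $P$-cone of degree $d$ in $\Pi$. A configuration $(\Pi_i,P_i,C_i)_{i=1}^3\in(\mathcal{P}_d)^3$ is suited for degree $d$ if there exists a hypersurface $X$ of degree $d$ in $\mathbb{P}^N$ such that, for every $i$, $X$ does not contain $\Pi_i$ and $X\cap\Pi_i=C_i$ as schemes. *)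

(* Defs.v *)
From HB Require Import structures.
From mathcomp Require Import all_boot all_order all_algebra.
From mathcomp Require Import complex mpoly.
From mathcomp Require Import boolp classical_sets reals.

Set Implicit Arguments.
Unset Strict Implicit.
Unset Printing Implicit Defensive.

Import Order.TTheory GRing.Theory Num.Theory.
Local Open Scope ring_scope.
Local Open Scope classical_set_scope.

(** ** Irreducibility and Krull dimension

  A topology on [T] is given by its family [cl] of closed sets; a subset of [T]
  carries the induced topology. *)

Definition irreducible (T : Type) (cl : set (set T)) (Y : set T) : Prop :=
  Y !=set0 /\
  forall Z1 Z2, cl Z1 -> cl Z2 -> Y `<=` Z1 `|` Z2 -> Y `<=` Z1 \/ Y `<=` Z2.

Definition closed_in (T : Type) (cl : set (set T)) (Y Z : set T) : Prop :=
  exists2 A, cl A & Z = Y `&` A.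

Definition irreducible_chain (T : Type) (cl : set (set T)) (Y : set T)
    (m : nat) (Z : nat -> set T) : Prop :=
  (forall i, (i <= m)%N -> closed_in cl Y (Z i) /\ irreducible cl (Z i)) /\
  (forall i, (i < m)%N -> Z i `<` Z i.+1).

Definition has_dimension (T : Type) (cl : set (set T)) (Y : set T) (m : nat)
    : Prop :=
  (exists Z, irreducible_chain cl Y m Z) /\
  (forall k Z, irreducible_chain cl Y k Z -> (k <= m)%N).

(** ** Zariski topology of a finite-dimensional vector space *)

Definition zariski_closed (K : numClosedFieldType) (V : vectType K) :
    set (set V) :=
  [set A | exists I : set {mpoly K[\dim {: V}]},
     A = [set v | forall q, I q ->
                    q.@[fun i => coord (vbasis {: V}) i v] = 0]].
Arguments zariski_closed {K} V.

(** ** Linear subspaces and hypersurfaces of projective space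

  A linear subspace of [P^N] is the corresponding vector subspace of
  [K^(N+1)], of dimension one more. *)

Definition lin_ideal (K : numClosedFieldType) (N : nat)
    (W : {vspace 'rV[K]_N.+1}) :
    set {mpoly K[N.+1]} :=
  [set f | forall v, v \in W -> f.@[v 0] = 0].

(* The ideal [(F) + I(W)] of the scheme [{F = 0} /\ W].  For [F] homogeneous not
   vanishing on [W] and [W] of projective dimension at least 1, it is saturated,
   so that equality of subschemes is equality of these ideals. *)
Definition section_ideal (K : numClosedFieldType) (N : nat)
    (F : {mpoly K[N.+1]}) (W : {vspace 'rV[K]_N.+1}) : set {mpoly K[N.+1]} :=
  [set f | exists A B, lin_ideal W B /\ f = A * F + B].

Definition dirder (K : numClosedFieldType) (N : nat) (w : 'rV[K]_N.+1)
    (F : {mpoly K[N.+1]}) : {mpoly K[N.+1]} :=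
  \sum_(i < N.+1) w 0 i *: F^`M(i).

(* All derivatives of order less than [m] of [F] restricted to [W] vanish at
   [p]. *)
Definition vanishes_to_order (K : numClosedFieldType) (N : nat)
    (W : {vspace 'rV[K]_N.+1}) (F : {mpoly K[N.+1]}) (p : 'rV[K]_N.+1)
    (m : nat) : Prop :=
  forall ws : seq 'rV[K]_N.+1, (size ws < m)%N -> {subset ws <= W} ->
    (foldr (@dirder K N) F ws).@[p 0] = 0.

(* Multiplicity at the point [p] of the hypersurface [F = 0] of [W]; derivatives
   detect it because the characteristic is 0. *)
Definition multiplicity_is (K : numClosedFieldType) (N : nat)
    (W : {vspace 'rV[K]_N.+1}) (F : {mpoly K[N.+1]}) (p : 'rV[K]_N.+1)
    (m : nat) : Prop :=
  vanishes_to_order W F p m /\ ~ vanishes_to_order W F p m.+1.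

(* Jacobian criterion at a point [q] of the hypersurface [F = 0] of [W]. *)
Definition smooth_at (K : numClosedFieldType) (N : nat)
    (W : {vspace 'rV[K]_N.+1}) (F : {mpoly K[N.+1]}) (q : 'rV[K]_N.+1) : Prop :=
  exists2 w, w \in W & (dirder w F).@[q 0] != 0.

(** ** The space of good cones *)

(* [C] is the homogeneous ideal, in the coordinate ring of [P^N], of a closed
   subscheme. *)
Record triple (K : numClosedFieldType) (N : nat) : Type := Triple {
  hyp : {vspace 'rV[K]_N.+1};
  vertex : {vspace 'rV[K]_N.+1};
  cone : set {mpoly K[N.+1]}
}.

Definition good_cone (K : numClosedFieldType) (N d : nat)
    (Pi P : {vspace 'rV[K]_N.+1}) (C : set {mpoly K[N.+1]}) : Prop :=
  exists F : {mpoly K[N.+1]},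
    [/\ F \is d.-homog, ~ lin_ideal Pi F & C = section_ideal F Pi] /\
    (forall p, p \in P -> p != 0 -> multiplicity_is Pi F p d) /\
    (forall q, q \in Pi -> q \notin P -> F.@[q 0] = 0 -> smooth_at Pi F q).

Definition good_triple (K : numClosedFieldType) (N d : nat) :
    set (triple K N) :=
  [set t | [/\ \dim (hyp t) = N, \dim (vertex t) = 1%N,
               (vertex t <= hyp t)%VS
             & good_cone d (hyp t) (vertex t) (cone t)]].
Arguments good_triple : clear implicits.

Definition good_config (K : numClosedFieldType) (N d : nat) :
    set ('I_3 -> triple K N) :=
  [set L | forall i, good_triple K N d (L i)].
Arguments good_config : clear implicits.

(* Equations [(l, p, F)] of a triple: coefficients of a linear form, homogeneous
   coordinates of a point, and a form of degree [d]. *)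
Definition equations (K : numClosedFieldType) (N d : nat) : vectType K :=
  ('rV[K]_N.+1 * 'rV[K]_N.+1 * dhomog N.+1 K d)%type.

Definition hyperplane (K : numClosedFieldType) (N : nat) (l : 'rV[K]_N.+1) :
    {vspace 'rV[K]_N.+1} :=
  lker (linfun (mulmxr l^T) : 'Hom('rV[K]_N.+1, 'rV[K]_1)).

Definition triple_of (K : numClosedFieldType) (N d : nat)
    (e : equations K N d) : triple K N :=
  let: (l, p, F) := e in
  Triple (hyperplane l) <[p]>%VS
    (section_ideal (F : {mpoly K[N.+1]}) (hyperplane l)).

(* Zariski topology of the third power of the space of triples, as the quotient
   of the Zariski topology on the locus of equations of good triples: taking
   the triple of given equations is a smooth surjection from that locus. *)
Definition config_closed (K : numClosedFieldType) (N d : nat) :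
    set (set ('I_3 -> triple K N)) :=
  [set Z | exists2 A, zariski_closed {ffun 'I_3 -> equations K N d} A &
     forall e : {ffun 'I_3 -> equations K N d},
       let L := fun i => triple_of (e i) in
       good_config K N d L -> (Z L <-> A e)].
Arguments config_closed : clear implicits.

Definition suited (K : numClosedFieldType) (N d : nat)
    (L : 'I_3 -> triple K N) : Prop :=
  exists2 H : {mpoly K[N.+1]}, H \is d.-homog &
    forall i, ~ lin_ideal (hyp (L i)) H /\
              section_ideal H (hyp (L i)) = cone (L i).

(* The indices 1, 2, 3 are the elements 0, 1, 2 of ['I_3]. *)
Definition Vint (K : numClosedFieldType) (N d : nat) :
    set ('I_3 -> triple K N) :=
  [set L | let t1 := L 0 in let t2 := L 1 in let t3 := L 2 in
    [/\ good_config K N d L, suited d L,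
        ~~ (vertex t1 <= hyp t2)%VS /\ ~~ (vertex t1 <= hyp t3)%VS,
        vertex t2 <> vertex t3
      & (vertex t2 + vertex t3 <= hyp t2 :&: hyp t3)%VS]].
Arguments Vint : clear implicits.

(* Main.v *)
Require Import Defs.
From HB Require Import structures.
From mathcomp Require Import all_boot all_order all_algebra.
From mathcomp Require Import complex mpoly.
From mathcomp Require Import boolp classical_sets reals.
From mathcomp Require Import fingroup perm ring zify.
Set Implicit Arguments.
Unset Strict Implicit.
Unset Printing Implicit Defensive.
Import Order.TTheory GRing.Theory Num.Theory.
Local Open Scope ring_scope.

(** Put [N = n + 3], number the triples from 0 to 2 and describe a configuration by
equations: linear forms [l_i],
points [p_i] and forms [F_i] of degree [d], where only the restriction of [F_i]
to [l_i = 0] matters, up to a scalar.  For a form, multiplicity [d] at [p] means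
that the form is invariant under translations along [p], so that all the
conditions can be read off values of forms ([good_tripleP], [triple_eqP]).

_Normal form._  Let [H] be a form cutting out the three cones.  A cone that is
smooth off its vertex has no second vertex ([vertex_unique]).  Translating along
[p_0] one sees that [l_0] vanishes neither at [p_1] nor at [p_2], and that
[l_0, l_1, l_2] are independent.  Hence there are coordinates [y = x D] in which
the hyperplanes are [y_0 = 0], [y_1 = 0], [y_2 = 0] and the vertices are
[e_1 - e_2], [e_0], [e_0 - e_3].  In these coordinates each cone is the pullback,
under the projection from its vertex, of one hypersurface [g = 0] of the space
[y_0 = y_1 = 0]; the form [g] is nonsingular, and for [y_2 = 0] it does not
involve [y_3], the trace of [H = 0] on [y_1 = y_2 = 0] being a cone over the
line through [p_1] and [p_2].  Conversely, every invertible [D] and every such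
[g] define a configuration of the required kind ([model_Vint], [Vint_model]).

_Irreducibility._  So the locus is the image of a set of pairs [(D, g)] inside a
vector space.  The form
[y_2 y_3^(d-1) + y_2^d + y_4^d + ... + y_N^d] is nonsingular and stays so under
small perturbations, by an estimate of absolute values.  Therefore every line
through the pair formed by the identity and this form contains infinitely many
admissible pairs, and a polynomial function vanishing on the admissible pairs
vanishes identically ([irreducible_image], [Vint_irreducible]).

_Dimension._  Normalise the [l_i] to have one coefficient equal to 1, the
vertices likewise, and the coefficient of [y_2^d] in [g] to 1.  The remaining
coefficients are [3 N], respectively [(N - 1) + 2 (N - 2)], respectively the
number of monomials that may occur in [g], minus one; they are the parameters of
a map [chart] from a vector space to the locus.  The exponent [k] of [y_3] gives
the count of the monomials: there are ['C(N + d - 3, N - 3)] of them for [k = 0],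
and for [1 <= k < d], since [y_2] then divides the monomial,
['C(N + d - k - 4, N - 3)].

Equating the last parameters to 0, one after the other, gives a chain of closed
irreducible subsets, distinct because each parameter can be recovered, up to a
factor, from the configuration once the later ones are 0 ([chart_chain]).

For the upper bound, a chain [Z_0 < ... < Z_k] yields functions [f_1, ..., f_k],
regular around a point of [Z_0], with [f_i] zero on [Z_(i-1)] but not on [Z_i].
They are algebraically independent ([dimension_upper_bound]).  On the other hand
regular functions are polynomials in suitably normalised equations, so that on
the chart they become rational functions of the parameters, and more functions
than parameters satisfy an algebraic relation ([rfun_dependence]).  As the chart
covers all the configurations off a closed proper subset ([chart_surj]), the
relation holds everywhere, by irreducibility. *)

(** * Polynomials as functions *)

Section PolynomialFunctions.
Variable K : numFieldType.

Lemma poly_infinite_root (p : {poly K}) (t : nat -> K) :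
  injective t -> (forall k, p.[t k] = 0) -> p = 0.
Proof.
move=> tI pt; apply/eqP/negPn/negP => p0.
have := @max_poly_roots _ p [seq t k | k <- iota 0 (size p)] p0.
rewrite size_map size_iota ltnn map_inj_uniq // iota_uniq.
suff -> : all (root p) [seq t k | k <- iota 0 (size p)] by move=> /(_ isT isT).
by apply/allP => _ /mapP[k _ ->]; rewrite /root pt.
Qed.

Lemma natr_inj : injective (fun k : nat => k%:R : K).
Proof. by move=> i j /eqP; rewrite eqr_nat => /eqP. Qed.

Lemma poly_fun_eq0 (p : {poly K}) : (forall t, p.[t] = 0) -> p = 0.
Proof. by move=> h; apply: (poly_infinite_root natr_inj) => k. Qed.

Lemma poly_fun_neq0 (p : {poly K}) : p != 0 -> exists t, p.[t] != 0.
Proof.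
move=> p0; apply: contrapT => h; move/eqP: p0; apply; apply: poly_fun_eq0 => t.
by apply: contrapT => /eqP pt; apply: h; exists t.
Qed.

Lemma muni_eval n (p : {mpoly K[n.+1]}) (x : 'I_n.+1 -> K) :
  p.@[x] = (map_poly (meval (fun i => x (widen_ord (leqnSn n) i))) (muni p)).[x ord_max].
Proof.
rewrite muniE mevalE raddf_sum /= horner_sum; apply: eq_bigr => m _.
rewrite map_polyZ /= map_polyXn hornerZ hornerXn mevalZ mevalX big_ord_recr /= mulrA.
by congr (_ * _ * _); apply: eq_bigr => i _; rewrite mnmE.
Qed.

Lemma muni_coef n (p : {mpoly K[n.+1]}) (m : 'X_{1..n.+1}) :
  ((muni p)`_(m ord_max))@_[multinom m (widen_ord (leqnSn n) i) | i < n] = p@_m.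
Proof.
rewrite muniE coef_sum [in RHS](mpolyE p) !raddf_sum /=; apply: eq_bigr => m' _.
rewrite coefZ coefXn mulr_natr mcoeffMn !mcoeffZ !mcoeffX. rewrite -mulrnAr -mulr_natr -natrM mulnb.
congr (_ * (nat_of_bool _)%:R); apply/andP/eqP => [[/eqP e /eqP e']|->]; last first.
  by split.
apply/mnmP => i; have [->//|ni] := eqVneq i ord_max.
have [j ->] : exists j, i = widen_ord (leqnSn n) j.
  have hi : (i < n)%N by have := ltn_ord i; rewrite ltnS leq_eqVlt (negbTE (ni : (i : nat) != n)).
  by exists (Ordinal hi); apply: val_inj.
by move/mnmP/(_ j): e; rewrite !mnmE.
Qed.

(** Induction on the number of variables: some coefficient with respect to the
    last variable is nonzero at some point, which leaves a nonzero polynomial in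
    one variable. *)
Lemma mpoly_fun_neq0 n (p : {mpoly K[n]}) : p != 0 -> exists x, p.@[x] != 0.
Proof.
elim: n p => [|n IHn] p p0.
  exists (fun=> 0); move: p0; rewrite (nvar0_mpolyC p) mevalC.
  by apply: contraNneq => ->.
have : exists k, (muni p)`_k != 0.
  apply: contrapT => h; move/eqP: p0; apply; apply/mpolyP => m.
  rewrite mcoeff0 -muni_coef.
  case: (eqVneq (muni p)`_(m ord_max) 0) => [->|h']; first by rewrite mcoeff0.
  by case: h; exists (m ord_max).
case=> k /IHn[x qx].
have /poly_fun_neq0[t pt] : map_poly (meval x) (muni p) != 0.
  by apply: contraNneq qx => /(congr1 (fun q : {poly K} => q`_k)); rewrite coef_map coef0 => ->.
exists (fun i => if unlift ord_max i is Some j then x j else t).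
rewrite muni_eval unlift_none; suff -> : (fun i : 'I_n => if unlift ord_max (widen_ord (leqnSn n) i) is Some j then x j else t) = x by [].
apply: funext => i; have -> : widen_ord (leqnSn n) i = lift ord_max i.
  by apply: val_inj; rewrite /= /bump leqNgt ltn_ord.
by rewrite liftK.
Qed.

Lemma mpoly_fun_eq0 n (p : {mpoly K[n]}) : (forall x, p.@[x] = 0) -> p = 0.
Proof.
move=> h; apply/eqP/negPn/negP => /mpoly_fun_neq0[x]; by rewrite h eqxx.
Qed.

End PolynomialFunctions.

Section FunctionAlgebra.
Variables (K : numFieldType) (X : Type) (P : (X -> K) -> Prop).
Hypotheses (PC : forall c, P (fun=> c)) (PD : forall f g, P f -> P g -> P (fun x => f x + g x)).
Hypothesis PM : forall f g, P f -> P g -> P (fun x => f x * g x).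

Lemma algebra_sum (I : Type) (r : seq I) (Q : pred I) (F : I -> X -> K) :
  (forall i, Q i -> P (F i)) -> P (fun x => \sum_(i <- r | Q i) F i x).
Proof.
move=> h; elim: r => [|i r IHr]; first by under eq_fun do rewrite big_nil; apply: PC.
under eq_fun do rewrite big_cons; case: (boolP (Q i)) => // Qi.
by apply: PD => //; apply: h.
Qed.

Lemma algebra_prod (I : Type) (r : seq I) (Q : pred I) (F : I -> X -> K) :
  (forall i, Q i -> P (F i)) -> P (fun x => \prod_(i <- r | Q i) F i x).
Proof.
move=> h; elim: r => [|i r IHr]; first by under eq_fun do rewrite big_nil; apply: PC.
under eq_fun do rewrite big_cons; case: (boolP (Q i)) => // Qi.
by apply: PM => //; apply: h.
Qed.

Lemma algebra_exp f k : P f -> P (fun x => f x ^+ k).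
Proof.
move=> Pf; elim: k => [|k IHk]; first exact: PC.
by under eq_fun do rewrite exprS; apply: PM.
Qed.

Lemma algebra_meval n (q : {mpoly K[n]}) (h : 'I_n -> X -> K) :
  (forall i, P (h i)) -> P (fun x => q.@[fun i => h i x]).
Proof.
move=> hh; under eq_fun do rewrite mevalE.
by apply: algebra_sum => m _; apply: PM => //; apply: algebra_prod => i _; apply: algebra_exp.
Qed.
End FunctionAlgebra.

(** * Polynomial and rational functions on a vector space *)

Section Dependence.
Variable K : numFieldType.

(** The monomials with all exponents below [B] span a space of dimension
    [B ^ m] that contains all the [G a]. *)
Lemma mpoly_linear_dependence (I : finType) m B (G : I -> {mpoly K[m]}) :
  (forall a, (msize (G a) <= B)%N) -> (B ^ m < #|I|)%N ->
  exists2 c : I -> K, exists a, c a != 0 & \sum_a c a *: G a = 0.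
Proof.
move=> sG lt; pose J : finType := {ffun 'I_m -> 'I_B}.
pose M := \matrix_(i < #|I|, j < #|J|)
  (G (enum_val i))@_[multinom (enum_val j i' : nat) | i' < m].
have : kermx M != 0.
  rewrite -mxrank_eq0 mxrank_ker subn_eq0 -ltnNge.
  by apply: leq_ltn_trans (rank_leq_col M) _; rewrite card_ffun !card_ord.
case/rowV0Pn=> c /sub_kermxP cM c0.
exists (fun a => c 0 (enum_rank a)).
  case/rV0Pn: c0 => j cj; exists (enum_val j); by rewrite enum_valK.
apply/mpolyP => mu; rewrite mcoeff0 raddf_sum /=.
have [lmu|] := @pselect (forall i, (mu i < B)%N); last first.
  move/existsNP => [i /negP]; rewrite -leqNgt => Bi.
  apply: big1 => a _; rewrite mcoeffZ memN_msupp_eq0 ?mulr0 //.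
  apply: msize_mdeg_ge; apply: leq_trans (sG a) _; apply: leq_trans Bi _.
  by rewrite mdegE (bigD1 i) //= leq_addr.
pose j : J := [ffun i => Ordinal (lmu i)].
have /matrixP /(_ 0 (enum_rank j)) := cM; rewrite !mxE => e; rewrite -[RHS]e {e}.
rewrite (reindex (@enum_val I predT)) /=; last first.
  by exists enum_rank => x _; rewrite ?enum_valK ?enum_rankK.
apply: eq_bigr => a _; rewrite mcoeffZ enum_valK !mxE enum_rankK; congr (_ * _@__).
by apply/mnmP => i; rewrite mnmE ffunE.
Qed.

Lemma msize_mul_le n (p q : {mpoly K[n]}) a b :
  (msize p <= a.+1)%N -> (msize q <= b.+1)%N -> (msize (p * q) <= (a + b).+1)%N.
Proof.
move=> ha hb; have [->|p0] := eqVneq p 0; first by rewrite mul0r msize0.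
have [->|q0] := eqVneq q 0; first by rewrite mulr0 msize0.
by rewrite msizeM // -subn1 leq_subLR add1n -addSn -addnS leq_add.
Qed.

Lemma msize_prod_le n (I : Type) (r : seq I) (F : I -> {mpoly K[n]}) (b : I -> nat) :
  (forall i, (msize (F i) <= (b i).+1)%N) ->
  (msize (\prod_(i <- r) F i) <= (\sum_(i <- r) b i).+1)%N.
Proof.
move=> h; elim: r => [|i r IHr]; first by rewrite !big_nil msizeC leq_b1.
by rewrite !big_cons; apply: msize_mul_le.
Qed.

Lemma msize_exp_le n (F : {mpoly K[n]}) b k :
  (msize F <= b.+1)%N -> (msize (F ^+ k) <= (b * k).+1)%N.
Proof.
move=> h; elim: k => [|k IHk]; first by rewrite expr0 msizeC muln0 leq_b1.
by rewrite exprS mulnS; apply: msize_mul_le.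
Qed.
End Dependence.

Section PFun.
Variable K : numFieldType.

(** The coordinates are those used by [zariski_closed]. *)
Definition pfun (V : vectType K) (f : V -> K) : Prop :=
  exists q : {mpoly K[\dim {:V}]}, forall v, f v = q.@[fun i => coord (vbasis {:V}) i v].

Section Closure.
Variable V : vectType K.
Implicit Types f g : V -> K.

Lemma pfunC c : pfun (fun _ : V => c).
Proof. by exists c%:MP => v; rewrite mevalC. Qed.

Lemma pfunD f g : pfun f -> pfun g -> pfun (fun v => f v + g v).
Proof. by move=> [p hp] [q hq]; exists (p + q) => v; rewrite mevalD hp hq. Qed.

Lemma pfunM f g : pfun f -> pfun g -> pfun (fun v => f v * g v).
Proof. by move=> [p hp] [q hq]; exists (p * q) => v; rewrite mevalM hp hq. Qed.

Lemma pfunN f : pfun f -> pfun (fun v => - f v).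
Proof. by move=> [p hp]; exists (- p) => v; rewrite mevalN hp. Qed.

Lemma pfunB f g : pfun f -> pfun g -> pfun (fun v => f v - g v).
Proof. by move=> hf /pfunN; apply: pfunD. Qed.

Lemma pfunX f k : pfun f -> pfun (fun v => f v ^+ k).
Proof. by move=> [p hp]; exists (p ^+ k) => v; rewrite rmorphXn /= hp. Qed.

Lemma pfun_eq f g : f =1 g -> pfun f -> pfun g.
Proof. by move=> fg [p hp]; exists p => v; rewrite -fg. Qed.

Lemma pfun_sum (I : Type) (r : seq I) (P : pred I) (F : I -> V -> K) :
  (forall i, P i -> pfun (F i)) -> pfun (fun v => \sum_(i <- r | P i) F i v).
Proof. exact: (algebra_sum (P := @pfun V) pfunC pfunD). Qed.

Lemma pfun_prod (I : Type) (r : seq I) (P : pred I) (F : I -> V -> K) :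
  (forall i, P i -> pfun (F i)) -> pfun (fun v => \prod_(i <- r | P i) F i v).
Proof. exact: (algebra_prod (P := @pfun V) pfunC pfunM). Qed.

Lemma pfun_linear (f : {linear V -> K^o}) : pfun f.
Proof.
exists (\sum_(i < \dim {:V}) f (vbasis {:V})`_i *: 'X_i) => v.
rewrite {1}(coord_vbasis (memvf v)) linear_sum raddf_sum /=; apply: eq_bigr => i _.
by rewrite linearZ /= mevalZ mevalXU mulrC.
Qed.

Lemma pfun_meval n (q : {mpoly K[n]}) (h : 'I_n -> V -> K) :
  (forall i, pfun (h i)) -> pfun (fun v => q.@[fun i => h i v]).
Proof. exact: (algebra_meval (P := @pfun V) pfunC pfunD pfunM). Qed.

(** Density arguments are all reduced to one variable by restriction to a line. *)
Lemma pfun_line f v w : pfun f -> exists p : {poly K}, forall t, f (v + t *: w) = p.[t].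
Proof.
case=> q hq; exists (\sum_(m <- msupp q) q@_m *: \prod_i
   ((coord (vbasis {:V}) i v)%:P + (coord (vbasis {:V}) i w) *: 'X) ^+ m i).
move=> t; rewrite hq mevalE horner_sum; apply: eq_bigr => m _.
rewrite hornerZ horner_prod; congr (_ * _); apply: eq_bigr => i _.
by rewrite horner_exp hornerD hornerC hornerZ hornerX linearD linearZ /= mulrC.
Qed.

End Closure.

Lemma pfun_det (V : vectType K) n (M : V -> 'M[K]_n) :
  (forall i j, pfun (fun v => M v i j)) -> pfun (fun v => \det (M v)).
Proof.
move=> h; apply: pfun_sum => s _; apply: pfunM; first exact: pfunC.
by apply: pfun_prod => i _; apply: h.
Qed.

Lemma pfun_adj (V : vectType K) n (M : V -> 'M[K]_n) :
  (forall i j, pfun (fun v => M v i j)) ->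
  forall i j, pfun (fun v => (\adj (M v)) i j).
Proof.
move=> h i j; apply: (@pfun_eq _ (fun v => (-1) ^+ (j + i) * \det (row' j (col' i (M v))))).
  by move=> v; rewrite mxE.
apply: pfunM; first exact: pfunC.
apply: pfun_det => i' j'; apply: pfun_eq (h (lift j i') (lift i j')) => v.
by rewrite !mxE.
Qed.

(** Regular functions on the locus [delta != 0].  Denominators are cleared, so
    that nothing is claimed about [f] where [delta] vanishes. *)
Definition rfun (V : vectType K) (delta f : V -> K) : Prop :=
  exists e h, pfun h /\ forall v, delta v != 0 -> delta v ^+ e * f v = h v.

Section RClosure.
Variables (V : vectType K) (delta : V -> K).
Hypothesis pdelta : pfun delta.
Implicit Types f g : V -> K.

Lemma pfun_rfun f : pfun f -> rfun delta f.
Proof. by move=> hf; exists 0%N, f; split=> // v _; rewrite expr0 mul1r. Qed.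

Lemma rfun_eq f g : (forall v, delta v != 0 -> f v = g v) -> rfun delta f -> rfun delta g.
Proof. by move=> fg [e [h [ph hh]]]; exists e, h; split=> // v d0; rewrite -fg // hh. Qed.

Lemma rfunD f g : rfun delta f -> rfun delta g -> rfun delta (fun v => f v + g v).
Proof.
move=> [e [h [ph hh]]] [e' [h' [ph' hh']]].
exists (e + e')%N, (fun v => delta v ^+ e' * h v + delta v ^+ e * h' v); split.
  by apply: pfunD; apply: pfunM => //; apply: pfunX.
by move=> v d0; rewrite -hh // -hh' // exprD; ring.
Qed.

Lemma rfunM f g : rfun delta f -> rfun delta g -> rfun delta (fun v => f v * g v).
Proof.
move=> [e [h [ph hh]]] [e' [h' [ph' hh']]].
exists (e + e')%N, (fun v => h v * h' v); split; first exact: pfunM.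
by move=> v d0; rewrite -hh // -hh' // exprD; ring.
Qed.

Lemma rfun_div f g k : pfun g -> pfun k -> (forall v, delta v != 0 -> f v * g v = k v) ->
  (exists h, pfun h /\ forall v, delta v = g v * h v) -> rfun delta f.
Proof.
move=> pg pk fg [h [ph dh]]; exists 1%N, (fun v => k v * h v); split; first exact: pfunM.
by move=> v d0; rewrite expr1 dh -fg //; ring.
Qed.

Lemma rfun_meval n (q : {mpoly K[n]}) (h : 'I_n -> V -> K) :
  (forall i, rfun delta (h i)) -> rfun delta (fun v => q.@[fun i => h i v]).
Proof. exact: (algebra_meval (P := rfun delta) (fun c => pfun_rfun (pfunC V c)) rfunD rfunM). Qed.

End RClosure.

(** There are [(s + 1) ^ k] monomials in the [f i] with exponents at most [s].
    Multiplied by a common power of [delta] they become polynomials of size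
    [O(s)] in [\dim {:V}] variables, hence elements of a space of dimension
    [O(s ^ \dim {:V})], which is smaller when [s] is large. *)
Lemma rfun_dependence (V : vectType K) (delta : V -> K) k (f : 'I_k -> V -> K) :
  pfun delta -> (forall i, rfun delta (f i)) -> (\dim {:V} < k)%N ->
  exists2 P : {mpoly K[k]}, P != 0 &
    forall v, delta v != 0 -> P.@[fun i => f i v] = 0.
Proof.
move=> [D hD] rf ltk; set m := \dim {:V} in D hD ltk.
have : exists e, exists h : 'I_k -> {mpoly K[m]}, forall i v, delta v != 0 ->
    delta v ^+ e * f i v = (h i).@[fun i => coord (vbasis {:V}) i v].
  have [e he] := choice rf.
  have [h hh] := choice he.
  have : forall i, exists q : {mpoly K[m]}, forall v, h i v = q.@[fun i => coord (vbasis {:V}) i v].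
    by move=> i; have [[q hq] _] := hh i; exists q.
  case/choice => q hq; exists (\sum_i e i)%N.
  exists (fun i => q i * D ^+ (\sum_(j | j != i) e j)) => i v d0.
  rewrite mevalM rmorphXn /= -hq -hD; have [_ <-//] := hh i.
  by rewrite (bigD1 i) //= exprD; ring.
case=> e [h hh].
(* [B s] bounds the sizes of the products and is at most [c (s + 1)], so that
   [s = c ^ m] makes [(s + 1) ^ k] larger than [B s ^ m]. *)
pose b := (\max_i msize (h i) + msize D)%N.
have hb i : (msize (h i) <= b.+1)%N.
  by rewrite leqW // /b (leq_trans (@leq_bigmax _ (fun i => msize (h i)) i)) ?leq_addr.
have Db : (msize D <= b.+1)%N by rewrite leqW // leq_addl.
pose B s := (b * (k * s * (1 + e))).+1.
pose c := (b * (k * (1 + e))).+1; pose s := (c ^ m)%N.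
have ss : (B s ^ m < s.+1 ^ k)%N.
  apply: (@leq_ltn_trans ((c * s.+1) ^ m)%N).
    have le : (B s <= c * s.+1)%N by rewrite /B /c; nia.
    by elim: (m) => // r IHr; rewrite !expnS leq_mul.
  rewrite expnMn -/s; apply: (@leq_trans (s.+1 ^ m.+1)%N); last by rewrite leq_pexp2l.
  by rewrite expnS ltn_pmul2r ?expn_gt0.
pose G (a : {ffun 'I_k -> 'I_s.+1}) : {mpoly K[m]} :=
  \prod_i h i ^+ a i * D ^+ (e * (k * s - \sum_i a i)).
have suma (a : {ffun 'I_k -> 'I_s.+1}) : (\sum_i a i <= k * s)%N.
  apply: leq_trans (_ : \sum_(i < k) s <= _)%N; last by rewrite sum_nat_const card_ord.
  by apply: leq_sum => i _; rewrite -ltnS.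
have sG a : (msize (G a) <= B s)%N.
  have h1 : (msize (\prod_i h i ^+ a i) <= (b * \sum_i a i).+1)%N.
    by rewrite big_distrr /=; apply: msize_prod_le => i; apply: msize_exp_le.
  have h2 := msize_exp_le (e * (k * s - \sum_i a i)) Db.
  apply: leq_trans (msize_mul_le h1 h2) _; rewrite ltnS /B.
  have := suma a; set S := (\sum_i _)%N => leS.
  apply: (@leq_trans (b * (k * s) + b * (e * (k * s)))%N); last by nia.
  by rewrite leq_add // leq_mul2l ?leS ?orbT // leq_mul2l leq_subr !orbT.
have [|c0 [a0 ca0] sum0] := mpoly_linear_dependence sG.
  by rewrite card_ffun !card_ord.
pose mn (a : {ffun 'I_k -> 'I_s.+1}) := [multinom (a i : nat) | i < k].
have mnI : injective mn.
  move=> a a' /mnmP aa'; apply/ffunP => i; apply: val_inj.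
  by have := aa' i; rewrite !mnmE.
exists (\sum_a c0 a *: 'X_[mn a]).
  apply: contraNneq ca0 => /(congr1 (mcoeff (mn a0))).
  rewrite raddf_sum /= mcoeff0 (bigD1 a0) //= mcoeffZ mcoeffX eqxx mulr1 big1 ?addr0.
    by move=> ->.
  by move=> a na; rewrite mcoeffZ mcoeffX (inj_eq mnI) (negbTE na) mulr0.
move=> v d0.
have /(congr1 (meval (fun i => coord (vbasis {:V}) i v))) := sum0.
rewrite raddf_sum /= meval0 => E.
apply: (mulfI (expf_neq0 (e * (k * s))%N d0)); rewrite mulr0 -[RHS]E.
rewrite raddf_sum /= mulr_sumr; apply: eq_bigr => a _.
rewrite !mevalZ mulrCA; congr (_ * _); rewrite mevalX mevalM rmorphXn rmorph_prod /= -hD.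
have -> : (e * (k * s) = e * (\sum_i a i) + e * (k * s - \sum_i a i))%N.
  by rewrite -mulnDr subnKC.
rewrite exprD mulrAC; congr (_ * _).
rewrite big_distrr /= -prodrXr -big_split /=; apply: eq_bigr => i _.
by rewrite mnmE rmorphXn /= -hh // exprMn exprM.
Qed.
End PFun.

(** * Irreducible sets and chains *)

Local Open Scope classical_set_scope.

Section Topology.
Variable K : numFieldType.
Variables (T : Type) (cl : set (set T)).

Lemma irreducible_closure (X Y : set T) : irreducible cl X -> X `<=` Y ->
  (forall C, cl C -> X `<=` C -> Y `<=` C) -> irreducible cl Y.
Proof.
move=> [[x Xx] irX] XY YC; split; first by exists x; apply: XY.
move=> Z1 Z2 c1 c2 YZ; have [|h|h] := irX Z1 Z2 c1 c2.
- by move=> z /XY /YZ.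
- by left; apply: YC.
- by right; apply: YC.
Qed.

(** A form of density that survives restriction to subspaces and is easily
    checked: no line of [W] through the origin meets [U] in the zeros of a nonzero
    polynomial only. *)
Definition line_dense (V : lmodType K) (W U : set V) : Prop :=
  forall w, W w -> forall p : {poly K}, p != 0 -> exists2 t, p.[t] != 0 & U (t *: w).

(** Continuity of [phi] on [U], for the topology defined by polynomial
    functions. *)
Definition pclosed (V : vectType K) (phi : V -> T) (U : set V) : Prop :=
  forall Z, cl Z -> exists2 I : set (V -> K), (forall f, I f -> pfun f) &
    forall u, U u -> (Z (phi u) <-> forall f, I f -> f u = 0).

(** If neither of two closed sets contains the image, then some equation of the
    first one and some equation of the second one have a product that does not
    vanish at some [w] of [W].  On the line through [w] it is a nonzero polynomial,
    hence nonzero at a point of [U], whose image lies in neither. *)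
Lemma irreducible_image (V : vectType K) (phi : V -> T) (W U : set V) :
  (forall v w (s t : K), W v -> W w -> W (s *: v + t *: w)) -> W 0 ->
  U `<=` W -> line_dense W U -> pclosed phi U -> irreducible cl (phi @` U).
Proof.
move=> linW W0 UW dU pc; split.
  have [t _ Ut] := dU 0 W0 1 (oner_neq0 _); by exists (phi (t *: 0)); exists (t *: 0).
move=> Z1 Z2 /pc[I1 pI1 h1] /pc[I2 pI2 h2] UZ.
apply: contrapT => /not_orP[/existsNP[y1 /not_implyP[[v1 Uv1 <-] n1]]].
move=> /existsNP[y2 /not_implyP[[v2 Uv2 <-] n2]].
have [f1 If1 f1v] : exists2 f, I1 f & f v1 <> 0.
  apply: contrapT => h; apply: n1; apply/(h1 _ Uv1) => f If.
  by apply: contrapT => fv; apply: h; exists f.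
have [f2 If2 f2v] : exists2 f, I2 f & f v2 <> 0.
  apply: contrapT => h; apply: n2; apply/(h2 _ Uv2) => f If.
  by apply: contrapT => fv; apply: h; exists f.
have pf : pfun (fun v => f1 v * f2 v) by apply: pfunM; [exact: pI1|exact: pI2].
have [w Ww fw] : exists2 w, W w & f1 w * f2 w <> 0.
  have [p1 hp1] := pfun_line v1 (v2 - v1) (pI1 _ If1).
  have [p2 hp2] := pfun_line v1 (v2 - v1) (pI2 _ If2).
  have : p1 * p2 != 0.
    rewrite mulf_neq0 //; apply/eqP => p0.
      by apply: f1v; have := hp1 0; rewrite scale0r addr0 p0 horner0.
    by apply: f2v; have := hp2 1; rewrite scale1r addrC subrK p0 horner0.
  case/poly_fun_neq0 => t; rewrite hornerM -hp1 -hp2 => /eqP nz.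
  exists (v1 + t *: (v2 - v1)) => //.
  have -> : v1 + t *: (v2 - v1) = (1 - t) *: v1 + t *: v2.
    by rewrite scalerBr scalerBl scale1r addrA addrAC.
  by apply: linW; apply: UW.
have [p hp] := pfun_line 0 w pf.
have p0 : p != 0.
  by apply/eqP => p0; apply: fw; have := hp 1; rewrite scale1r add0r p0 horner0.
have [t pt Ut] := dU w Ww p p0; move: pt; rewrite -hp add0r => /eqP; apply.
have /UZ : (phi @` U) (phi (t *: w)) by exists (t *: w).
by case=> [/(h1 _ Ut)/(_ _ If1)|/(h2 _ Ut)/(_ _ If2)] ->; rewrite ?mul0r ?mulr0.
Qed.

(** The chain consists of the closures of the images of the coordinate
    subspaces. *)
Lemma dimension_lower_bound (Y : set T) m (phi : 'rV[K]_m -> T) (U : set 'rV[K]_m) :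
  (forall F : set (set T), F `<=` cl -> cl [set y | forall C, F C -> C y]) ->
  line_dense setT U -> pclosed phi U -> phi @` U `<=` Y ->
  (forall j : 'I_m, exists2 C, cl C &
     forall u, U u -> (forall j' : 'I_m, (j < j')%N -> u 0 j' = 0) ->
       (C (phi u) <-> u 0 j = 0)) ->
  exists Z, irreducible_chain cl Y m Z.
Proof.
move=> clI dU pc UY sep.
pose W i : set 'rV[K]_m := [set u | forall j : 'I_m, (i <= j)%N -> u 0 j = 0].
pose X i := phi @` (U `&` W i).
pose A i := [set y | forall C, cl C /\ X i `<=` C -> C y].
exists (fun i => Y `&` A i).
have XZ i : X i `<=` Y `&` A i.
  move=> y Xy; split; last by move=> C [_]; apply.
  by apply: UY; case: Xy => u [Uu _] <-; exists u.
have clA i : cl (A i) by apply: clI => C [].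
split=> i im.
  split; first by exists (A i).
  apply: irreducible_closure (XZ i) _.
    apply: (@irreducible_image _ phi (W i) (U `&` W i)).
    - by move=> v w s t Wv Ww j ij; rewrite !mxE Wv // Ww // !mulr0 addr0.
    - by move=> j _; rewrite mxE.
    - by move=> u [].
    - move=> w Ww p p0; have [//|t pt Ut] := dU w _ p p0; exists t => //; split=> // j ij.
      by rewrite mxE Ww // mulr0.
    - by move=> Z /pc[I pI hI]; exists I => // u [Uu _]; apply: hI.
  by move=> C cC XC y [_]; apply.
have WS : W i `<=` W i.+1 by move=> u Wu j ij; apply: Wu; apply: ltnW.
split.
  move=> y [Yy Ay]; split=> // C [cC XC]; apply: Ay; split=> // z [u [Uu Wu] <-].
  by apply: XC; exists u => //; split=> //; apply: WS.
move=> sub; have [C cC hC] := sep (Ordinal im).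
have [//|t t0 Ut] := dU (delta_mx 0 (Ordinal im)) _ 'X (negbT (polyX_eq0 _)).
rewrite hornerX in t0.
have : X i.+1 (phi (t *: delta_mx 0 (Ordinal im))).
  eexists; last reflexivity; split=> // j ij; rewrite !mxE.
  by rewrite eqxx /= -val_eqE /= gtn_eqF ?mulr0.
move/XZ/sub => [_ /(_ C)] h; have : C (phi (t *: delta_mx 0 (Ordinal im))).
  apply: h; split=> // y [u [Uu Wu] <-]; apply/hC => //.
    by move=> j ij; apply: Wu; apply: ltnW.
  exact: Wu.
move/hC; rewrite !mxE !eqxx mulr1 => h'; move/eqP: t0; apply; apply: h'; first exact: Ut.
by move=> j ij; rewrite !mxE eqxx /= -val_eqE /= gtn_eqF ?mulr0.
Qed.

(** What the bound on chains needs from the functions regular off [C0]: they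
    form an algebra that defines the closed sets, and more than [m] of them are
    algebraically dependent. *)
Record regular_functions (Y C0 : set T) (m : nat) (Rg : set (T -> K)) : Prop := {
  regC : forall c, Rg (fun=> c);
  regD : forall f g, Rg f -> Rg g -> Rg (fun y => f y + g y);
  regM : forall f g, Rg f -> Rg g -> Rg (fun y => f y * g y);
  reg_zeros : forall f, Rg f ->
    exists2 C, cl C & forall z, Y z -> (C z <-> C0 z \/ f z = 0);
  reg_separate : forall C z, cl C -> Y z -> ~ C0 z -> ~ C z ->
    exists2 f, Rg f & f z != 0 /\ forall z', Y z' -> ~ C0 z' -> C z' -> f z' = 0;
  reg_dependent : forall k (f : 'I_k -> T -> K), (m < k)%N ->
    (forall i, Rg (f i)) ->
    exists2 P : {mpoly K[k]}, P != 0 &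
      forall z, Y z -> ~ C0 z -> P.@[fun i => f i z] = 0 }.

(** A chain [Z_0 < ... < Z_k] gives functions [f_i] that vanish on [Z_i] but not
    on [Z_(i+1)].  A relation between [f_0, ..., f_j] on [Z_(j+1)] may be divided
    by powers of [f_j], because [Z_(j+1)] is irreducible; restricting it to
    [Z_j], where [f_j = 0], leaves a relation between the previous ones.  So the
    [f_i] are algebraically independent. *)
Lemma dimension_upper_bound (Y : set T) m :
  (forall y, Y y -> exists C0 Rg,
    [/\ cl C0, ~ C0 y & regular_functions Y C0 m Rg]) ->
  forall k Z, irreducible_chain cl Y k Z -> (k <= m)%N.
Proof.
move=> loc k Z [Zirr Zlt].
have [y Zy] : (Z 0%N) !=set0 by have [] := (Zirr 0%N isT).2.
have ZY i : (i <= k)%N -> Z i `<=` Y.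
  by move=> ik; have [[A _ ->] _] := Zirr i ik; apply: subIset; left.
have Zmono i : (i <= k)%N -> Z 0%N `<=` Z i.
  elim: i => [|i IHi] ik z Zz; first by [].
  by apply: (Zlt i ik).1; apply: IHi (ltnW ik) _ Zz.
have [C0 [Rg [c0 ny [Rc RD RM Rcl Rsep Rdep]]]] := loc y (ZY 0%N isT y Zy).
have step i : (i < k)%N -> exists2 f, Rg f &
    (forall z, Z i z -> ~ C0 z -> f z = 0) /\ exists z, [/\ Z i.+1 z, ~ C0 z & f z != 0].
  move=> ik; have [[A cA ZA] _] := Zirr i (ltnW ik).
  have [_ [_ irr]] := Zirr i.+1 ik.
  have [z [Zz nz nA]] : exists z, [/\ Z i.+1 z, ~ C0 z & ~ A z].
    apply: contrapT => h; have : Z i.+1 `<=` A `|` C0.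
      move=> z Zz; apply: contrapT => /not_orP[nA nC]; apply: h; by exists z.
    case/(irr _ _ cA c0) => sub; last by apply: ny; apply: sub; apply: Zmono.
    apply: (Zlt i ik).2 => z Zz; rewrite ZA; split; last exact: sub.
    exact: (ZY i.+1).
  have [f Rf [fz f0]] := Rsep A z cA (ZY i.+1 ik z Zz) nz nA.
  exists f => //; split; last by exists z.
  by move=> z' Zz'; move: (Zz'); rewrite ZA => -[Yz' Az'] nC; apply: f0.
have [f hf] : exists f : nat -> T -> K, forall i, (i < k)%N -> [/\ Rg (f i),
    forall z, Z i z -> ~ C0 z -> f i z = 0 &
    exists z, [/\ Z i.+1 z, ~ C0 z & f i z != 0]].
  have : forall i, exists f, (i < k)%N -> [/\ Rg f,
      forall z, Z i z -> ~ C0 z -> f z = 0 &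
      exists z, [/\ Z i.+1 z, ~ C0 z & f z != 0]].
    move=> i; have [/step[f Rf hf]|_] := ltnP i k; first by exists f => _; split; case: hf.
    by exists (fun=> 0).
  by case/choice => f hf; exists f.
have indep j (P : {mpoly K[j]}) : (j <= k)%N ->
    (forall z, Z j z -> ~ C0 z -> P.@[fun i => f i z] = 0) -> P = 0.
  elim: j P => [|j IHj] P jk P0.
    have := P0 y Zy ny; rewrite (nvar0_mpolyC P) mevalC => ->; exact: mpolyC0.
  apply/eqP/negPn/negP => Pn0.
  have [Rfj fj0 [z0 [Zz0 nz0 fz0]]] := hf j jk.
  have RP (Q : {mpoly K[j]}) : Rg (fun z => Q.@[fun i : 'I_j => f i z]).
    by apply: (algebra_meval Rc RD RM) => i; have [] := hf i (ltn_trans (ltn_ord i) jk).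
  (* [P = R 'X^e] in the last variable, where [R] has a nonzero constant
     coefficient; the factor [f j ^ e] is not zero on [Z j.+1], so that [R]
     vanishes there, and on [Z j] only its constant coefficient remains. *)
  have Q0 : exists e, (muni P)`_e != 0.
    apply: contrapT => h; case/negP: Pn0; apply/eqP/mpolyP => mu.
    rewrite mcoeff0 -muni_coef.
    have [->|h'] := eqVneq (muni P)`_(mu ord_max) 0; first by rewrite mcoeff0.
    by case: h; exists (mu ord_max).
  pose e := ex_minn Q0.
  have eP : (muni P)`_e != 0 by rewrite /e; case: ex_minnP.
  have em e' : (e' < e)%N -> (muni P)`_e' = 0.
    rewrite /e; case: ex_minnP => e0 _ me lt; apply/eqP/negPn/negP => /me.
    by rewrite leqNgt lt.
  pose R := drop_poly e (muni P).
  have PR : muni P = R * 'X^e.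
    rewrite -[LHS](poly_take_drop e) (_ : take_poly e (muni P) = 0) ?add0r //.
    by apply/polyP => e'; rewrite coef_take_poly coef0; case: ltnP => // /em.
  pose g z := \sum_(i <- iota 0 (size R)) (R`_i).@[fun i : 'I_j => f i z] * f j z ^+ i.
  have Rgg : Rg g by apply: (algebra_sum Rc RD) => i _; apply: (RM) => //; apply: (algebra_exp Rc RM).
  have Pg z : P.@[fun i : 'I_j.+1 => f i z] = g z * f j z ^+ e.
    rewrite muni_eval PR rmorphM /= map_polyXn hornerM hornerXn; congr (_ * _).
    rewrite (@horner_coef_wide _ (size R)) ?size_poly //.
    rewrite /g -[X in iota 0 X]subn0 -/(index_iota 0 _) big_mkord.
    by apply: eq_bigr => i _; rewrite coef_map.
  have [Cg cCg hCg] := Rcl g Rgg; have [Cf cCf hCf] := Rcl _ Rfj.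
  have [_ [_ irr]] := Zirr j.+1 jk.
  have g0 z : Z j.+1 z -> ~ C0 z -> g z = 0.
    have sub : Z j.+1 `<=` Cg `|` Cf.
      move=> z' Zz'; have Yz' := ZY j.+1 jk z' Zz'.
      have [Cz|nC] := pselect (C0 z'); first by left; apply/hCg => //; left.
      have := P0 z' Zz' nC; rewrite Pg => /eqP; rewrite mulf_eq0 => /orP[/eqP h|].
        by left; apply/hCg => //; right.
      by rewrite expf_eq0 => /andP[_ /eqP h]; right; apply/hCf => //; right.
    move=> Zz nC; case: (irr Cg Cf) => // sub'.
      by have /hCg[|//|] := sub' z Zz; first exact: (ZY j.+1).
    have /hCf[|//|/eqP] := sub' z0 Zz0; first exact: (ZY j.+1).
    by rewrite (negbTE fz0).
  have : (muni P)`_e = 0.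
    have -> : (muni P)`_e = R`_0 by rewrite coef_drop_poly.
    apply: IHj; first exact: ltnW.
    move=> z Zz nC; have := g0 z ((Zlt j jk).1 z Zz) nC.
    rewrite /g; case E : (size R) => [|s].
      by rewrite nth_default ?E // meval0.
    rewrite /= big_cons expr0 mulr1 big_seq big1 ?addr0 // => i.
    by rewrite mem_iota => /andP[i0 _]; rewrite fj0 // expr0n gtn_eqF ?mulr0.
  by move/eqP; apply/negP.
rewrite leqNgt; apply/negP => mk.
have [P P0 hP] := Rdep k (fun i => f i) mk (fun i => let: And3 h _ _ := hf i (ltn_ord i) in h).
move/eqP: P0; apply; apply: indep => // z Zz nC; apply: hP => //; exact: (ZY k).
Qed.
End Topology.

(** * Forms on lines *)

Section Forms.
Variable K : numClosedFieldType.

Section General.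
Variable n : nat.
Implicit Types (F G : {mpoly K[n]}) (q w x : 'rV[K]_n).

Lemma homog_scale d F c x : F \is d.-homog -> F.@[(c *: x) 0] = c ^+ d * F.@[x 0].
Proof.
move=> /dhomogP hF; rewrite !mevalE mulr_sumr [LHS]big_seq [RHS]big_seq.
apply: eq_bigr => m mF; have <- : mdeg m = d := hF m mF; rewrite mulrCA mdegE -prodrXr -big_split /=.
by congr (_ * _); apply: eq_bigr => i _; rewrite mxE exprMn.
Qed.

Lemma homog_eval0 d F : (0 < d)%N -> F \is d.-homog -> F.@[(0 : 'rV[K]_n) 0] = 0.
Proof. by move=> d0 hF; rewrite -[0 in LHS](scale0r 0) (homog_scale _ _ hF) expr0n gtn_eqF // mul0r. Qed.

Lemma homog_deriv d F i : F \is d.+1.-homog -> F^`M(i) \is d.-homog.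
Proof.
move=> /dhomogP hF; apply/dhomogP => m; rewrite mcoeff_msupp mcoeff_deriv => h.
have /hF /= : (m + U_(i))%MM \in msupp F.
  by rewrite mcoeff_msupp; apply: contraNneq h => ->; rewrite mul0rn.
by rewrite mdegD mdeg1 addn1 => -[].
Qed.

Definition line F q w : {poly K} := mmap polyC (fun i => (q 0 i)%:P + (w 0 i)%:P * 'X) F.

Lemma line_eval F q w t : (line F q w).[t] = F.@[(q + t *: w) 0].
Proof.
rewrite /line /mmap mevalE horner_sum; apply: eq_bigr => m _.
rewrite hornerM hornerC /mmap1 horner_prod; congr (_ * _); apply: eq_bigr => i _.
by rewrite horner_exp hornerD hornerM !hornerC hornerX !mxE [t * _]mulrC.
Qed.

Lemma line_eq F G q w q' w' :
  (forall t, F.@[(q + t *: w) 0] = G.@[(q' + t *: w') 0]) -> line F q w = line G q' w'.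
Proof.
move=> h; apply/eqP; rewrite -subr_eq0; apply/eqP/poly_fun_eq0 => t.
by rewrite hornerD hornerN !line_eval h subrr.
Qed.
End General.

Section Derivatives.
Variable n : nat.
Local Notation V := 'rV[K]_n.+1.
Implicit Types (F G : {mpoly K[n.+1]}) (p q w x : V) (W : {vspace V}).

Lemma dirderD w F G : dirder w (F + G) = dirder w F + dirder w G.
Proof. by rewrite -big_split; apply: eq_bigr => i _; rewrite /= mderivD scalerDr. Qed.

Lemma dirderM w F G : dirder w (F * G) = dirder w F * G + F * dirder w G.
Proof.
rewrite mulr_suml mulr_sumr -big_split; apply: eq_bigr => i _.
by rewrite /= mderivM scalerDr scalerAl scalerAr.
Qed.

Lemma dirderC w c : dirder w c%:MP = 0.
Proof. by apply: big1 => i _; rewrite mderivC scaler0. Qed.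

Lemma dirderXU w i : dirder w 'X_i = (w 0 i)%:MP.
Proof.
rewrite /dirder (bigD1 i) //= mderivX mnm1E eqxx scale1r.
have -> : (U_(i) - U_(i))%MM = 0%MM by apply/mnmP => j; rewrite mnmBE subnn mnm0E.
rewrite big1 ?addr0 => [|j nj]; first by rewrite -mul_mpolyC mpolyX0 mulr1.
by rewrite mderivX mnm1E eq_sym (negbTE nj) scale0r scaler0.
Qed.

(** Both sides are derivations in [F], so that constants and variables are
    enough. *)
Lemma line_deriv F q w : (line F q w)^`() = line (dirder w F) q w.
Proof.
have lC c : line c%:MP q w = c%:P by rewrite /line mmapC.
have lD A B : line (A + B) q w = line A q w + line B q w by rewrite /line mmapD.
have lM A B : line (A * B) q w = line A q w * line B q w by rewrite /line rmorphM.
have HM A B : (line A q w)^`() = line (dirder w A) q w ->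
    (line B q w)^`() = line (dirder w B) q w ->
    (line (A * B) q w)^`() = line (dirder w (A * B)) q w.
  by move=> hA hB; rewrite dirderM lM lD !lM derivM hA hB.
have HC c : (line c%:MP q w)^`() = line (dirder w c%:MP) q w.
  by rewrite lC dirderC derivC (lC 0).
elim/mpolyind: F => [|c m F _ _ IHF]; first exact: (HC 0).
rewrite dirderD !lD derivD IHF; congr (_ + _).
rewrite -mul_mpolyC; apply: (HM); first exact: HC.
rewrite mpolyXE_id; apply: (big_ind (fun A => (line A q w)^`() = line (dirder w A) q w)); [exact: (HC 1)|by move=> A B; apply: HM|move=> i _].
elim: (m i) => [|k IHk]; first by rewrite expr0; apply: (HC 1).
rewrite exprS; apply: (HM) => //.
rewrite dirderXU lC /line mmapX mmap1U derivD derivC derivM derivX derivC.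
by rewrite mul0r !add0r mulr1.
Qed.

Lemma line_size d F q w : F \is d.-homog -> (size (line F q w) <= d.+1)%N.
Proof.
move=> /dhomogP hF; rewrite /line /mmap big_seq.
apply: (leq_trans (size_sum _ _ _)); apply/bigmax_leqP_seq => m mF _.
rewrite mul_polyC; apply: (leq_trans (size_scale_leq _ _)).
have <- : mdeg m = d := hF m mF; rewrite mdegE /mmap1.
elim/big_rec2: _ => [|i a b _ IH]; first by rewrite size_poly1.
apply: (leq_trans (size_polyMleq _ _)).
pose l : {poly K} := (q 0 i)%:P + (w 0 i)%:P * 'X; rewrite -/l.
have : (size (l ^+ m i)%R <= (m i).+1)%N.
  apply: (leq_trans (size_poly_exp_leq _ _)); rewrite ltnS.
  have : (size l <= 2)%N.
    apply: (leq_trans (size_polyD _ _)); rewrite geq_max size_polyC.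
    rewrite (leq_trans (leq_b1 _)) // mul_polyC.
    by apply: (leq_trans (size_scale_leq _ _)); rewrite size_polyX.
  by case: (size _) => [|[|[|]]] //= _; rewrite ?mul0n ?mul1n.
by move: IH; case: (size _) => [|?]; case: (size _) => [|?] //=; lia.
Qed.
End Derivatives.
End Forms.

(** * Cones and sections by subspaces *)

Section Cones.
Variable K : numClosedFieldType.
Variable n : nat.
Local Notation V := 'rV[K]_n.+1.
Implicit Types (F G : {mpoly K[n.+1]}) (p q w x : V) (W : {vspace V}).

(** For a form, this says that [F = 0] is a cone over [p] in [W]. *)
Definition invariant_along W F p :=
  forall q, q \in W -> forall t, F.@[(q + t *: p) 0] = F.@[q 0].

Lemma dirder_homog d w F : F \is d.+1.-homog -> dirder w F \is d.-homog.
Proof. by move=> hF; apply: rpred_sum => i _; apply/rpredZ/homog_deriv. Qed.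

Lemma foldr_dirder_homog d F ws : F \is d.-homog -> (size ws <= d)%N ->
  foldr (@dirder K n) F ws \is (d - size ws).-homog.
Proof.
move=> hF; elim: ws => [|w ws IHws] /= le; first by rewrite subn0.
by apply: dirder_homog; rewrite -subSn //= subSS IHws // ltnW.
Qed.

Lemma invariant_dirder W F p w : p \in W -> w \in W -> invariant_along W F p ->
  invariant_along W (dirder w F) p.
Proof.
move=> pW wW inv q qW t.
have h0 G q' : G.@[q' 0] = (line G q' w).[0] by rewrite line_eval scale0r addr0.
rewrite !h0 -!line_deriv; congr (_^`()).[_]; apply: line_eq => s.
rewrite addrAC inv //; apply: memvD => //; exact: memvZ.
Qed.

Lemma invariant_vanishes d W F p : F \is d.-homog -> p \in W ->
  invariant_along W F p -> vanishes_to_order W F p d.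
Proof.
move=> hF pW inv ws lt sub.
have {}inv : invariant_along W (foldr (@dirder K n) F ws) p.
  elim: ws sub {lt} => //= w ws IHws sub; apply: invariant_dirder => //.
    by apply: sub; rewrite mem_head.
  by apply: IHws => x xws; apply: sub; rewrite in_cons xws orbT.
have := inv 0 (mem0v _) 1; rewrite add0r scale1r => ->.
by apply: homog_eval0 (foldr_dirder_homog hF (ltnW lt)); rewrite subn_gt0.
Qed.

Lemma line_derivn F q w k : (line F q w)^`(k) = line (foldr (@dirder K n) F (nseq k w)) q w.
Proof. by elim: k => [|k IHk] //; rewrite derivnS IHk line_deriv. Qed.

Lemma line_coef F q w k :
  (line F q w)`_k *+ k`! = (foldr (@dirder K n) F (nseq k w)).@[q 0].
Proof.
have -> : (foldr (@dirder K n) F (nseq k w)).@[q 0] = ((line F q w)^`(k))`_0.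
  by rewrite line_derivn -horner_coef0 line_eval scale0r addr0.
by rewrite coef_derivn addn0 ffactnn.
Qed.

(** The polynomial [s |-> F (p + s q)] has degree at most [d], and its
    coefficients below [d] vanish; so [F (q + s p) = s^d F (p + q / s)] does not
    depend on [s != 0], hence not on [s]. *)
Lemma vanishes_invariant d W F p : F \is d.-homog -> p \in W ->
  vanishes_to_order W F p d -> invariant_along W F p.
Proof.
move=> hF pW van q qW.
pose r := line F p q.
have rk k : (k < d)%N -> r`_k = 0.
  move=> kd; have := line_coef F p q k; rewrite van ?size_nseq //; last first.
    by move=> x /nseqP[-> _].
  by move/eqP; rewrite mulrn_eq0 -leqn0 leqNgt fact_gt0 /= => /eqP.
have rE : r = r`_d *: 'X^d.
  apply/polyP => k; rewrite coefZ coefXn; case: (ltngtP k d) => [/rk ->|kd|->].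
  - by rewrite mulr0.
  - by rewrite mulr0 nth_default // (leq_trans (line_size _ _ hF)).
  - by rewrite mulr1.
have key s : s != 0 -> F.@[(q + s *: p) 0] = r`_d.
  move=> s0; have -> : q + s *: p = s *: (p + s^-1 *: q).
    by rewrite scalerDr scalerA mulfV // scale1r addrC.
  rewrite (homog_scale _ _ hF) -line_eval -/r rE hornerZ hornerXn coefZ coefXn eqxx mulr1.
  by rewrite mulrCA -exprMn mulfV // expr1n mulr1.
have : line F q p - (r`_d)%:P = 0.
  apply: (@poly_infinite_root _ _ (fun k => k.+1%:R)) => [i j|k].
    by move/natr_inj => [].
  by rewrite hornerD hornerN hornerC line_eval key ?subrr // pnatr_eq0.
move/eqP; rewrite subr_eq0 => /eqP lE t.
by rewrite -line_eval lE hornerC -[q in RHS]addr0 -(scale0r p) -line_eval lE hornerC.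
Qed.

(** The derivative of order [d] at [p] in the direction [x] is [d! F(x)]. *)
Lemma invariant_not_vanishes d W F p x : F \is d.-homog -> p \in W -> x \in W ->
  invariant_along W F p -> F.@[x 0] != 0 -> ~ vanishes_to_order W F p d.+1.
Proof.
move=> hF pW xW inv Fx van.
have := line_coef F p x d; rewrite van ?size_nseq //; last by move=> y /nseqP[-> _].
move/eqP; rewrite mulrn_eq0 -leqn0 leqNgt fact_gt0 /= => /eqP c0.
have key t : F.@[(t *: x) 0] = (line F p x).[t].
  by rewrite line_eval -[in RHS](scale1r p) addrC inv // memvZ.
case/negP: Fx; have := key 1; rewrite scale1r => ->.
have lE : line F p x = F.@[x 0] *: 'X^d.
  apply/eqP; rewrite -subr_eq0; apply/eqP/poly_fun_eq0 => t.
  by rewrite hornerD hornerN -key hornerZ hornerXn (homog_scale _ _ hF) mulrC subrr.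
by move: c0; rewrite lE coefZ coefXn eqxx mulr1 => ->; rewrite scale0r horner0.
Qed.

Lemma smooth_atE W F q : smooth_at W F q <->
  exists2 w, w \in W & (line F q w)^`().[0] != 0.
Proof.
by split=> -[w wW h]; exists w => //; move: h; rewrite line_deriv line_eval scale0r addr0.
Qed.

(** If [F = A G] on [W], then comparing degrees on the line through [x] shows that
    [A] may be replaced by its constant term. *)
Lemma section_ideal_eqP d W F G : F \is d.-homog -> G \is d.-homog ->
  ~ lin_ideal W F ->
  (section_ideal F W = section_ideal G W <->
   exists2 c, c != 0 & forall x, x \in W -> F.@[x 0] = c * G.@[x 0]).
Proof.
move=> hF hG nF; split=> [E|[c c0 FG]]; last first.
  have key A B a (FG' : forall x, x \in W -> A.@[x 0] = a * B.@[x 0]) :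
      section_ideal A W `<=` section_ideal B W.
    move=> f [Q [R [LR ->]]]; exists (Q * a%:MP), (Q * (A - a *: B) + R).
    split; last by rewrite -mul_mpolyC; ring.
    by move=> x xW; rewrite mevalD mevalM mevalB mevalZ LR // FG' // subrr mulr0 addr0.
  apply/seteqP; split; first exact: key FG.
  by apply: (key _ _ c^-1) => x xW; rewrite FG // mulKf.
have : section_ideal G W F.
  rewrite -E; exists 1, 0; split; first by move=> x _; rewrite meval0.
  by rewrite mul1r addr0.
case=> A [B [LB FE]].
have FW x : x \in W -> F.@[x 0] = A.@[x 0] * G.@[x 0].
  by move=> xW; rewrite FE mevalD mevalM LB // addr0.
pose c := A.@[(0 : V) 0].
have FG x : x \in W -> F.@[x 0] = c * G.@[x 0].
  move=> xW; have [G0|G0] := eqVneq G.@[x 0] 0; first by rewrite FW // G0 !mulr0.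
  have : line A 0 x - (F.@[x 0] / G.@[x 0])%:P = 0.
    apply: (@poly_infinite_root _ _ (fun k => k.+1%:R)) => [i j|k].
      by move/natr_inj => [].
    rewrite hornerD hornerN hornerC line_eval add0r.
    have := FW (k.+1%:R *: x) (memvZ _ xW).
    rewrite (homog_scale _ _ hF) (homog_scale _ _ hG) mulrCA.
    move/(mulfI (expf_neq0 _ _)) => ->; last by rewrite pnatr_eq0.
    by rewrite mulfK // subrr.
  move/eqP; rewrite subr_eq0 => /eqP lE.
  have : c = (line A 0 x).[0] by rewrite line_eval scale0r addr0.
  by rewrite lE hornerC => ->; rewrite divfK.
exists c => //; apply: contra_notN nF => /eqP c0 x xW; by rewrite FG // c0 mul0r.
Qed.

End Cones.

(** * Configurations and their equations *)

Section Triples.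
Variable K : numClosedFieldType.
Variable N : nat.
Local Notation V := 'rV[K]_N.+1.
Implicit Types (F G : {mpoly K[N.+1]}) (l p q w x v : V) (W : {vspace V}).

Definition dot l v : K := (v *m l^T) 0 0.

Lemma dotE l v : dot l v = \sum_i v 0 i * l 0 i.
Proof. by rewrite /dot mxE; apply: eq_bigr => i _; rewrite mxE. Qed.

Lemma dotC l v : dot l v = dot v l.
Proof. by rewrite !dotE; apply: eq_bigr => i _; rewrite mulrC. Qed.

Lemma dotDr l u v : dot l (u + v) = dot l u + dot l v.
Proof. by rewrite /dot mulmxDl mxE. Qed.

Lemma dotZr l c v : dot l (c *: v) = c * dot l v.
Proof. by rewrite /dot -scalemxAl mxE. Qed.

Lemma dotZl l c v : dot (c *: l) v = c * dot l v.
Proof. by rewrite dotC dotZr dotC. Qed.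

Lemma dotNr l v : dot l (- v) = - dot l v.
Proof. by rewrite -scaleN1r dotZr mulN1r. Qed.

Lemma dotBr l u v : dot l (u - v) = dot l u - dot l v.
Proof. by rewrite dotDr dotNr. Qed.

Lemma dot_delta l i : dot l (delta_mx 0 i) = l 0 i.
Proof.
rewrite dotE (bigD1 i) //= mxE !eqxx mul1r big1 ?addr0 // => j nj.
by rewrite mxE eqxx (negbTE nj) mul0r.
Qed.

Lemma mem_hyperplane l v : (v \in hyperplane l) = (dot l v == 0).
Proof.
rewrite memv_ker lfunE /= /dot; apply/eqP/eqP => [->|h]; first by rewrite mxE.
by apply/matrixP => i j; rewrite !ord1 h mxE.
Qed.

Lemma dim_hyperplane l : (\dim (hyperplane l) == N) = (l != 0).
Proof.
have dimV : \dim {:V} = N.+1 by rewrite dimvf /dim /= mul1n.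
have [->|l0] := eqVneq l 0.
  suff -> : hyperplane (0 : V) = fullv by rewrite dimV eqn_leq ltnn.
  by apply/vspaceP => v; rewrite memvf mem_hyperplane dotC /dot mul0mx mxE eqxx.
pose f : 'Hom(V, 'rV[K]_1) := linfun (mulmxr l^T); have := limg_ker_dim f fullv; rewrite capfv dimV => E.
have le1 : (\dim (limg f) <= 1)%N.
  by apply: leq_trans (dimvS (subvf _)) _; rewrite dimvf /dim /= muln1.
have : \dim (limg f) != 0%N.
  rewrite dimv_eq0; apply: contraNneq l0 => lim0; apply/eqP/rowP => i.
  rewrite mxE -dot_delta; apply/eqP; rewrite -mem_hyperplane memv_ker.
  by rewrite -memv0 -lim0 memv_img ?memvf.
by rewrite /hyperplane -/f; case: (\dim (limg f)) le1 E => [|[|]] //= _; rewrite addn1 => -[->]; rewrite eqxx.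
Qed.

Lemma hyperplane_eq l l' : l != 0 -> l' != 0 ->
  hyperplane l = hyperplane l' <-> exists2 c, c != 0 & l' = c *: l.
Proof.
move=> l0 l0'; split=> [E|[c c0 ->]]; last first.
  by apply/vspaceP => v; rewrite !mem_hyperplane dotZl mulf_eq0 (negbTE c0).
case/rV0Pn: (l0) => i li.
have key v : dot l' v = l' 0 i / l 0 i * dot l v.
  have : v - (dot l v / l 0 i) *: delta_mx 0 i \in hyperplane l'.
    by rewrite -E mem_hyperplane dotBr dotZr dot_delta divfK // subrr.
  rewrite mem_hyperplane dotBr dotZr dot_delta subr_eq0 => /eqP ->.
  by rewrite mulrC mulrCA mulrC.
have E' : l' = (l' 0 i / l 0 i) *: l.
  by apply/rowP => j; rewrite mxE -dot_delta key dot_delta.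
exists (l' 0 i / l 0 i) => //; apply: contraNneq l0' => c0.
by rewrite E' c0 scale0r.
Qed.

(** Coefficients of a linear form vanishing on a basis of [W] are found in the
    kernel of a matrix with fewer columns than rows. *)
Lemma hyperplane_surj W : \dim W = N -> exists2 l, l != 0 & W = hyperplane l.
Proof.
move=> dW; pose B := \matrix_(i < \dim W) (vbasis W)`_i.
have : kermx B^T != 0.
  rewrite -mxrank_eq0 mxrank_ker subn_eq0 -ltnNge mxrank_tr.
  by apply: leq_ltn_trans (rank_leq_row _) _; rewrite dW.
case/rowV0Pn => l /sub_kermxP lB l0; exists l => //.
have dl : \dim (hyperplane l) = N by apply/eqP; rewrite dim_hyperplane.
apply/eqP; rewrite eqEdim dW dl leqnn andbT.
apply/subvP => v /coord_vbasis ->; apply: memv_suml => i _; apply: memvZ.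
rewrite mem_hyperplane dotC; have /rowP/(_ i) := lB; rewrite [RHS]mxE => <-.
by rewrite dotE mxE; apply/eqP; apply: eq_bigr => j _; rewrite !mxE.
Qed.

Lemma line_eq_vspace p p' : p != 0 -> p' != 0 ->
  <[p]>%VS = <[p']>%VS <-> exists2 c, c != 0 & p' = c *: p.
Proof.
move=> p0 p0'; split=> [E|[c c0 ->]].
  have /vlineP[c cE] : p' \in <[p]>%VS by rewrite E memv_line.
  by exists c => //; apply: contraNneq p0' => c0; rewrite cE c0 scale0r.
apply/eqP; rewrite eqEsubv -!memvE memvZ ?memv_line // andbT.
by apply/vlineP; exists c^-1; rewrite scalerK.
Qed.

Definition nonzero_on W F := exists2 x, x \in W & F.@[x 0] != 0.

Lemma nonzero_onP W F : nonzero_on W F <-> ~ lin_ideal W F.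
Proof.
split=> [[x xW Fx] LF|]; first by move: Fx; rewrite LF // eqxx.
by move=> /existsNP[x /not_implyP[xW /eqP Fx]]; exists x.
Qed.

Definition smooth_off W F p := forall q, q \in W -> q \notin <[p]>%VS ->
  F.@[q 0] = 0 -> exists2 w, w \in W & (line F q w)^`().[0] != 0.

(** The conditions for [triple_of (l, p, F)] to be a good triple, in terms of
    values of [F] on the hyperplane. *)
Record good_equations l p F : Prop := GoodEquations {
  geq_l : l != 0; geq_p : p != 0; geq_pl : p \in hyperplane l;
  geq_F : nonzero_on (hyperplane l) F;
  geq_cone : invariant_along (hyperplane l) F p;
  geq_smooth : smooth_off (hyperplane l) F p }.

Lemma line_scale W F G c q w : q \in W -> w \in W ->
  (forall x, x \in W -> F.@[x 0] = c * G.@[x 0]) ->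
  line F q w = c *: line G q w.
Proof.
move=> qW wW FG; have -> : c *: line G q w = line (c *: G) q w.
  by rewrite /line mmapZ mul_polyC.
by apply: line_eq => t; rewrite mevalZ FG // memvD ?memvZ.
Qed.

Lemma proportional_good l p F G c : c != 0 ->
  (forall x, x \in hyperplane l -> F.@[x 0] = c * G.@[x 0]) ->
  good_equations l p F -> good_equations l p G.
Proof.
move=> c0 FG [l0 p0 pl [x xW Fx] inv sm]; split=> //.
- by exists x => //; apply: contraNneq Fx => G0; rewrite FG // G0 mulr0.
- move=> q qW t; apply: (mulfI c0); rewrite -!FG ?inv //.
  by rewrite memvD ?memvZ.
move=> q qW qp Gq; have [|w wW h] := sm q qW qp; first by rewrite FG // Gq mulr0.
exists w => //; move: h; rewrite (line_scale qW wW FG) derivZ hornerZ.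
by rewrite mulf_eq0 negb_or => /andP[].
Qed.

(** The form given by [good_cone] has the same section ideal as [F], hence is
    proportional to [F] on the hyperplane, and the conditions see nothing else of
    it. *)
Lemma good_tripleP d l p (F : dhomog N.+1 K d) :
  good_triple K N d (triple_of (l, p, F)) <-> good_equations l p F.
Proof.
rewrite /good_triple /triple_of /=; split.
  case=> /eqP; rewrite dim_hyperplane => l0.
  rewrite dim_vline; case: (eqVneq p 0) => // p0 _; rewrite -memvE => pl.
  case=> G [[hG nG E] [mult sm]].
  have nF : ~ lin_ideal (hyperplane l) F.
    move=> LF; apply: nG => x xW.
    have : section_ideal F (hyperplane l) G.
      rewrite E; exists 1, 0; split; first by move=> y _; rewrite meval0.
      by rewrite mul1r addr0.
    by case=> A [B [LB ->]]; rewrite mevalD mevalM LF // LB // mulr0 addr0.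
  have [c c0 GF] : exists2 c, c != 0 & forall x, x \in hyperplane l -> G.@[x 0] = c * F.@[x 0].
    by apply/(section_ideal_eqP hG (dhomog_is_dhomog F) nG).
  apply: (proportional_good c0 GF); split => //; first exact/nonzero_onP.
    by apply: (vanishes_invariant hG) => //; have [] := mult p (memv_line _) p0.
  by move=> q qW qp Gq; apply/smooth_atE; apply: sm.
case=> l0 p0 pl nF inv sm; split.
- by apply/eqP; rewrite dim_hyperplane.
- by rewrite dim_vline p0.
- by rewrite -memvE.
exists F; split.
  by split; [exact: dhomog_is_dhomog|exact/nonzero_onP|].
split; last by move=> q qW qp Fq; apply/smooth_atE; apply: sm.
move=> _ /vlineP[c ->]; rewrite scaler_eq0 negb_or => /andP[c0 _].
have inv' : invariant_along (hyperplane l) F (c *: p).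
  by move=> q qW t; rewrite scalerA inv.
split; first exact: invariant_vanishes (dhomog_is_dhomog F) (memvZ _ pl) inv'.
have [x xW Fx] := nF; exact: invariant_not_vanishes (dhomog_is_dhomog F) (memvZ _ pl) xW inv' Fx.
Qed.

Lemma good_triple_surj d (t : triple K N) : good_triple K N d t ->
  exists e : equations K N d, t = triple_of e.
Proof.
case: t => W P C [/= dW dP PW [F [[hF nF ->] _]]].
have [l l0 ->] := hyperplane_surj dW.
have [p p0 ->] : exists2 p, p != 0 & P = <[p]>%VS.
  exists (vpick P); first by rewrite vpick0 -dimv_eq0 dP.
  by apply/eqP; rewrite eq_sym eqEdim -memvE memv_pick dP dim_vline vpick0 -dimv_eq0 dP.
by exists (l, p, DHomog hF).
Qed.

Lemma triple_eqP d l p (F : dhomog N.+1 K d) l' p' (F' : dhomog N.+1 K d) :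
  good_equations l p F -> l' != 0 -> p' != 0 ->
  triple_of (l, p, F) = triple_of (l', p', F') <->
  [/\ exists2 c, c != 0 & l' = c *: l, exists2 c, c != 0 & p' = c *: p &
      exists2 c, c != 0 & forall x, x \in hyperplane l -> F.@[x 0] = c * F'.@[x 0] ].
Proof.
move=> [l0 p0 pl nF inv sm] l0' p0'; rewrite /triple_of; split.
  move=> E; have El := congr1 (@hyp K N) E; have Ep := congr1 (@vertex K N) E.
  have EF := congr1 (@cone K N) E; rewrite /= in El Ep EF; split; [exact/(hyperplane_eq l0 l0')|exact/(line_eq_vspace p0 p0')|].
  apply/(section_ideal_eqP (dhomog_is_dhomog F) (dhomog_is_dhomog F')).
    exact/nonzero_onP.
  by rewrite EF -El.
case=> /(hyperplane_eq l0 l0') El /(line_eq_vspace p0 p0') Ep EF.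
congr Triple => //; rewrite -El.
by apply/(section_ideal_eqP (dhomog_is_dhomog F) (dhomog_is_dhomog F')) => //; apply/nonzero_onP.
Qed.
Local Notation E d := {ffun 'I_3 -> equations K N d}.

Definition config_of d (e : E d) : 'I_3 -> triple K N := fun i => triple_of (e i).

Definition eqs_good d (e : equations K N d) := good_equations e.1.1 e.1.2 e.2.

Lemma good_configP d (e : E d) :
  good_config K N d (config_of e) <-> forall i, eqs_good (e i).
Proof.
split=> h i; have := h i; rewrite /config_of /eqs_good; case: (e i) => [[l p] F] /=.
  by move/good_tripleP.
by move=> ?; apply/good_tripleP.
Qed.

Lemma good_surj d (L : 'I_3 -> triple K N) : good_config K N d L ->
  exists2 e : E d, L = config_of e & forall i, eqs_good (e i).
Proof.
move=> gL; have : forall i, exists e : equations K N d, L i = triple_of e.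
  by move=> i; apply: good_triple_surj.
case/choice => e he; exists (finfun e).
  by apply: funext => i; rewrite /config_of ffunE.
by apply/good_configP => i; rewrite /config_of ffunE -he.
Qed.

Lemma same_config d (e e' : E d) : (forall i, eqs_good (e i)) -> (forall i, eqs_good (e' i)) ->
  config_of e = config_of e' ->
  forall i, [/\ exists2 c, c != 0 & (e' i).1.1 = c *: (e i).1.1,
   exists2 c, c != 0 & (e' i).1.2 = c *: (e i).1.2 &
   exists2 c, c != 0 & forall x, x \in hyperplane (e i).1.1 ->
     (e i).2.@[x 0] = c * (e' i).2.@[x 0]].
Proof.
move=> ge ge' ee' i; have := congr1 (fun L => L i) ee'; rewrite /config_of.
have gi := ge i; have [l0 p0 _ _ _ _] := ge' i.
rewrite [e i]surjective_pairing [(e i).1]surjective_pairing.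
rewrite [e' i]surjective_pairing [(e' i).1]surjective_pairing.
by move/(triple_eqP (e' i).2 gi l0 p0).
Qed.
End Triples.

(** * Linear substitutions and coordinates of forms *)

Section Substitution.
Variables (K : numClosedFieldType) (n : nat).

Definition msubst (A : 'M[K]_n) (F : {mpoly K[n]}) : {mpoly K[n]} :=
  F \mPo [tuple \sum_j A j i *: 'X_j | i < n].

Lemma msubst_eval A F (x : 'rV[K]_n) : (msubst A F).@[x 0] = F.@[(x *m A) 0].
Proof.
rewrite /msubst comp_mpoly_meval; apply: meval_eq => i.
rewrite tnth_mktuple raddf_sum mxE; apply: eq_bigr => j _.
by rewrite /= mevalZ mevalXU mulrC.
Qed.

Lemma prod_exp_homog (G : 'I_n -> {mpoly K[n]}) (m : 'X_{1..n}) :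
  (forall i, G i \is 1.-homog) -> \prod_i G i ^+ m i \is (mdeg m).-homog.
Proof.
move=> hG; rewrite mdegE; elim/big_rec2: _ => [|i a b _ IH]; first exact: dhomog1.
apply: dhomogM => //; have := dhomogMn (m i) (hG i); by rewrite mul1n.
Qed.

Lemma msubst_homog d A F : F \is d.-homog -> msubst A F \is d.-homog.
Proof.
move=> /dhomogP hF; rewrite /msubst comp_mpolyEX big_seq.
apply: rpred_sum => m /hF dm; apply: rpredZ; rewrite comp_mpolyX.
have <- : mdeg m = d := dm.
apply: prod_exp_homog => i; rewrite tnth_mktuple; apply: rpred_sum => j _.
by apply: rpredZ; rewrite dhomogX; apply/eqP; exact: mdeg1.
Qed.

Definition fsubst d (A : 'M[K]_n) (F : dhomog n K d) : dhomog n K d :=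
  DHomog (msubst_homog A (dhomog_is_dhomog F)).

Lemma fsubst_eval d A (F : dhomog n K d) (x : 'rV[K]_n) :
  (fsubst A F).@[x 0] = F.@[(x *m A) 0].
Proof. exact: msubst_eval. Qed.

Lemma form_scale d (F : dhomog n K d) c (x : 'rV[K]_n) : F.@[(c *: x) 0] = c ^+ d * F.@[x 0].
Proof. exact: homog_scale (dhomog_is_dhomog F). Qed.

Lemma fevalD d (F G : dhomog n K d) (x : 'rV[K]_n) : (F + G).@[x 0] = F.@[x 0] + G.@[x 0].
Proof. by rewrite /= mevalD. Qed.

Lemma fevalN d (F : dhomog n K d) (x : 'rV[K]_n) : (- F).@[x 0] = - F.@[x 0].
Proof. by rewrite /= mevalN. Qed.

Lemma fevalZ d c (F : dhomog n K d) (x : 'rV[K]_n) : (c *: F).@[x 0] = c * F.@[x 0].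
Proof. by rewrite /= mevalZ. Qed.

Definition form_at d (x : 'rV[K]_n) (F : dhomog n K d) : K^o := F.@[x 0].

Lemma form_at_linear d x : linear (@form_at d x).
Proof. by move=> a F G; rewrite /form_at /= mevalD mevalZ. Qed.
HB.instance Definition _ d x :=
  GRing.isLinear.Build K (dhomog n K d) K^o _ (@form_at d x) (@form_at_linear d x).

Lemma form_eq0 d (F : dhomog n K d) : (forall x, form_at x F = 0) -> F = 0.
Proof.
move=> h; apply/val_inj/mpoly_fun_eq0 => x.
have := h (\row_i x i); rewrite /form_at => <-; apply: meval_eq => i; by rewrite mxE.
Qed.

Definition form_coef d (m : 'X_{1..n}) (F : dhomog n K d) : K^o := F@_m.

Lemma form_coef_linear d m : linear (@form_coef d m).
Proof. by move=> a F G; rewrite /form_coef /= mcoeffD mcoeffZ. Qed.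
HB.instance Definition _ d m :=
  GRing.isLinear.Build K (dhomog n K d) K^o _ (@form_coef d m) (@form_coef_linear d m).

(** Summing over all the monomials of bounded degree, and not over the support
    of [F], makes the right-hand side polynomial in [F] too. *)
Lemma form_expand d (F : dhomog n K d) (x : 'rV[K]_n) :
  F.@[x 0] = \sum_(m : 'X_{1..n < d.+1}) F@_m * \prod_i x 0 i ^+ m i.
Proof.
rewrite /meval (@mmapE _ _ _ _ _ _ d.+1) //.
rewrite msizeE; apply/bigmax_leqP_seq => m mF _; rewrite ltnS.
by have /dhomogP/(_ m mF) := dhomog_is_dhomog F => /= ->.
Qed.
End Substitution.

(** Functionals that separate vectors contain a basis of the dual space: a
    functional that is not zero on [U] cuts [U] in a smaller subspace.  Applied to
    evaluations, this makes the coefficients of a form linear combinations of its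
    values. *)
Lemma dual_expansion (K : numFieldType) (V : vectType K) (X : Type) (ev : X -> {linear V -> K^o}) :
  (forall v, (forall x, ev x v = 0) -> v = 0) ->
  exists s : seq (X * V), forall v, v = \sum_(xb <- s) ev xb.1 v *: xb.2.
Proof.
move=> sep.
suff H k (U : {vspace V}) : (\dim U <= k)%N -> exists s : seq (X * V),
    forall v, v \in U -> v = \sum_(xb <- s) ev xb.1 v *: xb.2.
  have [s hs] := H _ fullv (leqnn _); by exists s => v; apply: hs; apply: memvf.
elim: k U => [|k IHk] U.
  rewrite leqn0 dimv_eq0 => /eqP ->; exists [::] => v.
  by rewrite memv0 big_nil => /eqP.
move=> dU; have [U0|] := eqVneq U 0%VS.
  by apply: IHk; rewrite U0 dimv0.
rewrite -vpick0; set u := vpick U => u0.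
have [x xu] : exists x, ev x u != 0.
  apply: contrapT => h; move/eqP: u0; apply; apply: sep => x.
  by apply: contrapT => /eqP hx; apply: h; exists x.
pose f : 'Hom(V, K^o) := linfun (ev x).
have fE v : f v = ev x v by rewrite lfunE.
have uU : u \in U by apply: memv_pick.
have [s hs] : exists s : seq (X * V),
    forall v, v \in (U :&: lker f)%VS -> v = \sum_(xb <- s) ev xb.1 v *: xb.2.
  apply: IHk; rewrite -ltnS; apply: leq_trans dU.
  rewrite -(limg_ker_dim f U) -[X in (X < _)%N]addn0 ltn_add2l lt0n dimv_eq0.
  apply: contraNneq xu => lim0; rewrite -fE -memv0 -lim0; exact: memv_img.
pose b := (ev x u)^-1 *: u.
have xb : ev x b = 1 by rewrite linearZ /= [LHS]mulVf.
pose b' := b - \sum_(xb <- s) ev xb.1 b *: xb.2.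
exists ((x, b') :: s) => v vU; rewrite big_cons /=.
have : v - ev x v *: b \in (U :&: lker f)%VS.
  rewrite memv_cap memvB ?memvZ //= memv_ker fE linearB linearZ /= xb.
  by rewrite [_ *: 1]mulr1 subrr.
move/hs => /eqP; rewrite subr_eq => /eqP {1}->.
rewrite addrC scalerBr -addrA; congr (_ + _).
rewrite scaler_sumr -sumrN -big_split /=; apply: eq_bigr => xc _.
by rewrite linearB linearZ /= scalerBl scalerA addrC.
Qed.

Section PolynomialForms.
Variables (K : numClosedFieldType) (n d : nat).
Local Notation form := (dhomog n.+1 K d).
Local Notation vec := 'rV[K]_n.+1.

Lemma functional_form (lam : {linear form -> K^o}) :
  exists s : seq ('rV[K]_n.+1 * K), forall F : form,
    lam F = \sum_(xc <- s) F.@[xc.1 0] * xc.2.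
Proof.
have [s hs] := @dual_expansion K form _ (fun x => @form_at K n.+1 d x) (@form_eq0 K n.+1 d).
exists [seq (xb.1, lam xb.2) | xb <- s] => F.
rewrite {1}(hs F) linear_sum big_map; apply: eq_bigr => xb _.
by rewrite linearZ.
Qed.

Lemma pfun_eval (V : vectType K) (phi : V -> form) (x : V -> 'rV[K]_n.+1) :
  (forall y : vec, pfun (fun v => (phi v).@[y 0])) -> (forall i, pfun (fun v => x v 0 i)) ->
  pfun (fun v => (phi v).@[(x v) 0]).
Proof.
move=> hphi hx; apply: (@pfun_eq _ _ (fun v => \sum_(m : 'X_{1..n.+1 < d.+1}) (phi v)@_m * \prod_i x v 0 i ^+ m i)).
  by move=> v; rewrite form_expand.
apply: pfun_sum => m _; apply: pfunM; last first.
  by apply: pfun_prod => i _; apply: pfunX.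
have [s hs] := functional_form (@form_coef K n.+1 d m).
apply: (@pfun_eq _ _ (fun v => \sum_(xc <- s) (phi v).@[xc.1 0] * xc.2)).
  by move=> v; rewrite -hs.
by apply: pfun_sum => xc _; apply: pfunM => //; apply: pfunC.
Qed.

Local Notation E := {ffun 'I_3 -> equations K n d}.

(** To know that the coordinates of equations belong to a class of functions it
    is enough to know it for the coefficients of the linear forms, the coordinates
    of the points and the values of the forms.  The class will consist of
    polynomial or of rational functions. *)
Lemma equations_coordinates (W : Type) (phi : W -> E) (P : (W -> K) -> Prop) :
  (forall c, P (fun=> c)) -> (forall f g, P f -> P g -> P (fun w => f w + g w)) ->
  (forall f g, P f -> P g -> P (fun w => f w * g w)) ->
  (forall i j, P (fun w => (phi w i).1.1 0 j)) ->
  (forall i j, P (fun w => (phi w i).1.2 0 j)) ->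
  (forall i (y : vec), P (fun w => (phi w i).2.@[y 0])) ->
  forall lam : {linear E -> K^o}, P (fun w => lam (phi w)).
Proof.
move=> PC PD PM Pl Pp PF lam.
have Peq f h : f =1 h -> P f -> P h by move/funext ->.
have Psum (I : Type) (r : seq I) (F : I -> W -> K) : (forall i, P (F i)) ->
  P (fun w => \sum_(i <- r) F i w) by move=> h; apply: algebra_sum.
pose inj i (c : equations K n d) : E := [ffun j => if j == i then c else 0].
have injL i : linear (inj i).
  by move=> a c c'; apply/ffunP => j; rewrite !ffunE; case: eqP => // _; rewrite scaler0 addr0.
have eE (e : E) : e = \sum_i inj i (e i).
  apply/ffunP => j; rewrite sum_ffunE (bigD1 j) //= ffunE eqxx big1 ?addr0 // => i ij.
  by rewrite ffunE eq_sym (negbTE ij).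
have inj0 i : inj i 0 = 0 by apply/ffunP => j; rewrite !ffunE if_same.
have injD i c c' : inj i (c + c') = inj i c + inj i c'.
  by have := injL i 1 c c'; rewrite !scale1r.
have injZ i a c : inj i (a *: c) = a *: inj i c.
  by have := injL i a c 0; rewrite !addr0 inj0 addr0.
have lamF i : exists s : seq ('rV[K]_n.+1 * K), forall F : form,
    lam (inj i (0, 0, F)) = \sum_(xc <- s) F.@[xc.1 0] * xc.2.
  have lin : linear (fun F : form => lam (inj i ((0, 0, F) : equations K n d))).
    move=> a F G; rewrite -linearP -injZ -injD; congr (lam (inj i _)).
    by rewrite /= -[RHS]/((_, _, _)) /= !scaler0 !addr0.
  pose lF := GRing.isLinear.Build K form K^o _ _ lin.
  pose LF : {linear form -> K^o} := HB.pack (fun F : form => lam (inj i ((0, 0, F) : equations K n d))) lF.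
  exact: (functional_form LF).
apply: (@Peq (fun w => \sum_i (lam (inj i ((phi w i).1.1, 0, 0)) + (lam (inj i (0, (phi w i).1.2, 0)) + lam (inj i (0, 0, (phi w i).2)))))).
  move=> w; rewrite [in RHS](eE (phi w)) linear_sum; apply: eq_bigr => i _.
  rewrite -!linearD -!injD; congr (lam (inj i _)).
  by case: (phi w i) => [[l p] F]; rewrite /= -[LHS]/((_, _, _)) /= !addr0 !add0r.
have lamV i (g : vec -> equations K n d) : linear g ->
    forall v, lam (inj i (g v)) = \sum_j v 0 j * lam (inj i (g (delta_mx 0 j))).
  move=> glin; have lin : linear (fun v : vec => lam (inj i (g v))).
    by move=> a u v; rewrite -linearP -injZ -injD glin.
  pose lF := GRing.isLinear.Build K vec K^o _ _ lin.
  pose LF : {linear vec -> K^o} := HB.pack (fun v : vec => lam (inj i (g v))) lF.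
  move=> v; have -> : lam (inj i (g v)) = LF v by [].
  rewrite [in LHS](row_sum_delta v) linear_sum.
  by apply: eq_bigr => j _; rewrite linearZ.
have lin1 : linear (fun v : vec => (v, 0, 0) : equations K n d).
  by move=> a u v; rewrite /= -[RHS]/((_, _, _)) /= !scaler0 !addr0.
have lin2 : linear (fun v : vec => (0, v, 0) : equations K n d).
  by move=> a u v; rewrite /= -[RHS]/((_, _, _)) /= !scaler0 !addr0.
apply: (Psum) => i; apply: (PD); last apply: (PD).
- apply: Peq; first by move=> w; rewrite (lamV i _ lin1).
  by apply: Psum => j; apply: (PM).
- apply: Peq; first by move=> w; rewrite (lamV i _ lin2).
  by apply: Psum => j; apply: (PM).
have [s hs] := lamF i.
apply: (@Peq (fun w => \sum_(xc <- s) (phi w i).2.@[xc.1 0] * xc.2)); first by move=> w; rewrite hs.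
by apply: Psum => xc; apply: (PM).
Qed.
End PolynomialForms.

(** * Standard hyperplanes, vertices and projections *)

Lemma ord3_ind (P : 'I_3 -> Prop) : P 0 -> P 1 -> P 2 -> forall i, P i.
Proof.
move=> P0 P1 P2 [[|[|[|k]]] hk] //.
- by rewrite (_ : Ordinal hk = 0) //; apply: val_inj.
- by rewrite (_ : Ordinal hk = 1) //; apply: val_inj.
- by rewrite (_ : Ordinal hk = 2) //; apply: val_inj.
Qed.

Section Standard.
Variable K : numClosedFieldType.
Variable n : nat.
Local Notation vec := 'rV[K]_n.+4.

Definition o0 : 'I_n.+4 := @Ordinal n.+4 0 isT.
Definition o1 : 'I_n.+4 := @Ordinal n.+4 1 isT.
Definition o2 : 'I_n.+4 := @Ordinal n.+4 2 isT.
Definition o3 : 'I_n.+4 := @Ordinal n.+4 3 isT.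

Lemma vec_eq (y z : vec) : y 0 o0 = z 0 o0 -> y 0 o1 = z 0 o1 -> y 0 o2 = z 0 o2 ->
  y 0 o3 = z 0 o3 -> (forall j : 'I_n.+4, (3 < j)%N -> y 0 j = z 0 j) -> y = z.
Proof.
move=> h0 h1 h2 h3 h; apply/rowP => -[[|[|[|[|k]]]] hk]; last exact: h.
- by rewrite (_ : Ordinal hk = o0) //; apply: val_inj.
- by rewrite (_ : Ordinal hk = o1) //; apply: val_inj.
- by rewrite (_ : Ordinal hk = o2) //; apply: val_inj.
- by rewrite (_ : Ordinal hk = o3) //; apply: val_inj.
Qed.

Lemma tail_index (j : 'I_n.+4) : (3 < j)%N ->
  ((j < 2)%N = false) * ((j < 3)%N = false) * ((j < 4)%N = false) * ((j == 0%N :> nat) = false) * ((j == 1%N :> nat) = false) *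
  ((j == 2%N :> nat) = false) * ((j == 3%N :> nat) = false).
Proof.
move=> h; do ![split]; apply/negbTE; rewrite ?neq_ltn -?leqNgt; lia.
Qed.

Lemma linear_matrix (f : vec -> vec) : linear f -> forall u, u *m lin1_mx f = f u.
Proof.
move=> lf u.
pose i := GRing.isLinear.Build K vec vec _ f lf.
pose F : {linear vec -> vec} := HB.pack f i.
exact: (mul_rV_lin1 F).
Qed.

(** The [i]-th standard hyperplane is [y_i = 0]. *)
Definition hidx (i : 'I_3) : 'I_n.+4 := widen_ord (isT : (3 <= n.+4)%N) i.

(** On the hyperplane [y_i = 0] this is the projection from [apex i] to the space
    [y_0 = y_1 = 0]. *)
Definition proj (i : 'I_3) (y : vec) : vec := \row_j
  if (j < 2)%N then 0 else
  if (j == 2 :> nat) then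
    (if (i == 0 :> nat) then y 0 o1 + y 0 o2 else if (i == 1 :> nat) then y 0 o2 else y 0 o1)
  else if (j == 3 :> nat) then (if (i == 2 :> nat) then y 0 o3 + y 0 o0 else y 0 o3)
  else y 0 j.

Lemma proj_linear i : linear (proj i).
Proof.
move=> a u v; apply/rowP => j; rewrite !mxE.
by do ![case: ifP => _]; rewrite ?mulr0 ?addr0 ?mulrDr //; ring.
Qed.

(** The first vertex lies on neither of the last two hyperplanes, and those contain
    the other two vertices. *)
Definition apex (i : 'I_3) : vec := \row_j
  if (i == 0 :> nat) then (j == 1 :> nat)%:R - (j == 2 :> nat)%:R
  else if (i == 1 :> nat) then (j == 0 :> nat)%:R
  else (j == 0 :> nat)%:R - (j == 3 :> nat)%:R.

Lemma mulmx_proj i y : y *m lin1_mx (proj i) = proj i y.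
Proof. exact/linear_matrix/proj_linear. Qed.

Lemma proj01 i y : proj i y 0 o0 = 0 /\ proj i y 0 o1 = 0.
Proof. by rewrite !mxE. Qed.

Lemma projD i y z : proj i (y + z) = proj i y + proj i z.
Proof. by have := proj_linear i 1 y z; rewrite !scale1r. Qed.

Lemma projZ i c y : proj i (c *: y) = c *: proj i y.
Proof.
have p0 : proj i 0 = 0 by have := proj_linear i (-1) 0 0; rewrite scaleN1r addNr scaleN1r addNr.
by have := proj_linear i c y 0; rewrite p0 !addr0.
Qed.

Lemma apex_hidx i : apex i 0 (hidx i) = 0.
Proof. by elim/ord3_ind: i; rewrite mxE /= ?subr0 ?subrr. Qed.

Lemma apex_neq0 i : apex i != 0.
Proof.
apply/eqP => /rowP; elim/ord3_ind: i => [/(_ o1)|/(_ o0)|/(_ o0)]; rewrite !mxE /= ?subr0;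
 by move/eqP; rewrite oner_eq0.
Qed.

Lemma proj_apex i : proj i (apex i) = 0.
Proof.
elim/ord3_ind: i; apply: vec_eq; rewrite ?mxE //= ?mxE /= ?subr0 ?sub0r ?subrr ?addNr //;
 by move=> j hj; rewrite !mxE !(tail_index hj) ?subrr.
Qed.

Lemma proj_eq0 i (y : vec) : y 0 (hidx i) = 0 -> proj i y = 0 -> exists c, y = c *: apex i.
Proof.
move=> yi /rowP py; have := (py o2, py o3); rewrite !mxE /= => -[p2 p3].
have pt (j : 'I_n.+4) : (3 < j)%N -> y 0 j = 0.
  by move=> hj; have := py j; rewrite !mxE !(tail_index hj).
elim/ord3_ind: i yi py p2 p3 => /= yi py p2 p3.
- have {}yi : y 0 o0 = 0 by rewrite -yi; congr (y 0 _); apply: val_inj.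
  exists (y 0 o1); apply: vec_eq; rewrite ?mxE /= ?yi ?p3 ?subr0 ?sub0r ?mulr0 ?mulr1 //.
    by apply/eqP; rewrite mulrN1 -addr_eq0 addrC p2.
  by move=> j hj; rewrite !mxE !(tail_index hj) pt // subrr mulr0.
- have {}yi : y 0 o1 = 0 by rewrite -yi; congr (y 0 _); apply: val_inj.
  exists (y 0 o0); apply: vec_eq; rewrite ?mxE /= ?yi ?p3 ?p2 ?mulr0 ?mulr1 //.
  by move=> j hj; rewrite !mxE !(tail_index hj) pt // mulr0.
- have {}yi : y 0 o2 = 0 by rewrite -yi; congr (y 0 _); apply: val_inj.
  exists (y 0 o0); apply: vec_eq; rewrite ?mxE /= ?yi ?p2 ?subr0 ?sub0r ?subrr ?mulr0 ?mulr1 //.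
    by apply/eqP; rewrite mulrN1 -addr_eq0 p3.
  by move=> j hj; rewrite !mxE !(tail_index hj) pt // subrr mulr0.
Qed.

Lemma proj_surj i (z : vec) : z 0 o0 = 0 -> z 0 o1 = 0 ->
  exists2 y : vec, y 0 (hidx i) = 0 & proj i y = z.
Proof.
move=> z0 z1; elim/ord3_ind: i.
- exists z; first by rewrite -[RHS]z0; congr (z 0 _); apply: val_inj.
  apply: vec_eq; rewrite ?mxE /= ?z0 ?z1 ?add0r //.
  by move=> j hj; rewrite !mxE !(tail_index hj).
- exists z; first by rewrite -[RHS]z1; congr (z 0 _); apply: val_inj.
  apply: vec_eq; rewrite ?mxE /= ?z0 ?z1 ?add0r //.
  by move=> j hj; rewrite !mxE !(tail_index hj).
exists (\row_j if (j == 2 :> nat) then 0 else if (j == 1 :> nat) then z 0 o2 else z 0 j).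
  by rewrite mxE.
apply: vec_eq; rewrite ?mxE /= ?mxE /= ?z0 ?z1 ?addr0 //.
by move=> j hj; rewrite !mxE !(tail_index hj).
Qed.

End Standard.

(** * Configurations built from a matrix and a form *)

Section Configurations.
Variable K : numClosedFieldType.
Variables (n d : nat).
Local Notation vec := 'rV[K]_n.+4.
Local Notation form := (dhomog n.+4 K d).
Local Notation E := {ffun 'I_3 -> equations K n.+3 d}.

(** In the coordinates [y = x D] the hyperplanes and vertices are the standard
    ones and the cones are the pullbacks of [g = 0] by [proj].  The adjugate of
    [D] stands for its inverse, so that all this is polynomial in [D]. *)
Definition model (D : 'M[K]_n.+4) (g : form) : E :=
  [ffun i => ((col (hidx n i) D)^T, apex K n i *m \adj D,
              fsubst (D *m lin1_mx (@proj K n i)) g)].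

(** The form [g] is a form in [y_2, y_3, ...], and for [y_2 = 0] it does not
    involve [y_3]: it will be the restriction of a form defining cones over [e_0]
    and over [e_0 - e_3] in [y_1 = y_2 = 0]. *)
Record cylindrical (g : {mpoly K[n.+4]}) : Prop := Cylindrical {
  cyl_base : forall y z : vec, (forall j : 'I_n.+4, (1 < j)%N -> y 0 j = z 0 j) ->
    g.@[y 0] = g.@[z 0];
  cyl_trace : forall y z : vec, y 0 (o2 n) = 0 -> z 0 (o2 n) = 0 ->
    (forall j : 'I_n.+4, (3 < j)%N -> y 0 j = z 0 j) -> g.@[y 0] = g.@[z 0] }.

Definition base (z : vec) := z 0 (o0 n) = 0 /\ z 0 (o1 n) = 0.

(** By the formula of Euler it makes no difference to require a nonzero
    derivative also where [g z != 0]. *)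
Definition nonsingular (g : {mpoly K[n.+4]}) := forall z : vec, base z -> z != 0 ->
  exists2 w, base w & (line g z w)^`().[0] != 0.

Lemma base_proj i y : base (@proj K n i y).
Proof. exact: proj01. Qed.

Lemma mem_col (D : 'M[K]_n.+4) j x : (x \in hyperplane (col j D)^T) = ((x *m D) 0 j == 0).
Proof.
rewrite mem_hyperplane dotE mxE; congr (_ == 0).
by apply: eq_bigr => k _; rewrite !mxE.
Qed.

Lemma nonsingular_neq0 g : nonsingular g -> exists2 z, base z & g.@[z 0] != 0.
Proof.
move=> ns; have [||w bw h] := ns (delta_mx 0 (o2 n)).
- by rewrite /base !mxE.
- by apply/eqP => /rowP/(_ (o2 n)); rewrite !mxE !eqxx => /eqP; rewrite oner_eq0.
have : line g (delta_mx 0 (o2 n)) w != 0.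
  by apply: contraNneq h => ->; rewrite deriv0 horner0.
case/poly_fun_neq0 => t; rewrite line_eval => gt; eexists; last exact: gt.
by case: bw => w0 w1; rewrite /base !mxE w0 w1 !mulr0 !addr0.
Qed.

Section Model.
Variables (D : 'M[K]_n.+4) (g : form).
Hypotheses (uD : D \in unitmx) (ns : nonsingular g).

Let detD : \det D != 0. Proof. by rewrite -unitfE -unitmxE. Qed.

Let adjD (v : vec) : v *m \adj D *m D = \det D *: v.
Proof. by rewrite -mulmxA mul_adj_mx mul_mx_scalar. Qed.

(** A cone over a smooth hypersurface is smooth off its vertex. *)
Lemma model_good i : good_equations (model D g i).1.1 (model D g i).1.2 (model D g i).2.
Proof.
rewrite ffunE /=; set l := (_)^T; set p := _ *m _.
have memW x : (x \in hyperplane l) = ((x *m D) 0 (hidx n i) == 0) := mem_col D _ x.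
have pD : p *m D = \det D *: apex K n i by apply: adjD.
have ev (x : vec) : (fsubst (D *m lin1_mx (@proj K n i)) g).@[x 0] = g.@[(proj i (x *m D)) 0].
  by rewrite fsubst_eval mulmxA mulmx_proj.
split.
- apply/eqP => l0; have : delta_mx 0 (hidx n i) *m invmx D \in hyperplane l.
    by rewrite l0 mem_hyperplane dotC /dot mul0mx mxE.
  by rewrite memW mulmxKV // mxE !eqxx oner_eq0.
- apply/eqP => p0; move: pD; rewrite p0 mul0mx => /esym/eqP.
  by rewrite scaler_eq0 (negbTE detD) (negbTE (apex_neq0 K n i)).
- by rewrite memW pD mxE apex_hidx mulr0.
- have [z [z0 z1] gz] := nonsingular_neq0 ns.
  have [y yi yz] := proj_surj i z0 z1.
  exists (y *m invmx D); first by rewrite memW mulmxKV // yi.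
  by rewrite ev mulmxKV // yz.
- by move=> q _ t; rewrite !ev mulmxDl -scalemxAl pD scalerA projD projZ proj_apex scaler0 addr0.
move=> q qW qp _; have [|w [w0 w1] h] := ns (z := proj i (q *m D)) (base_proj _ _).
  apply: contra qp => /eqP /proj_eq0 [|c qD]; first by apply/eqP; rewrite -memW.
  apply/vlineP; exists (c / \det D).
  by rewrite -[q](mulmxK uD) qD -[p](mulmxK uD) pD -!scalemxAl scalerA divfK.
have [y yi yw] := proj_surj i w0 w1.
exists (y *m invmx D); first by rewrite memW mulmxKV // yi.
congr (_^`().[_] != 0): h; apply: line_eq => t.
by rewrite ev mulmxDl -scalemxAl mulmxKV // projD projZ yw.
Qed.

Hypothesis cyl : cylindrical g.

(** The form [g1 + g3 - g'] is used, where [g1] and [g3] define the first and the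
    last cone and [g'] is [g (y_1, y_3, ...)].  On each hyperplane [g'] cancels
    against one of the other two terms: on [y_0 = 0] and on [y_2 = 0] it is equal
    to [g3] and to [g1], and on [y_1 = 0] it agrees with [g3] because, for
    [y_2 = 0], [g] does not involve [y_3]. *)
Lemma model_suited : suited d (config_of (model D g)).
Proof.
(* The point [k4 y] is both [proj 2 y] for [y_0 = 0] and [proj 0 y] for [y_2 = 0]. *)
pose k4 (y : vec) : vec := \row_j if (j < 2)%N then 0 else if (j == 2 :> nat) then y 0 (o1 n) else y 0 j.
have k4_lin : linear k4.
  move=> a u v; apply/rowP => j; rewrite !mxE.
  by do ![case: ifP => _]; rewrite ?mulr0 ?addr0.
pose H : form := fsubst (D *m lin1_mx (@proj K n 0)) g + fsubst (D *m lin1_mx (@proj K n 2)) g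
   - fsubst (D *m lin1_mx k4) g.
exists H; first exact: dhomog_is_dhomog.
have HE (x : vec) : H.@[x 0] = g.@[(proj 0 (x *m D)) 0] + g.@[(proj 2 (x *m D)) 0] - g.@[(k4 (x *m D)) 0].
  by rewrite /H /= mevalB mevalD !fsubst_eval !mulmxA !mulmx_proj linear_matrix.
have HW i (x : vec) : x \in hyperplane (model D g i).1.1 -> H.@[x 0] = (model D g i).2.@[x 0].
  rewrite ffunE /= mem_col HE fsubst_eval mulmxA mulmx_proj => /eqP.
  move: (x *m D) => y; elim/ord3_ind: i => yi.
  - have {}yi : y 0 (o0 n) = 0 by rewrite -[RHS]yi; congr (y 0 _); apply: val_inj.
    rewrite (_ : proj 2 y = k4 y) ?addrK //.
    apply: vec_eq; rewrite ?mxE //= ?yi ?addr0 // => j hj.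
    by rewrite !mxE !(tail_index hj).
  - have {}yi : y 0 (o1 n) = 0 by rewrite -[RHS]yi; congr (y 0 _); apply: val_inj.
    rewrite (_ : proj 0 y = proj 1 y); last first.
      apply: vec_eq; rewrite ?mxE //= ?yi ?add0r // => j hj.
      by rewrite !mxE !(tail_index hj).
    rewrite (cyl_trace cyl (y := proj 2 y) (z := k4 y)) ?addrK ?mxE //=.
    by move=> j hj; rewrite !mxE !(tail_index hj).
  - have {}yi : y 0 (o2 n) = 0 by rewrite -[RHS]yi; congr (y 0 _); apply: val_inj.
    rewrite (_ : proj 0 y = k4 y); last first.
      apply: vec_eq; rewrite ?mxE //= ?yi ?addr0 // => j hj.
      by rewrite !mxE !(tail_index hj).
    by rewrite addrAC subrr add0r.
move=> i; have [l0 p0 pl [x xW Fx] inv sm] := model_good i.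
have nz : ~ lin_ideal (hyperplane (model D g i).1.1) H.
  by apply/nonzero_onP; exists x => //; rewrite (HW i).
rewrite /config_of; case E: (model D g i) => [[l p] F].
rewrite E /= in HW nz *.
split=> //; apply/(section_ideal_eqP (dhomog_is_dhomog H) (dhomog_is_dhomog F) nz).
exists 1; first exact: oner_neq0.
by move=> y yW; rewrite mul1r; have := HW i y; rewrite E; apply.
Qed.

Lemma model_Vint : Vint K n.+3 d (config_of (model D g)).
Proof.
have adjW i j : (apex K n i *m \adj D \in hyperplane (col (hidx n j) D)^T) = (apex K n i 0 (hidx n j) == 0).
  by rewrite mem_col adjD mxE mulf_eq0 (negbTE detD).
split.
- move=> i; rewrite /config_of; have := model_good i.
  by case: (model D g i) => [[l p] F] /= /good_tripleP.
- exact: model_suited.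
- rewrite /config_of !ffunE /= -!memvE !adjW !mxE /= ?subr0 ?sub0r oppr_eq0 oner_eq0.
  by [].
- rewrite /config_of !ffunE /= => h.
  have : apex K n 1 *m \adj D \in <[apex K n 2 *m \adj D]>%VS by rewrite -h memv_line.
  case/vlineP => c /(congr1 (mulmx^~ D)); rewrite -scalemxAl !adjD scalerA mulrC -scalerA.
  move/(scalerI detD)/rowP => hc.
  have := (hc (o0 n), hc (o3 n)); rewrite !mxE /= !subr0 sub0r mulr1 mulrN1 => -[<- /esym/eqP].
  by rewrite oppr_eq0 oner_eq0.
rewrite /config_of !ffunE /= subv_add !subv_cap -!memvE !adjW !mxE /= ?subr0 ?subrr eqxx.
by [].
Qed.
End Model.
End Configurations.

(** * Every configuration is built from a matrix and a form *)

Section Frames.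
Variable K : numClosedFieldType.
Variables (n d : nat).
Hypothesis d1 : (1 < d)%N.
Local Notation vec := 'rV[K]_n.+4.
Local Notation form := (dhomog n.+4 K d).
Local Notation E := {ffun 'I_3 -> equations K n.+3 d}.

(** If [F] is invariant along [p'] then [F (p' + t w) = t^d F(w)], so that all the
    derivatives of [F] vanish at [p'], against smoothness. *)
Lemma vertex_unique (l p p' : vec) (F : form) : good_equations l p F ->
  p' \in hyperplane l -> p' \notin <[p]>%VS -> ~ invariant_along (hyperplane l) F p'.
Proof.
move=> [_ _ _ _ _ sm] p'l p'p inv.
have F0 : F.@[p' 0] = 0.
  have := inv 0 (mem0v _) 1; rewrite add0r scale1r => ->.
  by apply: homog_eval0 (dhomog_is_dhomog F); apply: ltnW.
have [w wW] := sm p' p'l p'p F0; case/negP; apply/eqP.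
have -> : line F p' w = F.@[w 0] *: 'X^d.
  apply/eqP; rewrite -subr_eq0; apply/eqP/poly_fun_eq0 => t.
  rewrite hornerD hornerN hornerZ hornerXn line_eval.
  have := inv (t *: w) (memvZ _ wW) 1; rewrite scale1r addrC => ->.
  by rewrite form_scale mulrC subrr.
rewrite derivZ derivXn hornerZ hornerMn hornerXn expr0n.
by rewrite -subn1 subn_eq0 leqNgt d1 mul0rn mulr0.
Qed.

(** The form [H] defines a hypersurface that cuts out the three cones. *)
Record vint_equations (e : E) (H : form) : Prop := VintEquations {
  ve_good : forall i, eqs_good (e i);
  ve_form : forall i, exists2 c, c != 0 & forall x, x \in hyperplane (e i).1.1 ->
     H.@[x 0] = c * (e i).2.@[x 0];
  ve_p1_off : dot (e 1).1.1 (e 0).1.2 != 0 /\ dot (e 2).1.1 (e 0).1.2 != 0;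
  ve_p2_neq_p3 : (e 1).1.2 \notin <[(e 2).1.2]>%VS;
  ve_p3_on_2 : dot (e 1).1.1 (e 2).1.2 = 0;
  ve_p2_on_3 : dot (e 2).1.1 (e 1).1.2 = 0 }.

Lemma Vint_equations (L : 'I_3 -> triple K n.+3) : Vint K n.+3 d L ->
  exists e H, L = config_of e /\ vint_equations e H.
Proof.
case=> gL [H hH HL] [p12 p13] p23 sub.
have [e LE ge] := good_surj gL; exists e, (DHomog hH); split=> //.
move: HL p12 p13 p23 sub; rewrite LE /config_of => HL.
case e0: (e 0) => [[l1 p1] F1]; case e1: (e 1) => [[l2 p2] F2]; case e2: (e 2) => [[l3 p3] F3] /=.
rewrite -!memvE !mem_hyperplane => p12 p13 p23.
rewrite subv_add !subv_cap -!memvE !mem_hyperplane.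
case/andP=> /andP[_ /eqP l3p2] /andP[/eqP l2p3 _].
split=> //; rewrite ?e0 ?e1 ?e2 //=.
- move=> i; have := HL i; have := ge i; rewrite /eqs_good; case: (e i) => [[l p] F] /= _ [nz].
  by move/(section_ideal_eqP hH (dhomog_is_dhomog F) nz).
apply/negP => /vlineP[c E']; apply: p23; rewrite E'.
have [_ p20 _ _ _ _] := ge 1; rewrite e1 /= E' scaler_eq0 negb_or in p20.
case/andP: p20 => c0 p30.
by apply/line_eq_vspace => //; [rewrite scaler_eq0 negb_or c0|exists c^-1; rewrite ?invr_eq0 // scalerK].
Qed.

Section VintEquations.
Variables (e : E) (H : form).
Hypothesis ve : vint_equations e H.
Local Notation l i := (e i).1.1.
Local Notation p i := (e i).1.2.

Lemma ve_invariant i : invariant_along (hyperplane (l i)) H (p i).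
Proof.
have [_ _ pl _ inv _] := ve_good ve i; have [c c0 HF] := ve_form ve i.
by move=> q qW t; rewrite !HF ?inv // memvD ?memvZ.
Qed.

Lemma ve_vertex_unique i (p' : vec) : p' \in hyperplane (l i) -> p' \notin <[p i]>%VS ->
  ~ invariant_along (hyperplane (l i)) H p'.
Proof.
move=> p'l p'p inv; have [c c0 HF] := ve_form ve i.
apply: (vertex_unique (ve_good ve i) p'l p'p) => q qW t; apply: (mulfI c0).
by rewrite -!HF ?inv // memvD ?memvZ.
Qed.

Lemma ve_dot i : dot (l i) (p i) = 0.
Proof. by apply/eqP; rewrite -mem_hyperplane; have [] := ve_good ve i. Qed.

(** Otherwise the section by the first hyperplane would have the second vertex
    [p i]: a point [q] of this hyperplane can be moved along [p 0] into the
    hyperplane [l i], then along [p i], and then back along [p 0]. *)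
Lemma ve_dot_first i : dot (l i) (p 0) != 0 -> dot (l 0) (p i) != 0.
Proof.
move=> lip1; apply/eqP => l1pi.
have piW : p i \in hyperplane (l 0) by rewrite mem_hyperplane l1pi.
have [_ pi0 _ _ _ _] := ve_good ve i.
apply: (@ve_vertex_unique 0 (p i)) => //.
  apply/vlineP => -[c pE]; have := ve_dot i; rewrite pE dotZr => /eqP.
  rewrite mulf_eq0 (negbTE lip1) orbF => /eqP c0.
  by move: pi0; rewrite pE c0 scale0r eqxx.
move=> q qW t; pose s := dot (l i) q / dot (l i) (p 0); pose q' := q - s *: p 0.
have p0W : p 0 \in hyperplane (l 0) by rewrite mem_hyperplane ve_dot.
have q'W : q' \in hyperplane (l 0) by rewrite memvB ?memvZ.
have q'Wi : q' \in hyperplane (l i).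
  by rewrite mem_hyperplane dotBr dotZr divfK // subrr.
have -> : q = q' + s *: p 0 by rewrite subrK.
move: q' q'W q'Wi => q' q'W q'Wi.
rewrite addrAC !(ve_invariant (i := 0)) // ?memvD ?memvZ //.
by rewrite (ve_invariant (i := i)).
Qed.

(** Evaluated at [p 1] and [p 0], a relation makes [l 1] and [l 2] proportional;
    then a single cone would have the two vertices [p 1] and [p 2]. *)
Lemma ve_independent a b c : a *: l 0 + b *: l 1 + c *: l 2 = 0 -> [/\ a = 0, b = 0 & c = 0].
Proof.
have dE v : a *: l 0 + b *: l 1 + c *: l 2 = 0 ->
    a * dot (l 0) v + b * dot (l 1) v + c * dot (l 2) v = 0.
  move=> /(congr1 (dot v)); rewrite !dotDr !dotZr -![dot v _]dotC => ->.
  by rewrite dotC /dot mul0mx mxE.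
move=> E0; have a0 : a = 0.
  have := dE (p 1) E0; rewrite ve_dot (ve_p2_on_3 ve) !mulr0 !addr0 => /eqP.
  by rewrite mulf_eq0 (negbTE (ve_dot_first (ve_p1_off ve).1)) orbF => /eqP.
have [[l1p0 l2p0]] := ve_p1_off ve.
have := dE (p 0) E0; rewrite a0 mul0r add0r => E1.
have b0 : b = 0.
  apply/eqP/negPn/negP => b0.
  have c0 : c != 0.
    apply: contraNneq b0 => c0; move/eqP: E1.
    by rewrite c0 mul0r addr0 mulf_eq0 (negbTE l1p0) orbF.
  have W12 : hyperplane (l 2) = hyperplane (l 1).
    have [l10 _ _ _ _ _] := ve_good ve 1; have [l20 _ _ _ _ _] := ve_good ve 2.
    apply/hyperplane_eq => //; exists (- (c / b)); first by rewrite oppr_eq0 mulf_neq0 ?invr_eq0.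
    move: E0; rewrite a0 scale0r add0r => /eqP; rewrite addr_eq0 => /eqP E2.
    by rewrite mulrC scaleNr -scalerA -scalerN -E2 scalerK.
  apply: (@ve_vertex_unique 1 (p 2)).
  - by rewrite -W12 mem_hyperplane ve_dot.
  - apply: contra (ve_p2_neq_p3 ve) => /vlineP[k pE].
    have [_ p20 _ _ _ _] := ve_good ve 2.
    have k0 : k != 0 by apply: contraNneq p20 => k0; rewrite pE k0 scale0r.
    by apply/vlineP; exists k^-1; rewrite pE scalerK.
  - by rewrite -W12; apply: ve_invariant.
split=> //; move/eqP: E1; rewrite b0 mul0r add0r mulf_eq0 (negbTE l2p0) orbF.
by move/eqP.
Qed.

(** The form [g] is [H] composed with the projection to [y_0 = y_1 = 0].  On each
    hyperplane a point is joined to its projection by translations along vertices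
    that leave [H] unchanged, so that [g] computes all three cones. *)
Lemma adapted_model (D : 'M[K]_n.+4) : D \in unitmx ->
  (forall i, exists2 a, a != 0 & forall x, (x *m D) 0 (hidx n i) = a * dot (l i) x) ->
  (forall i, exists2 b, b != 0 & p i *m D = b *: apex K n i) ->
  exists g : form, [/\ cylindrical g, nonsingular g & config_of e = config_of (model D g)].
Proof.
move=> uD lD pD; have detD : \det D != 0 by rewrite -unitfE -unitmxE.
pose g : form := fsubst (lin1_mx (@proj K n 1) *m invmx D) H.
have gE (y : vec) : g.@[y 0] = H.@[(proj 1 y *m invmx D) 0].
  by rewrite fsubst_eval mulmxA mulmx_proj.
pose H' (y : vec) := H.@[(y *m invmx D) 0].
have memW i (x : vec) : (x \in hyperplane (l i)) = ((x *m D) 0 (hidx n i) == 0).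
  by have [a a0 ->] := lD i; rewrite mem_hyperplane mulf_eq0 (negbTE a0).
have inv i (y : vec) t : y 0 (hidx n i) = 0 -> H' (y + t *: apex K n i) = H' y.
  move=> yi; have [b b0 pE] := pD i.
  have -> : t *: apex K n i = (t / b) *: (p i *m D) by rewrite pE scalerA divfK.
  rewrite /H' mulmxDl -scalemxAl mulmxK // ve_invariant // memW mulmxKV //.
  exact/eqP.
have h0 (y : vec) : y 0 (hidx n 0) = y 0 (o0 n) by congr (y 0 _); apply: val_inj.
have h1 (y : vec) : y 0 (hidx n 1) = y 0 (o1 n) by congr (y 0 _); apply: val_inj.
have h2 (y : vec) : y 0 (hidx n 2) = y 0 (o2 n) by congr (y 0 _); apply: val_inj.
have gproj i (y : vec) : y 0 (hidx n i) = 0 -> H' y = g.@[(proj i y) 0].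
  move=> yi; rewrite gE -/(H' _).
  have -> : proj 1 (proj i y) = proj i y.
    apply: vec_eq; rewrite ?mxE //= ?mxE //= => j hj.
    by rewrite !mxE !(tail_index hj).
  elim/ord3_ind: i yi => yi.
  - rewrite -(inv 0 _ (- y 0 (o1 n)) yi); congr H'.
    rewrite h0 in yi; apply: vec_eq; rewrite ?mxE /= ?yi ?subr0 ?sub0r; try by ring.
    by move=> j hj; rewrite !mxE !(tail_index hj) /=; ring.
  - rewrite -(inv 1 _ (- y 0 (o0 n)) yi); congr H'.
    rewrite h1 in yi; apply: vec_eq; rewrite ?mxE /= ?yi; try by ring.
    by move=> j hj; rewrite !mxE !(tail_index hj) /=; ring.
  rewrite -(inv 2 _ (- y 0 (o0 n)) yi).
  have y0 : (y + - y 0 (o0 n) *: apex K n 2) 0 (hidx n 0) = 0.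
    by rewrite h0 !mxE /=; ring.
  rewrite -(inv 0 _ (- y 0 (o1 n)) y0); congr H'.
  rewrite h2 in yi; apply: vec_eq; rewrite ?mxE /= ?yi; try by ring.
  by move=> j hj; rewrite !mxE !(tail_index hj) /=; ring.
have nsg : nonsingular g.
  move=> z bz z0; have [z00 z01] := bz.
  have pz : proj 1 z = z.
    apply: vec_eq; rewrite ?mxE //= => j hj; by rewrite !mxE !(tail_index hj).
  have [gz|gz] := eqVneq g.@[z 0] 0; last first.
    exists z => //.
    have -> : line g z z = g.@[z 0] *: ('X + 1) ^+ d.
      apply/eqP; rewrite -subr_eq0; apply/eqP/poly_fun_eq0 => t.
      rewrite hornerD hornerN hornerZ horner_exp hornerD hornerX hornerC line_eval.
      have -> : z + t *: z = (1 + t) *: z by rewrite scalerDl scale1r.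
      by rewrite form_scale [1 + t]addrC mulrC subrr.
    (* At points off the hypersurface the derivative along [z] itself is [d g(z)]. *)
    rewrite derivZ deriv_exp derivD derivX derivC addr0 mul1r hornerZ hornerMn.
    rewrite horner_exp hornerD hornerX hornerC add0r expr1n mulf_neq0 // pnatr_eq0.
    by rewrite -lt0n ltnW.
  have xW : z *m invmx D \in hyperplane (l 1) by rewrite memW mulmxKV // h1 z01.
  have [c c0 HF] := ve_form ve 1.
  have [_ _ _ _ _ sm] := ve_good ve 1.
  have [||w wW h] := sm _ xW.
  - apply/vlineP => -[k /(congr1 (mulmx^~ D))]; rewrite mulmxKV // -scalemxAl.
    have [b b0 ->] := pD 1; rewrite scalerA => zE; case/eqP: z0.
    move: z00; rewrite zE !mxE /= mulr1 => ->; by rewrite scale0r.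
  - by apply: (mulfI c0); rewrite -HF // mulr0 -/(H' z) (gproj 1) ?h1 // pz.
  exists (proj 1 (w *m D)); first exact: base_proj.
  apply: contraNneq h => h; apply/eqP; apply: (mulfI c0); rewrite mulr0 -hornerZ -derivZ.
  rewrite -(line_scale xW wW HF); rewrite -[RHS]h; congr (_^`().[_]); apply: line_eq => t.
  have -> : z + t *: proj 1 (w *m D) = proj 1 (z + t *: (w *m D)) by rewrite projD projZ pz.
  rewrite -gproj; first by rewrite /H' mulmxDl -scalemxAl mulmxK.
  by move: wW; rewrite memW !mxE h1 z01 => /eqP ->; rewrite mulr0 addr0.
exists g; split=> //.
  split=> [y z yz|y z y2 z2 yz].
    rewrite !gE; congr (_.@[(_ *m _) 0]); apply: vec_eq; rewrite ?mxE //= ?yz //.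
    by move=> j hj; rewrite !mxE !(tail_index hj) yz // ltnW // ltnW.
  rewrite !gE -!/(H' _); set u := proj 1 y.
  pose t := z 0 (o3 n) - y 0 (o3 n).
  have -> : proj 1 z = u + t *: apex K n 1 + (- t) *: apex K n 2.
    apply: vec_eq; rewrite ?mxE /= ?y2 ?z2; try by ring.
      by rewrite /t; ring.
    by move=> j hj; rewrite !mxE !(tail_index hj) yz //=; ring.
  rewrite [in RHS]inv ?[in RHS]inv // ?h1 ?h2 !mxE //= y2; ring.
apply: funext => i; rewrite /config_of.
have ge := ve_good ve i; have [a a0 HF] := ve_form ve i.
have [l0' p0' _ _ _ _] := model_good uD nsg i; rewrite ffunE /= in l0' p0'.
have [al al0 lE] := lD i; have [b b0 pE] := pD i.
rewrite ffunE [e i]surjective_pairing [(e i).1]surjective_pairing.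
apply/triple_eqP => //; split.
- exists al => //; apply/rowP => j; rewrite !mxE -dot_delta -lE mxE.
  rewrite (bigD1 j) //= mxE !eqxx mul1r big1 ?addr0 // => k kj.
  by rewrite mxE (negbTE kj) andbF mul0r.
- exists (\det D / b); first by rewrite mulf_neq0 ?invr_eq0.
  apply: (can_inj (mulmxK uD)); rewrite -scalemxAl pE scalerA divfK //.
  by rewrite -mulmxA mul_adj_mx mul_mx_scalar.
exists a^-1; first by rewrite invr_eq0.
move=> x xW; rewrite fsubst_eval mulmxA mulmx_proj -gproj; last by apply/eqP; rewrite -memW.
by rewrite /H' mulmxK // HF // mulKf.
Qed.
End VintEquations.
End Frames.

Section Frame.
Variable K : numClosedFieldType.
Variables (n d : nat).
Hypothesis d1 : (1 < d)%N.
Local Notation vec := 'rV[K]_n.+4.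
Local Notation form := (dhomog n.+4 K d).
Local Notation E := {ffun 'I_3 -> equations K n.+3 d}.

Section Coordinates.
Variables (l1 l2 l3 : vec) (b : K) (B G c : vec) (L : 'M[K]_n.+4).

Definition frame_coord (j : 'I_n.+4) (x : vec) : K :=
  (x *m L) 0 j - G 0 j * dot l1 x - B 0 j * dot l2 x.

(** The coordinates 0, 1, 2 are [l1], [l2], [l3] up to scalars, and [frame_coord j]
    is coordinate [j] of [x *m L] corrected so as to vanish at the vertices with
    images [B] and [G] under [L].  It will be [- c j] at the last vertex, where
    subtracting multiples of coordinate 3 therefore leaves only that one.  The
    scalars [c 3] and [- b] bring the vertices to multiples of [apex], without
    denominators. *)
Definition frame_map (x : vec) : vec := \row_j
  if (j == 0 :> nat) then c 0 (o3 n) * dot l1 x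
  else if (j == 1 :> nat) then - b * dot l2 x
  else if (j == 2 :> nat) then dot l3 x
  else if (j == 3 :> nat) then frame_coord (o3 n) x
  else c 0 (o3 n) * frame_coord j x - c 0 j * frame_coord (o3 n) x.

Lemma frame_map_linear : linear frame_map.
Proof.
have lin j a u v : frame_coord j (a *: u + v) = a * frame_coord j u + frame_coord j v.
  by rewrite /frame_coord !dotDr !dotZr mulmxDl -scalemxAl !mxE; ring.
move=> a u v; apply/rowP => j; rewrite !mxE !lin !dotDr !dotZr.
by do ![case: ifP => _]; ring.
Qed.

Definition frame : 'M[K]_n.+4 := lin1_mx frame_map.

Lemma mul_frame x : x *m frame = frame_map x.
Proof. exact/linear_matrix/frame_map_linear. Qed.

Hypotheses (b0 : b != 0) (c0 : c 0 (o3 n) != 0).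
Hypothesis inj : forall x : vec, dot l1 x = 0 -> dot l2 x = 0 -> dot l3 x = 0 ->
  (forall j : 'I_n.+4, (2 < j)%N -> (x *m L) 0 j = 0) -> x = 0.

Lemma frame_unit : frame \in unitmx.
Proof.
rewrite -row_free_unit -kermx_eq0; apply/negPn/negP => /rowV0Pn[x /sub_kermxP].
rewrite mul_frame => /rowP h; case/negP; apply/eqP.
have h1 : dot l1 x = 0.
  by have := h (o0 n); rewrite !mxE /= => /eqP; rewrite mulf_eq0 (negbTE c0) => /eqP.
have h2 : dot l2 x = 0.
  by have := h (o1 n); rewrite !mxE /= => /eqP; rewrite mulNr oppr_eq0 mulf_eq0 (negbTE b0) => /eqP.
have h3 : dot l3 x = 0 by have := h (o2 n); rewrite !mxE.
have fE j : frame_coord j x = (x *m L) 0 j by rewrite /frame_coord h1 h2 !mulr0 !subr0.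
have f3 : (x *m L) 0 (o3 n) = 0 by rewrite -fE; have := h (o3 n); rewrite !mxE.
apply: inj => // j hj; have [j3|] := eqVneq (j : nat) 3%N.
  by rewrite (_ : j = o3 n) //; apply: val_inj.
move=> j3; have {}hj : (3 < j)%N by rewrite ltn_neqAle eq_sym j3.
have := h j; rewrite mxE !(tail_index hj) !fE f3 mulr0 subr0 [RHS]mxE => /eqP.
by rewrite mulf_eq0 (negbTE c0) => /eqP.
Qed.
End Coordinates.

(** At the three points the forms [l1], [l2], [l3] have the values prescribed by
    the incidences and the scaling; all the [frame_coord j] vanish at [q1] and
    [q2], and are [- c j] at [q3]. *)
Lemma frame_apex (l1 l2 l3 q1 q2 q3 : vec) (L : 'M[K]_n.+4) :
  dot l1 q1 = 0 -> dot l2 q1 = 1 ->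
  [/\ dot l1 q2 = 1, dot l2 q2 = 0 & dot l3 q2 = 0] ->
  [/\ dot l1 q3 = 1, dot l2 q3 = 0 & dot l3 q3 = 0] ->
  let b := dot l3 q1 in let c := (q2 - q3) *m L in
  let D := frame l1 l2 l3 b (q1 *m L) (q2 *m L) c L in
  [/\ q1 *m D = - b *: apex K n 0, q2 *m D = c 0 (o3 n) *: apex K n 1 &
      q3 *m D = c 0 (o3 n) *: apex K n 2].
Proof.
move=> h11 h21 [h12 h22 h32] [h13 h23 h33] b c D.
have fE x j : frame_coord l1 l2 (q1 *m L) (q2 *m L) L j x =
    (x *m L) 0 j - (q2 *m L) 0 j * dot l1 x - (q1 *m L) 0 j * dot l2 x by [].
have cE j : (q3 *m L) 0 j = (q2 *m L) 0 j - c 0 j.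
  suff -> : c 0 j = (q2 *m L) 0 j - (q3 *m L) 0 j by ring.
  by rewrite /c mulmxBl !mxE.
split; rewrite mul_frame {D}; move: (c) cE => {}c cE; apply/rowP => j;
  rewrite mxE !fE ?h11 ?h21 ?h12 ?h22 ?h32 ?h13 ?h23 ?h33 ?cE -?/b [in RHS]mxE [apex _ _ _ 0 _]mxE /=;
  do 3![case: ifP => [/eqP jk|_]; first by rewrite ?jk /=; ring];
  by case: ifP => [/eqP jk|_]; rewrite ?jk /=; ring.
Qed.

Section Adapted.
Variables (e : E) (H : form) (L : 'M[K]_n.+4).
Hypothesis ve : vint_equations e H.
Local Notation l i := (e i).1.1.
Local Notation p i := (e i).1.2.

Let q1 := (dot (l 1) (p 0))^-1 *: p 0.
Let q2 := (dot (l 0) (p 1))^-1 *: p 1.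
Let q3 := (dot (l 0) (p 2))^-1 *: p 2.
Let b := dot (l 2) q1.

Hypothesis c0 : ((q2 - q3) *m L) 0 (o3 n) != 0.
Hypothesis inj : forall x : vec, dot (l 0) x = 0 -> dot (l 1) x = 0 -> dot (l 2) x = 0 ->
  (forall j : 'I_n.+4, (2 < j)%N -> (x *m L) 0 j = 0) -> x = 0.

Let D := frame (l 0) (l 1) (l 2) b (q1 *m L) (q2 *m L) ((q2 - q3) *m L) L.

(** The frame turns the vertices, scaled so that [l 1 q1 = l 0 q2 = l 0 q3 = 1],
    into multiples of the standard ones. *)
Lemma frame_model : D \in unitmx /\ exists g : form, [/\ cylindrical g, nonsingular g &
  config_of e = config_of (model D g)].
Proof.
have [l1p0 l2p0] := ve_p1_off ve.
have l0p1 : dot (l 0) (p 1) != 0 by apply: (ve_dot_first d1 ve).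
have l0p2 : dot (l 0) (p 2) != 0 by apply: (ve_dot_first d1 ve).
have b0 : b != 0 by rewrite /b dotZr mulf_neq0 ?invr_eq0.
have uD : D \in unitmx by apply: frame_unit.
split=> //; apply: (adapted_model d1 ve uD).
  move=> i; elim/ord3_ind: i.
  - by exists (((q2 - q3) *m L) 0 (o3 n)) => // x; rewrite mul_frame mxE.
  - by exists (- b); rewrite ?oppr_eq0 // => x; rewrite mul_frame mxE.
  - by exists 1; rewrite ?oner_eq0 // => x; rewrite mul_frame mxE mul1r.
have d00 : dot (l 0) (p 0) = 0 := ve_dot ve 0.
have d11 : dot (l 1) (p 1) = 0 := ve_dot ve 1.
have d22 : dot (l 2) (p 2) = 0 := ve_dot ve 2.
have d12 := ve_p3_on_2 ve; have d21 := ve_p2_on_3 ve.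
have scale (a u : K) (v : vec) w : a != 0 -> u != 0 -> (a^-1 *: v) *m D = u *: w ->
    exists2 s, s != 0 & v *m D = s *: w.
  move=> a0 u0 h; exists (a * u); first exact: mulf_neq0.
  by rewrite -scalerA -h -scalemxAl scalerA mulfV // scale1r.
have [|||| E0 E1 E2] := @frame_apex (l 0) (l 1) (l 2) q1 q2 q3 L.
- by rewrite dotZr d00 mulr0.
- by rewrite dotZr mulVf.
- by rewrite !dotZr mulVf // d11 d21 !mulr0.
- by rewrite !dotZr mulVf // d12 d22 !mulr0.
move=> i; elim/ord3_ind: i.
- by apply: (scale _ (- b)) E0; rewrite ?oppr_eq0.
- exact: scale l0p1 c0 E1.
- exact: scale l0p2 c0 E2.
Qed.
End Adapted.

(** The columns of [L] beyond the first three complete [l 0, l 1, l 2] to a basis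
    of linear forms.  These three vanish at [q2 - q3], so that a permutation of
    the other columns makes its coordinate 3 nonzero. *)
Lemma Vint_model (T : 'I_3 -> triple K n.+3) : Vint K n.+3 d T ->
  exists D (g : form), [/\ D \in unitmx, cylindrical g, nonsingular g & T = config_of (model D g)].
Proof.
move=> /Vint_equations[e [H [-> ve]]].
have l0p1 : dot (e 0).1.1 (e 1).1.2 != 0 by apply: (ve_dot_first d1 ve); have [] := ve_p1_off ve.
have l0p2 : dot (e 0).1.1 (e 2).1.2 != 0 by apply: (ve_dot_first d1 ve); have [] := ve_p1_off ve.
pose A : 'M[K]_(n.+4, 3) := \matrix_(k, i) (e i).1.1 0 k.
have mulA (x : vec) i : (x *m A) 0 i = dot (e i).1.1 x.
  by rewrite mxE dotE; apply: eq_bigr => k _; rewrite mxE.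
have rA : \rank A = 3.
  rewrite -mxrank_tr; apply/eqP; rewrite -/(row_free A^T) -kermx_eq0.
  apply/negPn/negP => /rowV0Pn[v /sub_kermxP vA]; case/negP; apply/eqP.
  have : v 0 0 *: (e 0).1.1 + v 0 1 *: (e 1).1.1 + v 0 2 *: (e 2).1.1 = 0.
    rewrite -[RHS]vA; apply/rowP => k; rewrite !mxE !big_ord_recl big_ord0 addr0 !mxE addrA.
    by congr (_ + v 0 _ * (e _).1.1 0 _ + v 0 _ * (e _).1.1 0 _); apply: val_inj.
  by case/(ve_independent d1 ve) => v0 v1 v2; apply/rowP => i; rewrite mxE; elim/ord3_ind: i.
pose L0 := col_ebase A.
have uL0 : L0 \in unitmx by apply: col_ebase_unit.
have L0_head (x : vec) : dot (e 0).1.1 x = 0 -> dot (e 1).1.1 x = 0 -> dot (e 2).1.1 x = 0 ->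
    forall j : 'I_n.+4, (j < 3)%N -> (x *m L0) 0 j = 0.
  move=> h0 h1 h2 j j3.
  have xA : x *m A = 0.
    by apply/rowP => i; rewrite mulA mxE; elim/ord3_ind: i.
  have : x *m L0 *m pid_mx 3 = 0 :> 'rV_3.
    move: xA; rewrite -[A]mulmx_ebase rA !mulmxA => h.
    by rewrite -[LHS](mulmxK (row_ebase_unit A)) h mul0mx.
  move: (x *m L0) => y /rowP/(_ (Ordinal j3)); rewrite !mxE (bigD1 j) //= !mxE eqxx j3 mulr1.
  rewrite big1 ?addr0 // => k kj; rewrite !mxE /=.
  by rewrite (negbTE (kj : (k : nat) != j)) mulr0.
pose o := (dot (e 0).1.1 (e 1).1.2)^-1 *: (e 1).1.2 - (dot (e 0).1.1 (e 2).1.2)^-1 *: (e 2).1.2.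
have o0 : o != 0.
  rewrite subr_eq0; apply: contra (ve_p2_neq_p3 ve) => /eqP h; apply/vlineP.
  exists (dot (e 0).1.1 (e 1).1.2 * (dot (e 0).1.1 (e 2).1.2)^-1).
  by rewrite -scalerA -h scalerA mulfV // scale1r.
have [j oj] : exists j, (o *m L0) 0 j != 0.
  apply/rV0Pn; apply: contraNneq o0 => h; by rewrite -[o](mulmxK uL0) h mul0mx.
have j3 : (2 < j)%N.
  rewrite ltnNge; apply: contra oj => j3; apply/eqP; apply: L0_head => //; rewrite dotBr !dotZr.
  - by rewrite !mulVf // subrr.
  - by rewrite (ve_dot ve 1) (ve_p3_on_2 ve) !mulr0 subrr.
  - by rewrite (ve_dot ve 2) (ve_p2_on_3 ve) !mulr0 subrr.
pose L := xcol j (o3 n) L0.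
have LE (x : vec) k : (x *m L) 0 k = (x *m L0) 0 (tperm j (o3 n) k).
  by rewrite !mxE; apply: eq_bigr => i _; rewrite !mxE.
have [||uD [g [cg ng ->]]] := @frame_model e H L ve.
- by rewrite LE tpermR.
- move=> x h0 h1 h2 h; rewrite -[x](mulmxK uL0).
  suff -> : x *m L0 = 0 by rewrite mul0mx.
  apply/rowP => k; rewrite [RHS]mxE; have [k3|k3] := ltnP k 3; first exact: L0_head.
  rewrite -[k](tpermK j (o3 n)) -LE h //.
  by case: tpermP => // _.
by eexists; exists g; split; [exact: uD|exact: cg|exact: ng|reflexivity].
Qed.
End Frame.

(** * Closed sets of configurations *)

Section ConfigTopology.
Variable K : numClosedFieldType.
Variables (n d : nat).
Local Notation vec := 'rV[K]_n.+1.
Local Notation E := {ffun 'I_3 -> equations K n d}.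
Local Notation cl := (config_closed K n d).

Definition good (e : E) := forall i, eqs_good (e i).

(** The zeros of such a function make up a set of configurations, although its
    values change when the equations are rescaled. *)
Definition saturated (h : E -> K) := forall e e', good e -> good e' ->
  config_of e = config_of e' -> h e = 0 -> h e' = 0.

Lemma closed_zeros (h : E -> K) : pfun h -> saturated h ->
  exists2 C, cl C & forall e, good e -> (C (config_of e) <-> h e = 0).
Proof.
move=> [q hq] sat.
pose C : set ('I_3 -> triple K n) := [set L | exists e, [/\ good e, L = config_of e & h e = 0]].
have CE e : good e -> (C (config_of e) <-> h e = 0).
  move=> ge; split=> [[e' [ge' ee' h0]]|h0]; last by exists e.
  exact: (sat e').
exists C => //; exists [set e | h e = 0].
  exists [set q]; apply/seteqP; split=> e /=; first by move=> h0 _ ->; rewrite -hq.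
  by move=> /(_ q erefl); rewrite -hq.
by move=> e L /good_configP ge; apply: CE.
Qed.

(** All the equations of all the sets [C] define the intersection. *)
Lemma config_closed_cap (F : set (set ('I_3 -> triple K n))) : F `<=` cl ->
  cl [set y | forall C, F C -> C y].
Proof.
move=> Fcl.
pose repr C (I : set {mpoly K[\dim {: E}]}) := forall e, good e ->
  (C (config_of e) <-> forall q, I q -> q.@[fun i => coord (vbasis {:E}) i e] = 0).
have rex C : F C -> exists I, repr C I.
  move=> /Fcl[A [I AE] h]; exists I => e ge; by have := h e ((good_configP e).2 ge); rewrite AE.
pose J : set {mpoly K[\dim {: E}]} := [set q | exists C I, [/\ F C, repr C I & I q]].
pose A : set E := [set e | forall q, J q -> q.@[fun i => coord (vbasis {:E}) i e] = 0].
have zA : zariski_closed E A by exists J.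
exists A; first exact: zA.
move=> e L /good_configP ge; split=> /= h.
  by move=> q [C [I [FC rI Iq]]]; apply: (rI e ge).1 Iq; apply: h.
move=> C FC; have [I rI] := rex C FC; apply/(rI e ge) => q Iq; apply: h.
by exists C, I.
Qed.

Lemma pfun_of_equations (V : vectType K) (phi : V -> E) (h : E -> K) :
  (forall i j, pfun (fun v => (phi v i).1.1 0 j)) ->
  (forall i j, pfun (fun v => (phi v i).1.2 0 j)) ->
  (forall i (y : vec), pfun (fun v => (phi v i).2.@[y 0])) ->
  pfun h -> pfun (fun v => h (phi v)).
Proof.
move=> hl hp hF [q hq]; apply: (@pfun_eq _ _ (fun v => q.@[fun i => coord (vbasis {:E}) i (phi v)])).
  by move=> v; rewrite hq.
apply: pfun_meval => i.
exact: (equations_coordinates (P := @pfun K V) (@pfunC K V) (@pfunD K V) (@pfunM K V) hl hp hF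
  (coord (vbasis {:E}) i)).
Qed.

Lemma config_pclosed (V : vectType K) (phi : V -> E) (U : set V) :
  (forall i j, pfun (fun v => (phi v i).1.1 0 j)) ->
  (forall i j, pfun (fun v => (phi v i).1.2 0 j)) ->
  (forall i (y : vec), pfun (fun v => (phi v i).2.@[y 0])) ->
  (forall u, U u -> good (phi u)) ->
  pclosed cl (fun v => config_of (phi v)) U.
Proof.
move=> hl hp hF gU Z [A [I AE] h].
exists [set f | exists2 q, I q & f = fun v => q.@[fun i => coord (vbasis {:E}) i (phi v)]].
  by move=> f [q _ ->]; apply: (pfun_of_equations hl hp hF (h := fun e => q.@[fun i => coord _ i e])); exists q.
move=> u Uu; have := h (phi u) ((good_configP _).2 (gU u Uu)); rewrite AE => -[h1 h2].
split=> [/h1 /= Au f [q Iq ->]|Au]; first exact: Au.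
by apply: h2 => q Iq; apply: (Au (fun v => q.@[fun i => coord (vbasis {:E}) i (phi v)])); exists q.
Qed.

End ConfigTopology.

(** * Nonsingular forms near a special one *)

Section NearFermat.
Variable K : numClosedFieldType.
Variables (n d : nat).
Hypothesis d3 : (3 <= d)%N.
Local Notation vec := 'rV[K]_n.+4.
Local Notation form := (dhomog n.+4 K d).

(** The monomial [y_3^d] is excluded by [cylindrical], and [y_2 y_3^(d-1)] makes
    up for it. *)
Definition special_mpoly : {mpoly K[n.+4]} :=
  'X_(o2 n) * 'X_(o3 n) ^+ d.-1 + 'X_(o2 n) ^+ d + \sum_(j < n.+4 | (3 < j)%N) 'X_j ^+ d.

Lemma special_homog : special_mpoly \is d.-homog.
Proof.
have X1 i : 'X_i \is [in K[n.+4], 1.-homog] by rewrite dhomogX; apply/eqP; exact: mdeg1.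
have Xk k i : 'X_i ^+ k \is [in K[n.+4], k.-homog].
  by have := dhomogMn k (X1 i); rewrite mul1n.
apply: rpredD; last by apply: rpred_sum => j _.
apply: rpredD => //; have := dhomogM (X1 (o2 n)) (Xk d.-1 (o3 n)).
by rewrite add1n prednK // (leq_trans _ d3).
Qed.

Definition special : form := DHomog special_homog.

Lemma special_line (z w : vec) : (line special z w)^`().[0] =
  w 0 (o2 n) * z 0 (o3 n) ^+ d.-1 + z 0 (o2 n) * (w 0 (o3 n) * z 0 (o3 n) ^+ d.-2 *+ d.-1)
  + w 0 (o2 n) * z 0 (o2 n) ^+ d.-1 *+ d
  + \sum_(j < n.+4 | (3 < j)%N) w 0 j * z 0 j ^+ d.-1 *+ d.
Proof.
have lX i : line 'X_i z w = (z 0 i)%:P + (w 0 i)%:P * 'X by rewrite /line mmapX mmap1U.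
have -> : line special z w = line 'X_(o2 n) z w * line 'X_(o3 n) z w ^+ d.-1
    + line 'X_(o2 n) z w ^+ d + \sum_(j < n.+4 | (3 < j)%N) line 'X_j z w ^+ d.
  rewrite /line /special /= /special_mpoly !mmapD rmorphM !rmorphXn raddf_sum /=.
  by congr (_ + _); apply: eq_bigr => j _; rewrite rmorphXn.
have dX i : (line 'X_i z w)^`() = (w 0 i)%:P.
  by rewrite lX derivD derivC derivM derivC derivX mul0r !add0r mulr1.
have eX i : (line 'X_i z w).[0] = z 0 i by rewrite lX hornerD hornerM !hornerC hornerX mulr0 addr0.
have dS (P : pred 'I_n.+4) (A : 'I_n.+4 -> {poly K}) :
    (\sum_(j | P j) A j)^`() = \sum_(j | P j) (A j)^`() by rewrite raddf_sum.
rewrite !derivD derivM !deriv_exp dS !hornerD !hornerM !hornerMn !hornerM !horner_exp.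
rewrite !dX !hornerC !eX horner_sum; congr (_ + _ + _ + _).
by apply: eq_bigr => j _; rewrite deriv_exp hornerMn hornerM horner_exp dX hornerC eX.
Qed.

Lemma exists_max_norm (m : nat) (f : 'I_m.+1 -> K) : exists k, forall j, `|f j| <= `|f k|.
Proof.
have H (s : seq 'I_m.+1) : exists k, forall j, j \in s -> `|f j| <= `|f k|.
  elim: s => [|i s [k IHk]]; first by exists ord0.
  have [ik|ki] := real_leP (normr_real (f i)) (normr_real (f k)).
    by exists k => j; rewrite in_cons => /orP[/eqP ->|/IHk].
  exists i => j; rewrite in_cons => /orP[/eqP -> //|/IHk jk].
  exact: le_trans jk (ltW ki).
have [k hk] := H (enum 'I_m.+1); by exists k => j; apply: hk; rewrite mem_enum.
Qed.

Lemma meval_bound (m : nat) (F : {mpoly K[m]}) (z : 'I_m -> K) : (forall i, `|z i| <= 1) ->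
  `|F.@[z]| <= \sum_(mu <- msupp F) `|F@_mu|.
Proof.
move=> z1; rewrite mevalE; apply: le_trans (ler_norm_sum _ _ _) _.
apply: ler_sum => mu _; rewrite normrM ler_piMr //.
rewrite normr_prod; apply: prodr_ile1 => i _; rewrite normr_ge0 /= normrX.
by apply: exprn_ile1.
Qed.

(** Scale a point so that its largest coordinate [y_k] has absolute value 1.  If
    all the derivatives of [special + t h] vanish at [y], those of [special] are
    at most [de = C |t|] there.  For [k > 3] the derivative by [y_k] exceeds that;
    for [k = 2] and [k = 3] the derivatives by [y_2] and [y_3] together do. *)
Lemma nonsingular_near (h : form) :
  exists2 eps : K, 0 < eps & forall t, `|t| < eps -> nonsingular (special + t *: h).
Proof.
pose B j := \sum_(mu <- msupp (dirder (delta_mx 0 j : vec) h)) `|(dirder (delta_mx 0 j : vec) h)@_mu|.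
pose C := \sum_(j < n.+4) B j.
have B0 j : 0 <= B j by apply: sumr_ge0.
have C0 : 0 <= C by apply: sumr_ge0.
have BC j : B j <= C by rewrite /C (bigD1 j) //= lerDl sumr_ge0.
have den0 : 0 < (C + 1) * d.+1%:R by rewrite mulr_gt0 ?ltr0n // ltr_wpDl.
exists ((C + 1) * d.+1%:R)^-1; first by rewrite invr_gt0.
move=> t te z [z0 z1] zn0.
have [k hk] := exists_max_norm (fun j => z 0 j).
have zk : z 0 k != 0.
  apply: contraNneq zn0 => zk; apply/eqP/rowP => j; rewrite mxE.
  by apply/eqP; rewrite -normr_le0 (le_trans (hk j)) // zk normr0.
pose s := `|z 0 k|^-1; have s0 : s != 0 by rewrite invr_eq0 normr_eq0.
pose y := s *: z.
have yk : `|y 0 k| = 1 by rewrite mxE normrM normfV normr_id mulVf // normr_eq0.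
have y1 j : `|y 0 j| <= 1 by rewrite mxE normrM normfV normr_id ler_pdivrMl ?normr_gt0 // mulr1.
have yz0 : y 0 (o0 n) = 0 by rewrite mxE z0 mulr0.
have yz1 : y 0 (o1 n) = 0 by rewrite mxE z1 mulr0.
pose g : form := special + t *: h.
have scale w : (line g y w)^`().[0] = s ^+ d * (line g z (s^-1 *: w))^`().[0].
  rewrite -hornerZ -derivZ; congr (_^`().[_]).
  apply/eqP; rewrite -subr_eq0; apply/eqP/poly_fun_eq0 => a.
  rewrite hornerD hornerN hornerZ !line_eval -form_scale scalerDr !scalerA.
  by rewrite mulrAC mulfV // mul1r subrr.
suff [j j2 hj] : exists2 j : 'I_n.+4, (1 < j)%N & (line g y (delta_mx 0 j))^`().[0] != 0.
  exists (s^-1 *: delta_mx 0 j).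
    by rewrite /base !mxE; case: j j2 {hj} => [[|[|j]] hj] //= _; rewrite mulr0.
  by move: hj; rewrite scale mulf_eq0 negb_or => /andP[].
apply: contrapT => none; clearbody y.
have vanish (j : 'I_n.+4) : (1 < j)%N -> (line special y (delta_mx 0 j))^`().[0] = - (t * (dirder (delta_mx 0 j : vec) h).@[y 0]).
  move=> j2; apply/eqP; rewrite -addr_eq0; apply: contrapT => /negP nz; apply: none; exists j => //.
  have gE : line g y (delta_mx 0 j) = line special y (delta_mx 0 j) + t *: line h y (delta_mx 0 j).
    have -> : (g : {mpoly K[n.+4]}) = (special : {mpoly K[n.+4]}) + t *: (h : {mpoly K[n.+4]}) by [].
    by rewrite /line mmapD mmapZ mul_polyC.
  by rewrite gE derivD derivZ hornerD hornerZ [(line h _ _)^`()]line_deriv line_eval scale0r addr0.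
pose de := `|t| * C.
have de0 : 0 <= de by rewrite mulr_ge0.
have bound (j : 'I_n.+4) : (1 < j)%N -> `|(line special y (delta_mx 0 j))^`().[0]| <= de.
  move=> j2; rewrite vanish // normrN normrM ler_wpM2l //.
  by apply: le_trans (BC j); apply: meval_bound.
have small : de * d.+1%:R < 1.
  apply: le_lt_trans (_ : `|t| * ((C + 1) * d.+1%:R) < 1).
    by rewrite /de -mulrA ler_wpM2l // ler_wpM2r // lerDl ler01.
  by rewrite -ltr_pdivlMr // mul1r.
have de1 : de < 1 by apply: le_lt_trans small; rewrite ler_peMr // ler1n.
have b2 := bound (o2 n) isT; have b3 := bound (o3 n) isT.
have dpos : (0 < d)%N by apply: leq_trans d3.
have sum0 (w : vec) : (forall j : 'I_n.+4, (3 < j)%N -> w 0 j = 0) ->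
    \sum_(j < n.+4 | (3 < j)%N) w 0 j * y 0 j ^+ d.-1 *+ d = 0.
  by move=> w0; apply: big1 => j hj; rewrite w0 // mul0r mul0rn.
rewrite special_line sum0 in b2; last first.
  by move=> j hj; rewrite mxE eqxx /= -val_eqE /= !(tail_index hj).
rewrite special_line sum0 in b3; last first.
  by move=> j hj; rewrite mxE eqxx /= -val_eqE /= !(tail_index hj).
rewrite !mxE /= !mul1r mul0r mul0rn mulr0 !addr0 in b2.
rewrite !mxE /= !mul1r !mul0r mul0rn add0r !addr0 in b3.
have le_mulrn (a : K) m : 0 <= a -> (0 < m)%N -> a <= a *+ m.
  by move=> a0; case: m => // m _; rewrite mulrSr lerDr mulrn_wge0.
have {}b3 : `|y 0 (o2 n)| * `|y 0 (o3 n)| ^+ d.-2 <= de.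
  apply: le_trans b3; rewrite mulrnAr normrMn normrM normrX. apply: le_mulrn; first by rewrite mulr_ge0 ?exprn_ge0.
  by rewrite -subn1 subn_gt0 (leq_trans _ d3).
have tail (j : 'I_n.+4) : (3 < j)%N -> `|y 0 j| ^+ d.-1 <= de.
  move=> hj; have := bound j (ltn_trans (isT : (1 < 3)%N) hj).
  rewrite special_line (bigD1 j) //= big1 => [|i /andP[_ ij]]; last first.
    by rewrite mxE (negbTE ij) andbF mul0r mul0rn.
  rewrite !mxE !eqxx -!val_eqE /= ![_ == (j : nat)]eq_sym !(tail_index hj) /= !mul0r mul0rn mulr0.
  rewrite mul0rn !add0r addr0 mul1r normrMn normrX.
  by apply: le_trans; apply: le_mulrn; rewrite ?exprn_ge0.
have nlt1 : ~ (1 <= de).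
  by move=> de1'; have := lt_le_trans de1 de1'; rewrite ltxx.
have d11 : d.-1 = d.-2.+1 by case: d d3 => [|[|]].
have k2 : (1 < k)%N.
  move: yk; case: (k) => [[|[|k']] hk'] //=.
    by rewrite (_ : Ordinal hk' = o0 n) ?yz0 ?normr0; [move/eqP; rewrite eq_sym oner_eq0|apply: val_inj].
  by rewrite (_ : Ordinal hk' = o1 n) ?yz1 ?normr0; [move/eqP; rewrite eq_sym oner_eq0|apply: val_inj].
have [k3|k3] := ltnP 3 k.
  by apply: nlt1; have := tail k k3; rewrite yk expr1n.
have [/eqP kE|kn] := boolP ((k : nat) == 2%N).
  have y2 : `|y 0 (o2 n)| = 1 by rewrite -yk; congr `|y 0 _|; apply: val_inj.
  apply: nlt1; rewrite y2 mul1r in b3.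
  have b3' : `|y 0 (o3 n)| ^+ d.-1 <= de.
    by rewrite d11 exprS; apply: le_trans b3; rewrite ler_piMl ?exprn_ge0.
  have : `|y 0 (o2 n) ^+ d.-1 *+ d| <= de + de.
    have -> : y 0 (o2 n) ^+ d.-1 *+ d = (y 0 (o3 n) ^+ d.-1 + y 0 (o2 n) ^+ d.-1 *+ d) - y 0 (o3 n) ^+ d.-1.
      by rewrite addrAC subrr add0r.
    by apply: le_trans (ler_normB _ _) _; apply: lerD => //; rewrite normrX.
  rewrite normrMn normrX y2 expr1n -mulr2n => le2.
  (* Here [d <= 2 de]; as [d >= 3], this contradicts [de < 1]. *)
  rewrite -(ler_pMn2r (isT : (0 < 2)%N)); apply: le_trans le2.
  by rewrite ler_nat (leq_trans _ d3).
have kE : (k : nat) = 3%N.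
  by move: k2 k3 kn; case: (k : nat) => [|[|[|[|]]]].
have y3 : `|y 0 (o3 n)| = 1 by rewrite -yk; congr `|y 0 _|; apply: val_inj.
rewrite y3 expr1n mulr1 in b3.
have b2' : `|y 0 (o2 n)| ^+ d.-1 <= de.
  by rewrite d11 exprS; apply: le_trans b3; rewrite ler_piMr ?exprn_ile1.
have : 1 <= de * d.+1%:R.
  have e1 : 1 = `|y 0 (o3 n) ^+ d.-1| by rewrite normrX y3 expr1n.
  rewrite [X in X <= _]e1.
  have -> : y 0 (o3 n) ^+ d.-1 = (y 0 (o3 n) ^+ d.-1 + y 0 (o2 n) ^+ d.-1 *+ d) - y 0 (o2 n) ^+ d.-1 *+ d.
    by rewrite addrK.
  apply: le_trans (ler_normB _ _) _; rewrite mulr_natr mulrS lerD //.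
  by rewrite normrMn normrX ler_wMn2r.
by move=> le1; have := le_lt_trans le1 small; rewrite ltxx.
Qed.

Lemma small_scalars (eps : K) : 0 < eps ->
  exists2 t : nat -> K, injective t & forall k, 0 < t k /\ `|t k| < eps.
Proof.
move=> e0; exists (fun k => eps / k.+2%:R) => [i j|k].
  by move/(mulfI (lt0r_neq0 e0))/invr_inj/natr_inj => [].
have t0 : 0 < eps / k.+2%:R by rewrite divr_gt0 ?ltr0n.
by split=> //; rewrite gtr0_norm // ltr_pdivrMr ?ltr0n // ltr_pMr // ltr1n.
Qed.
End NearFermat.

(** * Cylindrical forms and their monomials *)

Section Monomials.
Variable K : numClosedFieldType.

Definition mrestrict m (S : pred 'I_m) (F : {mpoly K[m]}) : {mpoly K[m]} :=
  \sum_(mu <- msupp F | [forall (i | S i), mu i == 0%N]) F@_mu *: 'X_[mu].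

Lemma mrestrict_eval m S (F : {mpoly K[m]}) y :
  (mrestrict S F).@[y] = F.@[fun i => if S i then 0 else y i].
Proof.
rewrite [in RHS]mevalE /mrestrict big_mkcond raddf_sum /=; apply: eq_bigr => mu _.
case: ifP => [/fintype.forall_inP h|nF].
  rewrite mevalZ mevalX; congr (_ * _); apply: eq_bigr => i _.
  by case: ifP => // Si; rewrite (eqP (h i Si)) !expr0.
have [i Si mui] : exists2 i, S i & mu i != 0%N.
  apply: contrapT => h; move/negP: nF; apply; apply/fintype.forall_inP => i Si.
  by apply: contrapT => /negP mui; apply: h; exists i.
by rewrite meval0 (bigD1 i) //= Si expr0n (negbTE mui) mul0r mulr0.
Qed.

Lemma mrestrict_coef m S (F : {mpoly K[m]}) mu :
  (mrestrict S F)@_mu = if [forall (i | S i), mu i == 0%N] then F@_mu else 0.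
Proof.
rewrite /mrestrict raddf_sum /=.
have [muF|muF] := boolP (mu \in msupp F); last first.
  rewrite big_seq_cond big1 => [|nu /andP[nuF _]]; first by rewrite memN_msupp_eq0 // if_same.
  rewrite mcoeffZ mcoeffX; case: eqP => [nE|_]; last by rewrite mulr0.
  by rewrite -nE nuF in muF.
rewrite big_mkcond (bigD1_seq mu) ?msupp_uniq //= big1 => [|nu nmu]; last first.
  by case: ifP => _; rewrite ?mcoeff0 // mcoeffZ mcoeffX (negbTE nmu) mulr0.
by rewrite addr0; case: ifP => _; rewrite ?mcoeff0 // mcoeffZ mcoeffX eqxx mulr1.
Qed.

Lemma independent_coef m S (F : {mpoly K[m]}) :
  (forall y, F.@[y] = F.@[fun i => if S i then 0 else y i]) ->
  forall (mu : 'X_{1..m}) i, S i -> (0 < mu i)%N -> F@_mu = 0.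
Proof.
move=> h mu i Si mui.
have -> : F = mrestrict S F.
  apply/eqP; rewrite -subr_eq0; apply/eqP/mpoly_fun_eq0 => y.
  by rewrite mevalB mrestrict_eval -h subrr.
rewrite mrestrict_coef; case: ifP => // /fintype.forall_inP/(_ i Si)/eqP mu0.
by rewrite mu0 in mui.
Qed.
End Monomials.

Section CylindricalForms.
Variable K : numClosedFieldType.
Variables (n d : nat).
Local Notation vec := 'rV[K]_n.+4.
Local Notation form := (dhomog n.+4 K d).

(** The last condition says that a monomial involving [y_3] vanishes for
    [y_2 = 0]. *)
Definition admissible (mu : 'X_{1..n.+4}) : bool :=
  [&& mdeg mu == d, mu (o0 n) == 0%N, mu (o1 n) == 0%N &
      (0 < mu (o2 n))%N || (mu (o3 n) == 0%N)].

Definition admissible_index : finType := {mu : 'X_{1..n.+4 < d.+1} | admissible mu}.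

Definition monomial (a : admissible_index) : 'X_{1..n.+4} := val (val a).

Lemma monomial_homog a : 'X_[monomial a] \is [in K[n.+4], d.-homog].
Proof. by rewrite dhomogX; have /and4P[] := valP a. Qed.

Definition monomial_form a : form := DHomog (monomial_homog a).

Definition combination (I : finType) (m : I -> admissible_index) (u : I -> K) : form :=
  \sum_a u a *: monomial_form (m a).

Lemma combination_coef (I : finType) (m : I -> admissible_index) u mu :
  (combination m u)@_mu = \sum_a u a * (monomial (m a) == mu)%:R.
Proof.
rewrite /combination raddf_sum /= raddf_sum /=; apply: eq_bigr => a _.
by rewrite mcoeffZ mcoeffX.
Qed.

Lemma combination_eval (I : finType) (m : I -> admissible_index) u (y : vec) :
  (combination m u).@[y 0] = \sum_a u a * \prod_i y 0 i ^+ monomial (m a) i.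
Proof.
rewrite /combination raddf_sum /= raddf_sum /=; apply: eq_bigr => a _.
by rewrite mevalZ mevalX.
Qed.

Lemma monomial_inj : injective monomial.
Proof. by move=> a b /val_inj/val_inj. Qed.

Lemma combination_cylindrical (I : finType) (m : I -> admissible_index) u : cylindrical (combination m u).
Proof.
have split4 (y : vec) a : \prod_i y 0 i ^+ monomial a i = \prod_(i < n.+4 | (1 < i)%N) y 0 i ^+ monomial a i.
  have /and4P[_ /eqP a0 /eqP a1 _] := valP a.
  rewrite (bigID (fun i : 'I_n.+4 => (1 < i)%N)) /= mulrC big1 ?mul1r // => -[[|[|k]] hk] //= _.
    by rewrite (_ : Ordinal hk = o0 n) ?a0 ?expr0 //; apply: val_inj.
  by rewrite (_ : Ordinal hk = o1 n) ?a1 ?expr0 //; apply: val_inj.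
split=> y z => [yz|y2 z2 yz]; rewrite !combination_eval; apply: eq_bigr => a _; congr (_ * _).
  by rewrite !split4; apply: eq_bigr => i hi; rewrite yz.
have /and4P[_ /eqP a0 /eqP a1 a23] := valP (m a).
have [a2|a2] := ltnP 0 (monomial (m a) (o2 n)).
  by rewrite (bigD1 (o2 n)) //= y2 [RHS](bigD1 (o2 n)) //= z2 expr0n gtn_eqF // !mul0r.
have a2' : monomial (m a) (o2 n) = 0%N by apply/eqP; rewrite -leqn0.
have a3 : monomial (m a) (o3 n) = 0%N.
  by move: a23; rewrite -/(monomial _) ltnNge a2 /= => /eqP.
apply: eq_bigr => -[[|[|[|[|k]]]] hk] _; last by rewrite yz.
- by rewrite (_ : Ordinal hk = o0 n) ?[monomial _ _]a0 ?expr0 //; apply: val_inj.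
- by rewrite (_ : Ordinal hk = o1 n) ?[monomial _ _]a1 ?expr0 //; apply: val_inj.
- by rewrite (_ : Ordinal hk = o2 n) ?a2' ?expr0 //; apply: val_inj.
- by rewrite (_ : Ordinal hk = o3 n) ?a3 ?expr0 //; apply: val_inj.
Qed.

Lemma cylindrical_combination (g : form) : cylindrical g ->
  g = combination id (fun a => g@_(monomial a)).
Proof.
move=> [g1 g2]; apply/val_inj/mpolyP => mu; rewrite combination_coef.
have row y : meval y g = g.@[(\row_i y i) 0].
  by apply: meval_eq => i; rewrite mxE.
have zero i : (i == o0 n) || (i == o1 n) -> (0 < mu i)%N -> g@_mu = 0.
  apply: (independent_coef (S := fun i => (i == o0 n) || (i == o1 n))) => y.
  rewrite row [RHS]row; apply: g1 => j hj; rewrite !mxE -!val_eqE /=.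
  by case: (j : nat) hj => [|[|]].
have zero3 : mu (o2 n) = 0%N -> (0 < mu (o3 n))%N -> g@_mu = 0.
  move=> m2 m3; pose g' := mrestrict (pred1 (o2 n)) (g : {mpoly K[n.+4]}).
  have : g'@_mu = 0.
    apply: (independent_coef (S := pred1 (o3 n)) _ (i := o3 n)) => //= y.
    rewrite !mrestrict_eval row [RHS]row; apply: g2; rewrite ?mxE ?eqxx //.
    move=> j hj; rewrite !mxE -!val_eqE /= !(tail_index hj).
    by [].
  rewrite mrestrict_coef ifT //; apply/fintype.forall_inP => i /eqP ->; exact/eqP.
have [adm|nadm] := boolP (admissible mu); last first.
  rewrite big1 => [|a _]; last first.
    case: eqP => [E|_]; last by rewrite mulr0.
    by case/negP: nadm; rewrite -E; exact: (valP a).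
  have [h|h] := eqVneq (mdeg mu) d; last exact: dhomog_nemf_coeff (dhomog_is_dhomog g) h.
  have [h0|h0] := posnP (mu (o0 n)); last by apply: zero h0; rewrite eqxx.
  have [h1|h1] := posnP (mu (o1 n)); last by apply: zero h1; rewrite eqxx orbT.
  have [h2|h2] := posnP (mu (o2 n)); last by case/negP: nadm; rewrite /admissible h h0 h1 h2 !eqxx.
  have [h3|h3] := posnP (mu (o3 n)); last exact: zero3.
  by case/negP: nadm; rewrite /admissible h h0 h1 h3 !eqxx orbT.
have mud : (mdeg mu < d.+1)%N by have /and4P[/eqP -> _ _ _] := adm.
pose a : admissible_index := Sub (BMultinom mud) adm.
rewrite (bigD1 a) //= big1 => [|b ba]; first by rewrite eqxx mulr1 addr0.
by case: eqP => [E|_]; [case/eqP: ba; apply: monomial_inj|rewrite mulr0].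
Qed.
End CylindricalForms.

(** * Irreducibility *)

Lemma pfun_functional (K : numFieldType) (V : vectType K) (f : V -> K) :
  (forall a u v, f (a *: u + v) = a * f u + f v) -> pfun f.
Proof.
move=> lf; pose i := GRing.isLinear.Build K V K^o _ f lf.
pose F : {linear V -> K^o} := HB.pack f i.
exact: (pfun_linear F).
Qed.

Section Irreducible.
Variable K : numClosedFieldType.
Variables (n d : nat).
Hypothesis d3 : (3 <= d)%N.
Let d1 : (1 < d)%N. Proof. exact: leq_trans d3. Qed.
Local Notation vec := 'rV[K]_n.+4.
Local Notation form := (dhomog n.+4 K d).

Lemma pfun_mulmx (V : vectType K) m1 m2 m3 (A : V -> 'M[K]_(m1, m2)) (B : V -> 'M[K]_(m2, m3)) :
  (forall i j, pfun (fun v => A v i j)) -> (forall i j, pfun (fun v => B v i j)) ->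
  forall i j, pfun (fun v => (A v *m B v) i j).
Proof.
move=> hA hB i j; apply: (@pfun_eq _ _ (fun v => \sum_k A v i k * B v k j)).
  by move=> v; rewrite mxE.
by apply: pfun_sum => k _; apply: pfunM.
Qed.

Section PfunModel.
Variables (V : vectType K) (D : V -> 'M[K]_n.+4) (g : V -> form).
Hypotheses (hD : forall i j, pfun (fun v => D v i j)).
Hypothesis (hg : forall y : vec, pfun (fun v => (g v).@[y 0])).

Lemma pfun_model_l i j : pfun (fun v => (model (D v) (g v) i).1.1 0 j).
Proof. by apply: pfun_eq (hD j (hidx n i)) => v; rewrite ffunE /= !mxE. Qed.

Lemma pfun_model_p i j : pfun (fun v => (model (D v) (g v) i).1.2 0 j).
Proof.
apply: (@pfun_eq _ _ (fun v => (apex K n i *m \adj (D v)) 0 j)) => [v|].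
  by rewrite ffunE.
by apply: pfun_mulmx => [*|]; [apply: pfunC|apply: pfun_adj].
Qed.

Lemma pfun_model_F i (y : vec) : pfun (fun v => (model (D v) (g v) i).2.@[y 0]).
Proof.
apply: (@pfun_eq _ _ (fun v => (g v).@[(y *m (D v *m lin1_mx (@proj K n i))) 0])) => [v|].
  by rewrite ffunE fsubst_eval.
apply: pfun_eval => // j; apply: pfun_mulmx => [*|]; first exact: pfunC.
by apply: pfun_mulmx => // *; apply: pfunC.
Qed.
End PfunModel.

Lemma pfun_combination (V : vectType K) (I : finType) (m : I -> admissible_index n d) (u : V -> I -> K) (y : vec) :
  (forall i, pfun (fun v => u v i)) ->
  pfun (fun v => (special K n d3 + combination m (u v)).@[y 0]).
Proof.
move=> hu; apply: (@pfun_eq _ _ (fun v => (special K n d3).@[y 0] + \sum_a u v a * \prod_i y 0 i ^+ monomial (m a) i)).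
  by move=> v; rewrite fevalD combination_eval.
apply: pfunD; first exact: pfunC.
by apply: pfun_sum => a _; apply: pfunM => //; apply: pfunC.
Qed.

Lemma cylindrical_add (g h : form) : cylindrical g -> cylindrical h -> cylindrical (g + h).
Proof.
move=> [g1 g2] [h1 h2]; split=> y z => [yz|y2 z2 yz]; rewrite !fevalD.
  by rewrite (g1 y z) // (h1 y z).
by rewrite (g2 y z) // (h2 y z).
Qed.

Lemma cylindrical_opp (g : form) : cylindrical g -> cylindrical (- g).
Proof.
move=> [g1 g2]; split=> y z => [yz|y2 z2 yz]; rewrite !fevalN.
  by rewrite (g1 y z).
by rewrite (g2 y z).
Qed.

Lemma special_eval (y : vec) : (special K n d3).@[y 0] =
  y 0 (o2 n) * y 0 (o3 n) ^+ d.-1 + y 0 (o2 n) ^+ d + \sum_(j < n.+4 | (3 < j)%N) y 0 j ^+ d.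
Proof.
rewrite /= /special_mpoly !mevalD mevalM !rmorphXn raddf_sum /= !mevalXU.
by congr (_ + _); apply: eq_bigr => j _; rewrite rmorphXn /= mevalXU.
Qed.

Lemma special_cylindrical : cylindrical (special K n d3).
Proof.
split=> y z => [yz|y2 z2 yz]; rewrite !special_eval.
  rewrite !yz //; congr (_ + _); apply: eq_bigr => j hj; rewrite yz //.
  by apply: ltn_trans hj.
by rewrite y2 z2 !mul0r; congr (_ + _); apply: eq_bigr => j hj; rewrite yz.
Qed.

(** On a line through 0 the determinant is a polynomial that is 1 at 0, and
    infinitely many small multiples of [w] are available by [nonsingular_near]. *)
Lemma line_dense_near (V : vectType K) (D : V -> 'M[K]_n.+4) (h : V -> form) :
  (forall i j, pfun (fun v => D v i j)) -> (D 0 = 1%:M) ->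
  (forall t v, h (t *: v) = t *: h v) ->
  line_dense setT [set v | D v \in unitmx /\ nonsingular (special K n d3 + h v)].
Proof.
move=> hD D0 hh w _ p p0.
have [q hq] := pfun_line 0 w (pfun_det hD).
have q0 : q != 0.
  apply/eqP => q0; have := hq 0; rewrite scale0r addr0 D0 det1 q0 horner0 => /eqP.
  by rewrite oner_eq0.
have [eps e0 he] := nonsingular_near d3 (h w).
have [t tI ht] := small_scalars e0.
have [k tk] : exists k, (p * q).[t k] != 0.
  apply: contrapT => none; have : p * q != 0 by rewrite mulf_neq0.
  case/eqP; apply: (poly_infinite_root tI) => k; apply: contrapT => /eqP nz.
  by apply: none; exists k.
move: tk; rewrite hornerM mulf_eq0 negb_or => /andP[pt qt]; exists (t k) => //; split.
  by rewrite unitmxE unitfE; move: qt; rewrite -hq add0r.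
by rewrite hh; apply: he; have [] := ht k.
Qed.

(** The pairs [(D, g)] are translated by the identity and [special], to put a good
    pair at the origin. *)
Lemma Vint_irreducible : irreducible (config_closed K n.+3 d) (Vint K n.+3 d).
Proof.
pose J := #|admissible_index n d|.
pose V : vectType K := ('M[K]_n.+4 * 'rV[K]_J)%type.
pose D (v : V) : 'M[K]_n.+4 := 1%:M + v.1.
pose h (v : V) : form := combination (fun i : 'I_J => enum_val i) (fun i => v.2 0 i).
pose phi (v : V) := model (D v) (special K n d3 + h v).
pose U : set V := [set v | D v \in unitmx /\ nonsingular (special K n d3 + h v)].
have hD i j : pfun (fun v => D v i j).
  apply: (@pfun_eq _ _ (fun v : V => (1%:M : 'M[K]_n.+4) i j + v.1 i j)).
    by move=> v; rewrite !mxE.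
  apply: pfunD; first exact: pfunC.
  by apply: pfun_functional => a u v; rewrite !mxE.
have hg (y : vec) : pfun (fun v => (special K n d3 + h v).@[y 0]).
  apply: (@pfun_combination V) => i; apply: pfun_functional => a u v; by rewrite !mxE.
have cyl v : cylindrical (special K n d3 + h v).
  by apply: cylindrical_add; [exact: special_cylindrical|exact: combination_cylindrical].
have dU : line_dense setT U.
  apply: line_dense_near => //; first by rewrite /D addr0.
  move=> t v; rewrite /h /combination scaler_sumr; apply: eq_bigr => i _.
  by rewrite !mxE scalerA.
have -> : Vint K n.+3 d = (fun v => config_of (phi v)) @` U.
  apply/seteqP; split=> [L|_ [v [uD ns] <-]]; last exact: (model_Vint uD ns (cyl v)).
  move=> /(Vint_model d1)[D' [g [uD' cg ng ->]]].
  have cg' : cylindrical (g - special K n d3).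
    by apply: cylindrical_add => //; apply: cylindrical_opp; apply: special_cylindrical.
  pose v : V := (D' - 1%:M, \row_i (g - special K n d3 : form)@_(monomial (enum_val i))).
  have Dv : D v = D' by rewrite /D addrC subrK.
  have gv : special K n d3 + h v = g.
    suff <- : g - special K n d3 = h v by rewrite addrC subrK.
    rewrite [LHS](cylindrical_combination cg') /h /combination.
    rewrite (reindex (@enum_val (admissible_index n d) predT)) /=; last first.
      by exists enum_rank => x _; rewrite ?enum_valK ?enum_rankK.
    by apply: eq_bigr => i _; rewrite mxE.
  exists v; last by rewrite /phi Dv gv.
  by split; rewrite ?Dv ?gv.
apply: (irreducible_image (W := setT)) => //.
apply: config_pclosed => //.
- exact: pfun_model_l.
- exact: pfun_model_p.
- exact: pfun_model_F.
by move=> u [uD ns] i; apply: model_good.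
Qed.
End Irreducible.

(** * A chart *)

Section Chart.
Variable K : numClosedFieldType.
Variables (n d : nat).
Hypothesis d3 : (3 <= d)%N.
Local Notation vec := 'rV[K]_n.+4.
Local Notation form := (dhomog n.+4 K d).
Local Notation E := {ffun 'I_3 -> equations K n.+3 d}.

Lemma pivot_admissible : admissible d (U_(o2 n) *+ d)%MM.
Proof.
apply/and4P; split; rewrite ?mulmnE ?mnm1E ?mdegMn ?mdeg1 ?mul1n //.
by rewrite ?eqxx /= ?mul1n (leq_trans _ d3).
Qed.

Lemma pivot_bound : (mdeg (U_(o2 n) *+ d)%MM < d.+1)%N.
Proof. by rewrite mdegMn mdeg1 mul1n. Qed.

(** The coefficient of [y_2^d] is the one normalised to 1. *)
Definition pivot : admissible_index n d := Sub (BMultinom pivot_bound) pivot_admissible.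

Definition free_index : finType := {a : admissible_index n d | a != pivot}.

Definition free_monomial (k : 'I_#|free_index|) : admissible_index n d := val (enum_val k).

Lemma card_free_index : #|free_index| = #|admissible_index n d|.-1.
Proof. by rewrite card_sig -(cardC1 pivot). Qed.

Local Notation a := #|free_index|.
Local Notation b := (n.+2 + (n.+1 + n.+1))%N.
Local Notation c := (3 * n.+3)%N.
(** The order of the blocks matters: parameters are equated to 0 from the last one
    on, and without those of the hyperplanes the vertices are easy to recover, then
    [g] when both are standard. *)
Definition chart_dim := (a + (b + c))%N.
Local Notation par := 'rV[K]_chart_dim.

Definition par_g (u : par) : 'rV[K]_a := lsubmx (u : 'rV_(a + (b + c))).
Definition par_p (u : par) : 'rV[K]_b := lsubmx (rsubmx (u : 'rV_(a + (b + c)))).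
Definition par_l (u : par) : 'M[K]_(3, n.+3) := vec_mx (rsubmx (rsubmx (u : 'rV_(a + (b + c))))).

Definition chart_l (u : par) (i : 'I_3) : vec := \row_j
  if unlift (hidx n i) j is Some k then par_l u i k else 1.

Definition shift2 (v : 'rV[K]_n.+2) : vec := row_mx (0 : 'rV_2) v.
Definition shift3 (v : 'rV[K]_n.+1) : vec := row_mx (0 : 'rV_3) v.

(** These are the vertices themselves when the hyperplanes are standard.  In
    general their coordinates of index at least 3 are those of the scaled vertices,
    and coordinate 2 of the first one is the value of [l_2] there; the incidences and
    the scaling determine the rest. *)
Definition chart_p (u : par) (i : 'I_3) : vec := apex K n i +
  if (i == 0 :> nat) then shift2 (lsubmx (par_p u))
  else if (i == 1 :> nat) then shift3 (lsubmx (rsubmx (par_p u)))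
  else shift3 (rsubmx (rsubmx (par_p u))).

Definition chart_D (u : par) : 'M[K]_n.+4 :=
  frame (chart_l u 0) (chart_l u 1) (chart_l u 2) (chart_p u 0 0 (o2 n))
    (chart_p u 0) (chart_p u 1) (chart_p u 1 - chart_p u 2) 1%:M.

Definition chart_h (u : par) : form := combination free_monomial (par_g u 0).

Definition chart (u : par) : E := model (chart_D u) (special K n d3 + chart_h u).

Definition chart_dom : set par := [set u | chart_D u \in unitmx /\ nonsingular (special K n d3 + chart_h u)].

Lemma pfun_par_g i j : pfun (fun u => par_g u i j).
Proof. by apply: pfun_functional => x u v; rewrite /par_g linearP !mxE. Qed.

Lemma pfun_par_l i j : pfun (fun u => par_l u i j).
Proof. by apply: pfun_functional => x u v; rewrite /par_l !linearP !mxE. Qed.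

Lemma pfun_chart_l i j : pfun (fun u => chart_l u i 0 j).
Proof.
case E1: (unlift (hidx n i) j) => [k|].
  by apply: pfun_eq (pfun_par_l i k) => u; rewrite [RHS]mxE E1.
by apply: pfun_eq (pfunC _ 1) => u; rewrite [RHS]mxE E1.
Qed.

Lemma shift2_linear x u v : shift2 (x *: u + v) = x *: shift2 u + shift2 v.
Proof.
rewrite /shift2 -[RHS]/(x *: row_mx (0 : 'rV_2) u + row_mx (0 : 'rV_2) v).
by rewrite scale_row_mx add_row_mx scaler0 addr0.
Qed.

Lemma shift3_linear x u v : shift3 (x *: u + v) = x *: shift3 u + shift3 v.
Proof.
rewrite /shift3 -[RHS]/(x *: row_mx (0 : 'rV_3) u + row_mx (0 : 'rV_3) v).
by rewrite scale_row_mx add_row_mx scaler0 addr0.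
Qed.

Lemma pfun_chart_p i j : pfun (fun u => chart_p u i 0 j).
Proof.
rewrite /chart_p; under eq_fun do rewrite mxE.
apply: pfunD; first exact: pfunC.
apply: pfun_functional => x u v; rewrite /par_p !linearP /=.
by case: ifP => _; [|case: ifP => _]; rewrite ?shift2_linear ?shift3_linear !mxE.
Qed.

Lemma pfun_chart_D i j : pfun (fun u => chart_D u i j).
Proof.
have hl k (x : vec) : pfun (fun u => dot (chart_l u k) x).
  apply: (@pfun_eq _ _ (fun u => \sum_j x 0 j * chart_l u k 0 j)) => [u|]; first by rewrite dotE.
  by apply: pfun_sum => j' _; apply: pfunM; [exact: pfunC|exact: pfun_chart_l].
have hc k (x : vec) : pfun (fun u => frame_coord (chart_l u 0) (chart_l u 1) (chart_p u 0) (chart_p u 1) 1%:M k x).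
  rewrite /frame_coord; apply: pfunB; first apply: pfunB; first exact: pfunC.
    by apply: pfunM => //; exact: pfun_chart_p.
  by apply: pfunM => //; exact: pfun_chart_p.
have hd k : pfun (fun u => (chart_p u 1 - chart_p u 2) 0 k).
  apply: (@pfun_eq _ _ (fun u => chart_p u 1 0 k - chart_p u 2 0 k)) => [u|].
    by rewrite !mxE.
  by apply: pfunB; exact: pfun_chart_p.
pose f u := frame_map (chart_l u 0) (chart_l u 1) (chart_l u 2) (chart_p u 0 0 (o2 n))
    (chart_p u 0) (chart_p u 1) (chart_p u 1 - chart_p u 2) 1%:M.
apply: (@pfun_eq _ _ (fun u => f u (delta_mx 0 i) 0 j)) => [u|]; first by rewrite [RHS]mxE.
rewrite /f; under eq_fun do rewrite mxE.
have pif (x : bool) (f1 f2 : par -> K) : pfun f1 -> pfun f2 -> pfun (fun u => if x then f1 u else f2 u).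
  by case: x.
apply: (pif); first by apply: pfunM.
apply: (pif); first by apply: pfunM => //; apply: pfunN; exact: pfun_chart_p.
by do 2![apply: (pif) => //]; apply: pfunB; apply: pfunM.
Qed.

Lemma pfun_chart_g (y : vec) : pfun (fun u => (special K n d3 + chart_h u).@[y 0]).
Proof. by apply: (@pfun_combination K n d d3 par) => i; exact: pfun_par_g. Qed.

Lemma frame_std : frame (delta_mx 0 (o0 n)) (delta_mx 0 (o1 n)) (delta_mx 0 (o2 n)) (-1)
  (apex K n 0) (apex K n 1) (apex K n 1 - apex K n 2) 1%:M = 1%:M :> 'M[K]_n.+4.
Proof.
apply/row_matrixP => i; rewrite !rowE mul_frame mulmx1; set x := delta_mx 0 i.
have fE (j : 'I_n.+4) : (2 < j)%N -> frame_coord (delta_mx 0 (o0 n)) (delta_mx 0 (o1 n)) (apex K n 0) (apex K n 1) 1%:M j x = x 0 j.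
  move=> hj; rewrite /frame_coord mulmx1 !mxE.
  by case: (j : nat) hj => [|[|[|k]]] //= _; rewrite subrr !mul0r !subr0.
have dE j : dot (delta_mx 0 j) x = x 0 j by rewrite dotC dot_delta.
have cE : (apex K n 1 - apex K n 2) 0 (o3 n) = 1 by rewrite !mxE /=; ring.
have cj (j : 'I_n.+4) : (3 < j)%N -> (apex K n 1 - apex K n 2) 0 j = 0.
  by move=> hj; rewrite !mxE !(tail_index hj) /=; ring.
apply: vec_eq => [||||j hj]; rewrite [LHS]mxE /=; last first.
  by rewrite !(tail_index hj) cE cj // !fE ?(ltnW hj) //; ring.
all: by rewrite ?fE // ?dE ?opprK ?cE ?mul1r.
Qed.

Lemma chart_l0 (u : par) i : par_l u = 0 -> chart_l u i = delta_mx 0 (hidx n i).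
Proof.
move=> u0; apply/rowP => j; rewrite !mxE eqxx /=.
by case: unliftP => [k ->|->]; rewrite ?u0 ?mxE ?eqxx // eq_sym (negbTE (neq_lift _ _)).
Qed.

Lemma shift20 : shift2 0 = 0.
Proof. by have := shift2_linear (-1) 0 0; rewrite scaler0 addr0 scaleN1r addNr. Qed.

Lemma shift30 : shift3 0 = 0.
Proof. by have := shift3_linear (-1) 0 0; rewrite scaler0 addr0 scaleN1r addNr. Qed.

Lemma chart_p0 (u : par) i : par_p u = 0 -> chart_p u i = apex K n i.
Proof. by move=> u0; rewrite /chart_p u0 !linear0 shift20 shift30 !if_same addr0. Qed.

Lemma hidxE : (hidx n 0 = o0 n) * (hidx n 1 = o1 n) * (hidx n 2 = o2 n).
Proof. by do ![split]; apply: val_inj. Qed.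

Lemma chart_D0 (u : par) : par_l u = 0 -> par_p u = 0 -> chart_D u = 1%:M.
Proof.
move=> l0 p0; rewrite /chart_D !chart_l0 // !chart_p0 // !hidxE -[RHS]frame_std.
by congr (frame _ _ _ _ _ _ _ _); rewrite mxE /= sub0r.
Qed.

Lemma chart_dom_dense : line_dense setT chart_dom.
Proof.
apply: line_dense_near => //; first exact: pfun_chart_D.
  by apply: chart_D0; rewrite /par_l /par_p !linear0.
move=> t u; rewrite /chart_h /combination scaler_sumr; apply: eq_bigr => i _.
by rewrite /par_g linearZ mxE scalerA.
Qed.

Lemma chart_cylindrical (u : par) : cylindrical (special K n d3 + chart_h u).
Proof. by apply: cylindrical_add; [exact: special_cylindrical|exact: combination_cylindrical]. Qed.

Lemma chart_Vint u : chart_dom u -> Vint K n.+3 d (config_of (chart u)).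
Proof. by move=> [uD ns]; apply: model_Vint uD ns (chart_cylindrical u). Qed.

Lemma chart_good u : chart_dom u -> good (chart u).
Proof. by move=> [uD ns] i; apply: model_good. Qed.

Lemma chart_pclosed : pclosed (config_closed K n.+3 d) (fun u => config_of (chart u)) chart_dom.
Proof.
apply: config_pclosed; last exact: chart_good.
- by move=> i j; apply: pfun_model_l; exact: pfun_chart_D.
- by move=> i j; apply: pfun_model_p; exact: pfun_chart_D.
- by move=> i y; apply: pfun_model_F; [exact: pfun_chart_D|exact: pfun_chart_g].
Qed.

End Chart.

(** * Functions whose zeros are determined by the configuration *)

Section Reduce.
Variable K : numClosedFieldType.
Variables (n d : nat).
Local Notation vec := 'rV[K]_n.+1.
Local Notation form := (dhomog n.+1 K d).
Local Notation E := {ffun 'I_3 -> equations K n d}.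

(** The composition of [F] with the projection to the hyperplane along [e_k],
    multiplied by [l_k] to avoid denominators.  It only depends on the restriction
    of [F] to the hyperplane. *)
Definition reduce (l : vec) (k : 'I_n.+1) (F : form) : form :=
  fsubst ((l 0 k)%:M - l^T *m delta_mx 0 k) F.

Lemma reduce_eval (l : vec) k (F : form) (x : vec) :
  (reduce l k F).@[x 0] = F.@[(l 0 k *: x - dot l x *: delta_mx 0 k) 0].
Proof.
by rewrite fsubst_eval mulmxBr mul_mx_scalar mulmxA [x *m l^T]mx11_scalar mul_scalar_mx.
Qed.

Lemma reduce_mem (l : vec) k (x : vec) : l 0 k *: x - dot l x *: delta_mx 0 k \in hyperplane l.
Proof. by rewrite mem_hyperplane dotBr !dotZr dot_delta mulrC subrr. Qed.

Lemma form_ext (F G : form) : (forall x : vec, F.@[x 0] = G.@[x 0]) -> F = G.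
Proof.
move=> h; apply/eqP; rewrite -subr_eq0; apply/eqP/form_eq0 => x.
by rewrite /form_at fevalD fevalN h subrr.
Qed.

Lemma reduce_scale (l : vec) k (F F' : form) c f : f != 0 ->
  (forall x, x \in hyperplane l -> F.@[x 0] = f * F'.@[x 0]) ->
  reduce (c *: l) k F' = (c ^+ d / f) *: reduce l k F.
Proof.
move=> f0 FF; apply: form_ext => x; rewrite fevalZ !reduce_eval FF ?reduce_mem //.
rewrite mulrA divfK // -form_scale mxE dotZl scalerBr !scalerA.
by [].
Qed.

Lemma pfun_eq_l i j : pfun (fun e : E => (e i).1.1 0 j).
Proof. by apply: pfun_functional => x u v; rewrite !ffunE /= !mxE. Qed.

Lemma pfun_eq_p i j : pfun (fun e : E => (e i).1.2 0 j).
Proof. by apply: pfun_functional => x u v; rewrite !ffunE /= !mxE. Qed.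

Lemma pfun_eq_F i (y : vec) : pfun (fun e : E => (e i).2.@[y 0]).
Proof. by apply: pfun_functional => x u v; rewrite !ffunE -fevalZ -fevalD. Qed.

Lemma pfun_dot (V : vectType K) (l x : V -> vec) : (forall j, pfun (fun v => l v 0 j)) ->
  (forall j, pfun (fun v => x v 0 j)) -> pfun (fun v => dot (l v) (x v)).
Proof.
move=> hl hx; apply: (@pfun_eq _ _ (fun v => \sum_j x v 0 j * l v 0 j)) => [v|].
  by rewrite dotE.
by apply: pfun_sum => j _; apply: pfunM.
Qed.

Lemma pfun_reduce i k (y : vec) : pfun (fun e : E => (reduce (e i).1.1 k (e i).2).@[y 0]).
Proof.
apply: (@pfun_eq _ _ (fun e : E => (e i).2.@[((e i).1.1 0 k *: y - dot (e i).1.1 y *: delta_mx 0 k) 0])).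
  by move=> e; rewrite reduce_eval.
apply: pfun_eval => [z|j]; first exact: pfun_eq_F.
apply: (@pfun_eq _ _ (fun e : E => (e i).1.1 0 k * y 0 j - dot (e i).1.1 y * (delta_mx 0 k : vec) 0 j)).
  by move=> e; rewrite !mxE.
apply: pfunB; apply: pfunM; try exact: pfunC; first exact: pfun_eq_l.
by apply: pfun_dot => ?; [exact: pfun_eq_l|exact: pfunC].
Qed.

Lemma pfun_reduce_functional i k (lam : {linear form -> K^o}) :
  pfun (fun e : E => lam (reduce (e i).1.1 k (e i).2)).
Proof.
have [s hs] := functional_form lam.
apply: (@pfun_eq _ _ (fun e : E => \sum_(xc <- s) (reduce (e i).1.1 k (e i).2).@[xc.1 0] * xc.2)).
  by move=> e; rewrite hs.
by apply: pfun_sum => xc _; apply: pfunM; [exact: pfun_reduce|exact: pfunC].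
Qed.

Lemma saturatedM (h k : E -> K) : saturated h -> saturated k -> saturated (fun e => h e * k e).
Proof.
move=> sh sk e e' ge ge' ee' /eqP; rewrite mulf_eq0 => /orP[] /eqP h0.
  by rewrite (sh e e') // mul0r.
by rewrite (sk e e') // mulr0.
Qed.

Lemma saturated_l i j : saturated (fun e : E => (e i).1.1 0 j).
Proof.
move=> e e' ge ge' ee' h; have [[c _ ->] _ _] := same_config ge ge' ee' i.
by rewrite mxE h mulr0.
Qed.

Lemma saturated_p i (lam : vec -> K) : (forall c x, lam (c *: x) = c * lam x) ->
  saturated (fun e : E => lam (e i).1.2).
Proof.
move=> lZ e e' ge ge' ee' h; have [_ [c _ ->] _] := same_config ge ge' ee' i.
by rewrite lZ h mulr0.
Qed.

Lemma saturated_reduce i k (lam : {linear form -> K^o}) :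
  saturated (fun e : E => lam (reduce (e i).1.1 k (e i).2)).
Proof.
move=> e e' ge ge' ee' h; have [[c _ ->] _ [f f0 FF]] := same_config ge ge' ee' i.
by rewrite (reduce_scale k c f0 FF) linearZ /= h scaler0.
Qed.
End Reduce.

Section LowerBound.
Variable K : numClosedFieldType.
Variables (n d : nat).
Hypothesis d3 : (3 <= d)%N.
Local Notation vec := 'rV[K]_n.+4.
Local Notation E := {ffun 'I_3 -> equations K n.+3 d}.
Local Notation par := 'rV[K]_(chart_dim n d3).
Local Notation chart := (@chart K n d d3).
Local Notation dom := (@chart_dom K n d d3).

Lemma chart_lE (u : par) : dom u -> forall i, exists2 s, s != 0 & (chart u i).1.1 = s *: chart_l u i.
Proof.
move=> du i; have [l0 _ _ _ _ _] := chart_good du i.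
suff [s E] : exists s, (chart u i).1.1 = s *: chart_l u i.
  by exists s => //; apply: contraNneq l0 => s0; rewrite E s0 scale0r.
rewrite ffunE /=; set D := chart_D u.
have colE j : (col (hidx n i) D)^T 0 j = ((delta_mx 0 j : vec) *m D) 0 (hidx n i).
  transitivity (row j D 0 (hidx n i)); [by rewrite !mxE|by rewrite rowE].
elim/ord3_ind: i {l0} colE => colE.
- exists ((chart_p u 1 - chart_p u 2) 0 (o3 n)); apply/rowP => j.
  by rewrite colE mul_frame mxE /= dot_delta [RHS]mxE.
- exists (- (chart_p u 0 0 (o2 n))); apply/rowP => j.
  by rewrite colE mul_frame mxE /= dot_delta [RHS]mxE.
- exists 1; apply/rowP => j.
  by rewrite colE mul_frame mxE /= dot_delta [RHS]mxE mul1r.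
Qed.

Definition unit_index (i : 'I_3) : 'I_n.+4 := if (i == 0 :> nat) then o1 n else o0 n.

Lemma shift2_low (v : 'rV[K]_n.+2) (k : 'I_2) : shift2 v 0 (lshift n.+2 k) = 0.
Proof. by have := row_mxEl (0 : 'rV[K]_2) v 0 k; rewrite [RHS]mxE. Qed.

Lemma shift2_high (v : 'rV[K]_n.+2) (k : 'I_n.+2) : shift2 v 0 (rshift 2 k) = v 0 k.
Proof. exact: (row_mxEr (0 : 'rV[K]_2) v 0 k). Qed.

Lemma shift3_low (v : 'rV[K]_n.+1) (k : 'I_3) : shift3 v 0 (lshift n.+1 k) = 0.
Proof. by have := row_mxEl (0 : 'rV[K]_3) v 0 k; rewrite [RHS]mxE. Qed.

Lemma shift3_high (v : 'rV[K]_n.+1) (k : 'I_n.+1) : shift3 v 0 (rshift 3 k) = v 0 k.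
Proof. exact: (row_mxEr (0 : 'rV[K]_3) v 0 k). Qed.

Lemma shift2E (v : 'rV[K]_n.+2) : shift2 v 0 (o0 n) = 0 /\ shift2 v 0 (o1 n) = 0.
Proof.
by split; [rewrite -[RHS](shift2_low v 0)|rewrite -[RHS](shift2_low v 1)];
  congr (shift2 v 0 _); apply: val_inj.
Qed.

Lemma shift3E (v : 'rV[K]_n.+1) :
  [/\ shift3 v 0 (o0 n) = 0, shift3 v 0 (o1 n) = 0 & shift3 v 0 (o2 n) = 0].
Proof.
by split; [rewrite -[RHS](shift3_low v 0)|rewrite -[RHS](shift3_low v 1)|rewrite -[RHS](shift3_low v 2)];
  congr (shift3 v 0 _); apply: val_inj.
Qed.

Lemma chart_p_head (u : par) :
  [/\ chart_p u 0 0 (o0 n) = 0 /\ chart_p u 0 0 (o1 n) = 1,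
   [/\ chart_p u 1 0 (o0 n) = 1, chart_p u 1 0 (o1 n) = 0 & chart_p u 1 0 (o2 n) = 0] &
   [/\ chart_p u 2 0 (o0 n) = 1, chart_p u 2 0 (o1 n) = 0 & chart_p u 2 0 (o2 n) = 0] ].
Proof.
have s2 v := shift2E v; have s3 v := shift3E v.
split.
- have [h0 h1] := s2 (lsubmx (par_p u)).
  by split; rewrite /chart_p /= [LHS]mxE ?h0 ?h1 mxE /=; ring.
- have [h0 h1 h2] := s3 (lsubmx (rsubmx (par_p u))).
  by split; rewrite /chart_p /= [LHS]mxE ?h0 ?h1 ?h2 mxE /=; ring.
- have [h0 h1 h2] := s3 (rsubmx (rsubmx (par_p u))).
  by split; rewrite /chart_p /= [LHS]mxE ?h0 ?h1 ?h2 mxE /=; ring.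
Qed.

(** For standard hyperplanes the frame sends [chart_p u i] to a multiple of
    [apex i]. *)
Lemma chart_pE (u : par) : dom u -> par_l u = 0 ->
  forall i, exists2 s, s != 0 & (chart u i).1.2 = s *: chart_p u i.
Proof.
move=> [uD _] l0 i; have detD : \det (chart_D u) != 0 by rewrite -unitfE -unitmxE.
have [[p00 p01] [p10 p11 p12] [p20 p21 p22]] := chart_p_head u.
suff [s E] : exists s, chart_p u i *m chart_D u = s *: apex K n i.
  have s0 : s != 0.
    apply/eqP => s0; have pz : chart_p u i = 0 by rewrite -[chart_p u i](mulmxK uD) E s0 scale0r mul0mx.
    have : chart_p u i 0 (unit_index i) = 0 by rewrite pz mxE.
    elim/ord3_ind: i {E pz} => /=.
    - by rewrite p01 => /eqP; rewrite oner_eq0.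
    - by rewrite p10 => /eqP; rewrite oner_eq0.
    - by rewrite p20 => /eqP; rewrite oner_eq0.
  exists (\det (chart_D u) / s); first by rewrite mulf_neq0 ?invr_eq0.
  rewrite ffunE /=; apply: (can_inj (mulmxK uD)).
  by rewrite -mulmxA mul_adj_mx mul_mx_scalar -scalemxAl E scalerA divfK.
have lE k x : dot (chart_l u k) x = x 0 (hidx n k) by rewrite chart_l0 // dotC dot_delta.
have [|||| E0 E1 E2] := @frame_apex K n (chart_l u 0) (chart_l u 1) (chart_l u 2)
  (chart_p u 0) (chart_p u 1) (chart_p u 2) 1%:M; rewrite ?lE ?hidxE //.
rewrite !lE hidxE !mulmx1 in E0 E1 E2.
by elim/ord3_ind: i; eexists; [exact: E0|exact: E1|exact: E2].
Qed.
End LowerBound.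

(** * A chain of maximal length *)

Section Separation.
Variable K : numClosedFieldType.
Variables (n d : nat).
Hypothesis d3 : (3 <= d)%N.
Let d1 : (1 < d)%N. Proof. exact: leq_trans d3. Qed.
Local Notation vec := 'rV[K]_n.+4.
Local Notation form := (dhomog n.+4 K d).
Local Notation E := {ffun 'I_3 -> equations K n.+3 d}.
Local Notation a := #|free_index n d3|.
Local Notation b := (n.+2 + (n.+1 + n.+1))%N.
Local Notation c := (3 * n.+3)%N.
Local Notation par := 'rV[K]_(chart_dim n d3).
Local Notation chart := (@chart K n d d3).
Local Notation dom := (@chart_dom K n d d3).
Local Notation cl := (config_closed K n.+3 d).

Definition zero_after (j : 'I_(chart_dim n d3)) (u : par) :=
  forall j' : 'I_(chart_dim n d3), (j < j')%N -> u 0 j' = 0.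

Definition separated j := exists2 C, cl C & forall u : par, dom u -> zero_after j u ->
  (C (config_of (chart u)) <-> u 0 j = 0).

(** A saturated function that vanishes together with the parameter [j], as soon as
    the later parameters vanish, separates two consecutive members of the chain. *)
Lemma separate_by (h : E -> K) (j : 'I_(chart_dim n d3)) : pfun h -> saturated h ->
  (forall u : par, dom u -> zero_after j u ->
     (h (chart u) == 0) = (u 0 j == 0)) ->
  separated j.
Proof.
move=> ph sh hu; have [C cC hC] := closed_zeros ph sh; exists C => // u du uj.
split=> [/(hC _ (chart_good du)) h0|u0].
  by apply/eqP; rewrite -hu // h0.
by apply/(hC _ (chart_good du))/eqP; rewrite hu // u0.
Qed.

Lemma separate_l (i : 'I_3) (k : 'I_n.+3) (j : 'I_(chart_dim n d3)) :
  (forall u : par, par_l u i k = u 0 j) ->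
  separated j.
Proof.
move=> uj; apply: (separate_by (h := fun e : E => (e i).1.1 0 (lift (hidx n i) k))).
- exact: pfun_eq_l.
- exact: saturated_l.
move=> u du _; have [s s0 ->] := chart_lE du i.
by rewrite !mxE liftK mulf_eq0 (negbTE s0) uj.
Qed.

Lemma separate_p (i : 'I_3) (jj : 'I_n.+4) (j : 'I_(chart_dim n d3)) :
  (forall u : par, chart_p u i 0 jj = apex K n i 0 jj + u 0 j) ->
  (forall u : par, zero_after j u -> par_l u = 0) ->
  separated j.
Proof.
move=> uj l0; apply: (separate_by (h := fun e : E => (e i).1.2 0 jj - apex K n i 0 jj * (e i).1.2 0 (unit_index n i))).
- apply: pfunB; first exact: pfun_eq_p.
  by apply: pfunM; [exact: pfunC|exact: pfun_eq_p].
- apply: (saturated_p (lam := fun x => x 0 jj - apex K n i 0 jj * x 0 (unit_index n i))) => s x.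
  by rewrite !mxE; ring.
move=> u du /l0 ul; have [s s0 ->] := chart_pE du ul i.
have m1 : chart_p u i 0 (unit_index n i) = 1.
  have [[_ p01] [p10 _ _] [p20 _ _]] := chart_p_head u.
  by elim/ord3_ind: i {uj s0}.
have sE k : (s *: chart_p u i) 0 k = s * chart_p u i 0 k by rewrite mxE.
rewrite !sE m1 uj mulr1 (_ : _ - _ = s * u 0 j); last by ring.
by rewrite mulf_eq0 (negbTE s0).
Qed.

Lemma special_pivot : (special K n d3)@_(monomial (pivot n d3)) = 1.
Proof.
have mE : monomial (pivot n d3) = (U_(o2 n) *+ d)%MM by [].
have dgt0 : (0 < d)%N by apply: leq_trans d3.
rewrite /= /special_mpoly !mcoeffD mE !mpolyXn -mpolyXD !mcoeffX eqxx raddf_sum /= big1.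
  rewrite addr0; case: eqP => [/mnmP/(_ (o3 n))|_]; last by rewrite add0r.
  rewrite mnmDE !mulmnE !mnm1E /= mul0n add0n mul1n => /eqP.
  by rewrite -subn1 subn_eq0 leqNgt d1.
move=> j hj; rewrite mpolyXn mcoeffX; case: eqP => // /mnmP/(_ (o2 n)).
rewrite !mulmnE !mnm1E -val_eqE /= !(tail_index hj) mul0n mul1n => /esym/eqP.
by rewrite gtn_eqF.
Qed.

Lemma reduce_base (g : form) : cylindrical g ->
  reduce (delta_mx 0 (o1 n) : vec) (o1 n) (fsubst (1%:M *m lin1_mx (@proj K n 1)) g) = g.
Proof.
move=> [g1 _]; apply: form_ext => x; rewrite reduce_eval fsubst_eval mul1mx mulmx_proj.
apply: g1 => j hj; have pj (y : vec) : proj 1 y 0 j = y 0 j.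
  rewrite mxE ltnNge hj /=.
  case: ifP => [/eqP e|_]; first by congr (y 0 _); apply: val_inj.
  by case: ifP => [/eqP e|//]; congr (y 0 _); apply: val_inj.
have jo1 : (j == o1 n) = false by rewrite -val_eqE /= gtn_eqF.
rewrite pj !mxE !eqxx jo1 andbF mulr0 subr0 mul1r.
by [].
Qed.

(** When all the parameters of hyperplanes and vertices vanish, the matrix is the
    identity and the form of the second cone, reduced to [y_1 = 0], is [g] itself.
    Its coefficients are defined up to a common factor; hence the combination
    [lam], which uses that the coefficient at [pivot] is 1. *)
Lemma separate_g (k : 'I_a) (j : 'I_(chart_dim n d3)) :
  (forall u : par, par_g u 0 k = u 0 j) ->
  (forall u : par, zero_after j u ->
     par_l u = 0 /\ par_p u = 0) ->
  separated j.
Proof.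
move=> uj lp0; pose sp := special K n d3.
pose m0 := monomial (pivot n d3); pose mk := monomial (free_monomial k).
(* The value of [lam] at [special + chart_h u] is the coefficient of [chart_h u]
   at [mk]. *)
pose lam (F : form) : K^o := form_coef mk F - sp@_mk * form_coef m0 F.
have lamL : linear lam.
  have scE (x : K) (y : K^o) : x *: y = x * y by [].
  by move=> x F G; rewrite scE /lam /form_coef /= !mcoeffD !mcoeffZ; ring.
pose iL := GRing.isLinear.Build K form K^o _ lam lamL.
pose Lam : {linear form -> K^o} := HB.pack lam iL.
have sp0 : sp@_m0 = 1 by exact: special_pivot.
have hm0 (u : par) : (chart_h u)@_m0 = 0.
  rewrite combination_coef big1 // => i _; case: eqP => [E|_]; last by rewrite mulr0.
  by have := valP (enum_val i); rewrite -(inj_eq (@monomial_inj n d)) E eqxx.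
have hmk (u : par) : (chart_h u)@_mk = par_g u 0 k.
  rewrite combination_coef (bigD1 k) //= eqxx mulr1 big1 ?addr0 // => i ik.
  case: eqP => [/monomial_inj/val_inj/enum_val_inj E|_]; last by rewrite mulr0.
  by rewrite E eqxx in ik.
apply: (separate_by (h := fun e : E => Lam (reduce (e 1).1.1 (o1 n) (e 1).2))).
- exact: pfun_reduce_functional.
- exact: saturated_reduce.
move=> u du /lp0[l0 p0].
have -> : reduce (chart u 1).1.1 (o1 n) (chart u 1).2 = special K n d3 + chart_h u.
  rewrite /chart chart_D0 // ffunE /= (_ : (col _ _)^T = delta_mx 0 (o1 n)).
    exact/reduce_base/chart_cylindrical.
  by apply/rowP => i; rewrite !mxE hidxE eqxx.
suff -> : Lam (special K n d3 + chart_h u) = u 0 j by [].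
have LE F : Lam F = F@_mk - sp@_mk * F@_m0 by [].
have cD m (F G : form) : (F + G : form)@_m = F@_m + G@_m by rewrite /= mcoeffD.
by rewrite LE !cD hm0 hmk uj sp0 addr0 mulr1 addrAC subrr add0r.
Qed.

Lemma chart_chain : exists Z, irreducible_chain cl (Vint K n.+3 d) (chart_dim n d3) Z.
Proof.
apply: (dimension_lower_bound (phi := fun u => config_of (chart u)) (U := dom)).
- exact: config_closed_cap.
- exact: chart_dom_dense.
- exact: chart_pclosed.
- by move=> _ [u du <-]; apply: chart_Vint.
move=> j.
have lE (u : par) i k : par_l u i k = u 0 (rshift a (rshift b (mxvec_index i k))) by rewrite !mxE.
have pE (u : par) k : par_p u 0 k = u 0 (rshift a (lshift c k)) by rewrite !mxE.
have l0 (u : par) : (forall j' : 'I_(chart_dim n d3), (a + b <= j')%N -> u 0 j' = 0) -> par_l u = 0.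
  move=> h; apply/matrixP => i k; rewrite lE [RHS]mxE; apply: h.
  by rewrite /= leq_add2l leq_addr.
case: (split_ordP (j : 'I_(a + (b + c)))) => k jE.
  apply: (@separate_g k); rewrite jE => u; first by rewrite mxE.
  move=> h; split.
    by apply: l0 => j' hj'; apply: h; rewrite /=; apply: leq_trans (leq_trans (leq_addr _ _) hj').
  apply/rowP => i; rewrite pE mxE h //=; apply: leq_trans (leq_addr _ _); exact: ltn_ord.
case: (split_ordP k) => k' kE; last first.
  case: (mxvec_indexP k') kE => i k'' kE.
  by apply: (@separate_l i k''); rewrite jE kE.
have l0' (u : par) : zero_after j u -> par_l u = 0.
  move=> h; apply: l0 => j' hj'; apply: h; rewrite jE kE /=.
  by apply: leq_trans hj'; rewrite ltn_add2l.
case: (split_ordP k') => k1 k1E.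
  apply: (separate_p (i := 0) (jj := rshift 2 k1)) l0' => u.
  by rewrite /chart_p /= [LHS]mxE shift2_high [lsubmx _ 0 k1]mxE pE jE kE k1E.
case: (split_ordP k1) => k2 k2E.
  apply: (separate_p (i := 1) (jj := rshift 3 k2)) l0' => u.
  by rewrite /chart_p /= [LHS]mxE shift3_high [lsubmx _ 0 k2]mxE [rsubmx _ 0 _]mxE pE jE kE k1E k2E.
apply: (separate_p (i := 2) (jj := rshift 3 k2)) l0' => u.
by rewrite /chart_p /= [LHS]mxE shift3_high [rsubmx _ 0 k2]mxE [rsubmx _ 0 _]mxE pE jE kE k1E k2E.
Qed.
End Separation.

(** * Almost every configuration lies in the chart *)

Section Generic.
Variable K : numClosedFieldType.
Variables (n d : nat).
Hypothesis d3 : (3 <= d)%N.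
Let d1 : (1 < d)%N. Proof. exact: leq_trans d3. Qed.
Local Notation vec := 'rV[K]_n.+4.
Local Notation form := (dhomog n.+4 K d).
Local Notation E := {ffun 'I_3 -> equations K n.+3 d}.
Local Notation par := 'rV[K]_(chart_dim n d3).
Local Notation chart := (@chart K n d d3).
Local Notation dom := (@chart_dom K n d d3).

(** The cross product of the first three coordinates. *)
Definition cross (l l' : vec) : vec := \row_j
  if (j == 0 :> nat) then l 0 (o1 n) * l' 0 (o2 n) - l 0 (o2 n) * l' 0 (o1 n)
  else if (j == 1 :> nat) then l 0 (o2 n) * l' 0 (o0 n) - l 0 (o0 n) * l' 0 (o2 n)
  else if (j == 2 :> nat) then l 0 (o0 n) * l' 0 (o1 n) - l 0 (o1 n) * l' 0 (o0 n)
  else 0.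

Lemma dot_head (l x : vec) : (forall j : 'I_n.+4, (2 < j)%N -> x 0 j = 0) ->
  dot l x = x 0 (o0 n) * l 0 (o0 n) + x 0 (o1 n) * l 0 (o1 n) + x 0 (o2 n) * l 0 (o2 n).
Proof.
move=> x0; rewrite dotE 3!big_ord_recl big1 ?addr0 => [|j _]; last by rewrite x0 ?mul0r.
have -> : lift ord0 ord0 = o1 n by apply: val_inj.
have -> : lift ord0 (lift ord0 ord0) = o2 n by apply: val_inj.
by rewrite (_ : ord0 = o0 n) ?addrA //; apply: val_inj.
Qed.

Lemma cross_tail l l' (j : 'I_n.+4) : (2 < j)%N -> cross l l' 0 j = 0.
Proof. by rewrite mxE; case: (j : nat) => [|[|[|]]]. Qed.

Lemma dot_cross (k l l' : vec) : dot k (cross l l') =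
  (l 0 (o1 n) * l' 0 (o2 n) - l 0 (o2 n) * l' 0 (o1 n)) * k 0 (o0 n) +
  (l 0 (o2 n) * l' 0 (o0 n) - l 0 (o0 n) * l' 0 (o2 n)) * k 0 (o1 n) +
  (l 0 (o0 n) * l' 0 (o1 n) - l 0 (o1 n) * l' 0 (o0 n)) * k 0 (o2 n).
Proof. by rewrite dot_head => [|j]; [rewrite !mxE|exact: cross_tail]. Qed.

Lemma crossZ c c' (l l' : vec) : cross (c *: l) (c' *: l') = (c * c') *: cross l l'.
Proof. by apply/rowP => j; rewrite !mxE; do ![case: ifP => _]; ring. Qed.

(** The factors say, in this order, that each [l_i] can be normalised, that the
    [l_i] are independent on the span of [e_0, e_1, e_2], that the frame completed
    by the coordinates of index at least 3 is defined, and that [g] has a nonzero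
    coefficient at [pivot]: in the frame the cross product of the first two linear
    forms is a multiple of [e_2]. *)
Definition generic_fun (e : E) : K :=
  (\prod_i (e i).1.1 0 (hidx n i)) * (dot (e 2).1.1 (cross (e 0).1.1 (e 1).1.1) *
  ((dot (e 0).1.1 (e 2).1.2 * (e 1).1.2 0 (o3 n) - dot (e 0).1.1 (e 1).1.2 * (e 2).1.2 0 (o3 n)) *
  (e 1).2.@[(cross (e 0).1.1 (e 1).1.1) 0])).

Lemma pfun_cross (V : vectType K) (l l' : V -> vec) : (forall j, pfun (fun v => l v 0 j)) ->
  (forall j, pfun (fun v => l' v 0 j)) -> forall j, pfun (fun v => cross (l v) (l' v) 0 j).
Proof.
move=> hl hl' j; have pif (x : bool) (f1 f2 : V -> K) : pfun f1 -> pfun f2 ->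
    pfun (fun u => if x then f1 u else f2 u) by case: x.
under eq_fun do rewrite mxE.
by do 3![apply: (pif); first by apply: pfunB; apply: pfunM]; apply: pfunC.
Qed.

Lemma pfun_generic_fun : pfun generic_fun.
Proof.
have hc : forall j, pfun (fun e : E => cross (e 0).1.1 (e 1).1.1 0 j).
  by apply: pfun_cross => j; exact: pfun_eq_l.
apply: pfunM; first by apply: pfun_prod => i _; exact: pfun_eq_l.
apply: pfunM; first by apply: pfun_dot => // j; exact: pfun_eq_l.
apply: pfunM; last by apply: pfun_eval => // y; exact: pfun_eq_F.
by apply: pfunB; apply: pfunM; try exact: pfun_eq_p;
  apply: pfun_dot => j; [exact: pfun_eq_l|exact: pfun_eq_p|exact: pfun_eq_l|exact: pfun_eq_p].
Qed.

(** Every factor is homogeneous in each equation; the last one is evaluated at a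
    point of the hyperplane, where [F] is determined up to a scalar. *)
Lemma saturated_generic_fun : saturated generic_fun.
Proof.
apply: saturatedM.
  move=> e e' ge ge' ee' /eqP/prodf_eq0[i _ /eqP h]; apply/eqP/prodf_eq0; exists i => //.
  by apply/eqP; apply: (saturated_l ge ge' ee').
apply: saturatedM.
  move=> e e' ge ge' ee' h; have s := same_config ge ge' ee'.
  have [[c0 _ ->] _ _] := s 0; have [[c1 _ ->] _ _] := s 1; have [[c2 _ ->] _ _] := s 2.
  by rewrite crossZ dotZr dotZl h !mulr0.
apply: saturatedM.
  move=> e e' ge ge' ee' h; have s := same_config ge ge' ee'.
  have [[c0 _ ->] _ _] := s 0; have [_ [p1 _ ->] _] := s 1; have [_ [p2 _ ->] _] := s 2.
  rewrite !dotZl !dotZr ![fun_of_matrix (_ *: _) 0 (o3 n)]mxE -[RHS](mulr0 (c0 * p1 * p2)) -h; ring.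
move=> e e' ge ge' ee' h; have s := same_config ge ge' ee'.
have [[c0 _ l0] _ _] := s 0; have [[c1 _ l1] _ [f f0 FF]] := s 1.
rewrite l0 l1 crossZ form_scale; apply/eqP; rewrite mulf_eq0; apply/orP; right.
apply/eqP/(mulfI f0); rewrite mulr0 -FF ?h // mem_hyperplane dot_cross; apply/eqP; ring.
Qed.

Definition rescale (c : 'I_3 -> K) (e : E) : E :=
  [ffun i => (c i *: (e i).1.1, (e i).1.2, (e i).2)].

Lemma hyperplaneZ c (l : vec) : c != 0 -> hyperplane (c *: l) = hyperplane l.
Proof.
by move=> c0; apply/vspaceP => x; rewrite !mem_hyperplane dotZl mulf_eq0 (negbTE c0).
Qed.

Lemma rescale_vint c e H : (forall i, c i != 0) -> vint_equations e H ->
  vint_equations (rescale c e) H /\ config_of e = config_of (rescale c e).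
Proof.
move=> c0 [ge HF [p1 p1'] p23 p3 p2]; split; last first.
  apply: funext => i; rewrite /config_of ffunE [e i]surjective_pairing [(e i).1]surjective_pairing /=.
  by rewrite hyperplaneZ.
split; rewrite ?ffunE /= ?dotZl ?mulf_neq0 // ?p3 ?p2 ?mulr0 //.
- move=> i; rewrite ffunE /eqs_good /=; have [l0 p0 pl nF inv sm] := ge i.
  by split; rewrite ?hyperplaneZ // scaler_eq0 negb_or c0.
- by move=> i; rewrite ffunE /= hyperplaneZ.
Qed.

(** The frame does not see the first three coordinates of the vertices. *)
Lemma frame_ext l1 l2 l3 b (B B' G G' c c' : vec) (L : 'M[K]_n.+4) :
  (forall j : 'I_n.+4, (2 < j)%N -> B 0 j = B' 0 j) ->
  (forall j : 'I_n.+4, (2 < j)%N -> G 0 j = G' 0 j) ->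
  (forall j : 'I_n.+4, (2 < j)%N -> c 0 j = c' 0 j) ->
  frame l1 l2 l3 b B G c L = frame l1 l2 l3 b B' G' c' L.
Proof.
move=> hB hG hc; apply/matrixP => i j; rewrite ![frame _ _ _ _ _ _ _ _ _ _]mxE !mxE /frame_coord.
case: ifP => j0; first by rewrite hc.
case: ifP => j1 //; case: ifP => j2 //.
have j3 : (2 < j)%N by move: j0 j1 j2; case: (j : nat) => [|[|[|]]].
case: ifP => _; first by rewrite hB // hG.
by rewrite !hB ?hG ?hc.
Qed.

Lemma pivot_coef (g : form) : cylindrical g ->
  g.@[(delta_mx 0 (o2 n) : vec) 0] = g@_(monomial (pivot n d3)).
Proof.
move=> cg; rewrite [in LHS](cylindrical_combination cg) combination_eval (bigD1 (pivot n d3)) //=.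
have dE i : (delta_mx 0 (o2 n) : vec) 0 i = (i == o2 n)%:R by rewrite mxE eqxx.
have pE i : monomial (pivot n d3) i = ((o2 n == i) * d)%N by rewrite mulmnE mnm1E.
have -> : \prod_i (delta_mx 0 (o2 n) : vec) 0 i ^+ monomial (pivot n d3) i = 1.
  apply: big1 => i _; rewrite dE pE eq_sym; case: eqP => _; first by rewrite expr1n.
  by rewrite mul0n expr0.
rewrite mulr1 big1 ?addr0 // => m mp.
have [i io mi] : exists2 i, i != o2 n & monomial m i != 0%N.
  apply: contrapT => none; case/eqP: mp; apply: monomial_inj; apply/mnmP => i.
  have m0 i' : i' != o2 n -> monomial m i' = 0%N.
    by move=> io; apply: contrapT => /eqP mi; apply: none; exists i'.
  have [->|io] := eqVneq i (o2 n); last by rewrite m0 // pE eq_sym (negbTE io).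
  rewrite pE eqxx mul1n; have /and4P[/eqP md _ _ _] := valP m; rewrite -[RHS]md.
  by rewrite mdegE (bigD1 (o2 n)) //= big1 ?addn0 // => i' /m0.
by rewrite (bigD1 i) //= dE (negbTE io) expr0n (negbTE mi) mul0r mulr0.
Qed.

Lemma free_combination (g : form) : cylindrical g -> g@_(monomial (pivot n d3)) = 0 ->
  g = combination (@free_monomial n d d3) (fun k => g@_(monomial (free_monomial k))).
Proof.
move=> cg g0; apply/val_inj/mpolyP => mu; rewrite combination_coef.
have [[k kmu]|none] := pselect (exists k, monomial (@free_monomial n d d3 k) = mu).
  rewrite (bigD1 k) //= kmu eqxx mulr1 big1 ?addr0 // => i ik.
  case: eqP => [E|_]; last by rewrite mulr0.
  move: E; rewrite -kmu => /monomial_inj/val_inj/enum_val_inj E.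
  by rewrite E eqxx in ik.
rewrite big1 => [|k _]; last first.
  by case: eqP => [E|_]; [case: none; exists k|rewrite mulr0].
rewrite {1}(cylindrical_combination cg) combination_coef big1 // => m _.
case: eqP => [E|_]; last by rewrite mulr0.
have [->|mp] := eqVneq m (pivot n d3); first by rewrite g0 mul0r.
case: none; exists (enum_rank (Sub m mp : free_index n d3)).
by rewrite /free_monomial enum_rankK.
Qed.

Lemma model_scale D (g : form) (s : K) : D \in unitmx -> nonsingular g -> s != 0 ->
  nonsingular (s *: g : form) /\ config_of (model D g) = config_of (model D (s *: g)).
Proof.
move=> uD ns s0; have ns' : nonsingular (s *: g : form).
  move=> z bz z0; have [w bw h] := ns z bz z0; exists w => //.
  have -> : line (s *: g : form) z w = s *: line g z w by rewrite /line /= mmapZ mul_polyC.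
  by rewrite derivZ hornerZ mulf_neq0.
split=> //; apply: funext => i; rewrite /config_of.
have [l0 p0 _ _ _ _] := model_good uD ns' i; have := model_good uD ns i.
rewrite ffunE /= in l0 p0; rewrite !ffunE => ge; apply/triple_eqP => //; split.
- by exists 1; rewrite ?oner_neq0 ?scale1r.
- by exists 1; rewrite ?oner_neq0 ?scale1r.
exists s^-1; first by rewrite invr_eq0.
by move=> x _; rewrite !fsubst_eval fevalZ mulKf.
Qed.

Lemma cylindricalZ (g : form) (s : K) : cylindrical g -> cylindrical (s *: g : form).
Proof.
by case=> g1 g2; split=> y z => [/g1|y2 z2 /(g2 _ _ y2 z2)] h; rewrite !fevalZ h.
Qed.

Lemma cramer (l l' l'' x : vec) : dot l'' (cross l l') != 0 ->
  (forall j : 'I_n.+4, (2 < j)%N -> x 0 j = 0) ->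
  dot l x = 0 -> dot l' x = 0 -> dot l'' x = 0 -> x = 0.
Proof.
move=> det0 x0; rewrite !dot_head // => h h' h''.
have E (j : 'I_n.+4) : (j < 3)%N -> dot l'' (cross l l') * x 0 j = 0.
  move=> j3; rewrite -[RHS](_ : (dot l'' x) * cross l l' 0 j + (dot l x) * cross l' l'' 0 j +
    (dot l' x) * cross l'' l 0 j = 0); last by rewrite !dot_head // h h' h''; ring.
  rewrite dot_cross !dot_head // !mxE.
  case: j j3 => -[|[|[|//]]] hj _ /=.
  - have -> : Ordinal hj = o0 n by apply: val_inj.
    by ring.
  - have -> : Ordinal hj = o1 n by apply: val_inj.
    by ring.
  - have -> : Ordinal hj = o2 n by apply: val_inj.
    by ring.
apply/rowP => j; rewrite [RHS]mxE; have [j3|j3] := ltnP j 3; last exact: x0.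
by apply/(mulfI det0); rewrite mulr0 E.
Qed.

Section Normalised.
Variables (e : E) (H : form).
Hypothesis ve : vint_equations e H.
Hypothesis lii : forall i, (e i).1.1 0 (hidx n i) = 1.
Let q1 := (dot (e 1).1.1 (e 0).1.2)^-1 *: (e 0).1.2.
Let q2 := (dot (e 0).1.1 (e 1).1.2)^-1 *: (e 1).1.2.
Let q3 := (dot (e 0).1.1 (e 2).1.2)^-1 *: (e 2).1.2.
Let b := dot (e 2).1.1 q1.
Let D := frame (e 0).1.1 (e 1).1.1 (e 2).1.1 b q1 q2 (q2 - q3) 1%:M.

Lemma chart_hit (h : form) : cylindrical h -> h@_(monomial (pivot n d3)) = 0 ->
  exists u : par, chart_D u = D /\ chart_h u = h.
Proof.
move=> ch h0.
pose w1 : 'rV[K]_n.+2 := \row_k ((if k == 0 :> nat then b else q1 0 (rshift 2 k)) - apex K n 0 0 (rshift 2 k)).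
pose w2 : 'rV[K]_n.+1 := \row_k (q2 0 (rshift 3 k) - apex K n 1 0 (rshift 3 k)).
pose w3 : 'rV[K]_n.+1 := \row_k (q3 0 (rshift 3 k) - apex K n 2 0 (rshift 3 k)).
pose M : 'M[K]_(3, n.+3) := \matrix_(i, k) (e i).1.1 0 (lift (hidx n i) k).
pose u : par := row_mx (\row_k h@_(monomial (free_monomial k))) (row_mx (row_mx w1 (row_mx w2 w3)) (mxvec M)).
have ug : par_g u = \row_k h@_(monomial (free_monomial k)) by rewrite /par_g row_mxKl.
have up : par_p u = row_mx w1 (row_mx w2 w3) by rewrite /par_p row_mxKr row_mxKl.
have ul : par_l u = M by rewrite /par_l row_mxKr row_mxKr mxvecK.
have lE i : chart_l u i = (e i).1.1.
  by apply/rowP => j; rewrite mxE ul; case: unliftP => [k|] ->; rewrite ?mxE ?lii.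
have p0E (k : 'I_n.+2) : chart_p u 0 0 (rshift 2 k) = if k == 0 :> nat then b else q1 0 (rshift 2 k).
  by rewrite /chart_p /= [LHS]mxE up row_mxKl shift2_high [w1 0 k]mxE addrC subrK.
have p1E (k : 'I_n.+1) : chart_p u 1 0 (rshift 3 k) = q2 0 (rshift 3 k).
  by rewrite /chart_p /= [LHS]mxE up row_mxKr row_mxKl shift3_high [w2 0 k]mxE addrC subrK.
have p2E (k : 'I_n.+1) : chart_p u 2 0 (rshift 3 k) = q3 0 (rshift 3 k).
  by rewrite /chart_p /= [LHS]mxE up !row_mxKr shift3_high [w3 0 k]mxE addrC subrK.
have tail3 (P : 'I_n.+4 -> Prop) : (forall k : 'I_n.+1, P (rshift 3 k)) ->
    forall j : 'I_n.+4, (2 < j)%N -> P j.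
  move=> hP j; case: (split_ordP (j : 'I_(3 + n.+1))) => k -> //= hk.
  by have := ltn_ord k; rewrite ltnNge hk.
exists u; split; last first.
  rewrite /chart_h ug [RHS](free_combination ch h0); congr combination.
  by apply: funext => k; rewrite mxE.
rewrite /chart_D !lE (_ : chart_p u 0 0 (o2 n) = b); last first.
  by rewrite -[RHS](p0E 0); congr (chart_p u 0 0 _); apply: val_inj.
apply: frame_ext; apply: tail3 => k.
- have -> : rshift 3 k = rshift 2 (lift ord0 k) :> 'I_n.+4 by apply: val_inj.
  by rewrite p0E.
- exact: p1E.
- by rewrite mxE [in RHS]mxE [X in _ + X]mxE [X in _ = _ + X]mxE p1E p2E.
Qed.

Hypothesis det0 : dot (e 2).1.1 (cross (e 0).1.1 (e 1).1.1) != 0.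
Hypothesis o30 : dot (e 0).1.1 (e 2).1.2 * (e 1).1.2 0 (o3 n)
  - dot (e 0).1.1 (e 1).1.2 * (e 2).1.2 0 (o3 n) != 0.
Hypothesis F0 : (e 1).2.@[(cross (e 0).1.1 (e 1).1.1) 0] != 0.

Lemma chart_surj_normalised : exists2 u : par, dom u & config_of e = config_of (chart u).
Proof.
have l0p1 : dot (e 0).1.1 (e 1).1.2 != 0 by apply: (ve_dot_first d1 ve); have [] := ve_p1_off ve.
have l0p2 : dot (e 0).1.1 (e 2).1.2 != 0 by apply: (ve_dot_first d1 ve); have [] := ve_p1_off ve.
have [||] := @frame_model K n d d1 e H 1%:M ve.
- rewrite mulmx1 mxE [X in _ + X]mxE [in X in X + _]mxE [in X in _ + X]mxE.
  rewrite (_ : _ - _ = (dot (e 0).1.1 (e 2).1.2 * (e 1).1.2 0 (o3 n)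
    - dot (e 0).1.1 (e 1).1.2 * (e 2).1.2 0 (o3 n)) / (dot (e 0).1.1 (e 1).1.2 * dot (e 0).1.1 (e 2).1.2)).
    by rewrite mulf_neq0 ?invr_eq0 ?mulf_neq0.
  by field; apply/andP.
- move=> x h0 h1 h2; rewrite mulmx1 => hx.
  exact: (cramer det0 hx h0 h1 h2).
rewrite !mulmx1 -/q1 -/q2 -/q3 -/b -/D => uD [g [cg ng eE]].
pose w := cross (e 0).1.1 (e 1).1.1.
have w0 : dot (e 0).1.1 w = 0 by rewrite dot_cross; ring.
have w1 : dot (e 1).1.1 w = 0 by rewrite dot_cross; ring.
have wD : w *m D = dot (e 2).1.1 w *: delta_mx 0 (o2 n).
  rewrite mul_frame; apply/rowP => j.
  have fE (k : 'I_n.+4) : (2 < k)%N -> frame_coord (e 0).1.1 (e 1).1.1 q1 q2 1%:M k w = 0.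
    by move=> hk; rewrite /frame_coord w0 w1 mulmx1 cross_tail //; ring.
  rewrite mxE w0 w1 !mulr0 [RHS]mxE [delta_mx _ _ _ _]mxE eqxx -val_eqE /=.
  case: ifP => [/eqP ->|j0]; first by rewrite mulr0.
  case: ifP => [/eqP ->|j1]; first by rewrite mulr0.
  case: ifP => [_|j2]; first by rewrite mulr1.
  have j3 : (2 < j)%N by move: j0 j1 j2; case: (j : nat) => [|[|[|]]].
  by rewrite !fE // !mulr0 subrr if_same.
have gmodel : good (model D g) by move=> i; apply: model_good.
have g0 : g@_(monomial (pivot n d3)) != 0.
  have [_ _ [f f0 FF]] := same_config (ve_good ve) gmodel eE 1.
  rewrite -pivot_coef //; apply: contraNneq F0 => gz; rewrite FF ?mem_hyperplane ?w1 //.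
  rewrite ffunE /= fsubst_eval mulmxA mulmx_proj wD projZ.
  rewrite (_ : proj 1 _ = delta_mx 0 (o2 n)); first by rewrite form_scale gz !mulr0.
  apply: vec_eq; rewrite ?mxE //= => j hj.
  by rewrite !mxE !(tail_index hj).
pose g' : form := (g@_(monomial (pivot n d3)))^-1 *: g.
have gi0 : (g@_(monomial (pivot n d3)))^-1 != 0 by rewrite invr_eq0.
have [ng' gE] := model_scale uD ng gi0.
have ch : cylindrical (g' - special K n d3 : form).
  apply: cylindrical_add; first exact: cylindricalZ.
  by apply: cylindrical_opp; apply: special_cylindrical.
have [|u [uDE uh]] := chart_hit ch.
  rewrite /= mcoeffB special_pivot mcoeffZ mulVf ?subrr //.
exists u.
  by split; rewrite ?uDE // uh addrC subrK.
by rewrite eE gE /chart uDE uh [special _ _ _ + _]addrC subrK.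
Qed.
End Normalised.

(** First normalise the [l_i], then [g]; the frame of the normalised equations is
    that of a point of the chart. *)
Lemma chart_surj e H : vint_equations e H -> generic_fun e != 0 ->
  exists2 u : par, dom u & config_of e = config_of (chart u).
Proof.
move=> ve0; rewrite /generic_fun !mulf_eq0 !negb_or => /and4P[lii0 det0 o30 F0].
have lne i : (e i).1.1 0 (hidx n i) != 0 by move/prodf_neq0: lii0; apply.
pose cc i := ((e i).1.1 0 (hidx n i))^-1.
have cc0 i : cc i != 0 by rewrite invr_eq0.
have [ve ->] := rescale_vint cc0 ve0.
have lE i : (rescale cc e i).1.1 = cc i *: (e i).1.1 by rewrite ffunE.
have pE i : (rescale cc e i).1.2 = (e i).1.2 by rewrite ffunE.
have FE i : (rescale cc e i).2 = (e i).2 by rewrite ffunE.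
apply: (chart_surj_normalised ve).
- by move=> i; rewrite lE mxE mulVf.
- by rewrite !lE crossZ dotZr dotZl !mulf_neq0.
- by rewrite !pE lE !dotZl -!mulrA -mulrBr mulf_neq0.
- by rewrite FE !lE crossZ form_scale mulf_neq0 ?expf_neq0 ?mulf_neq0.
Qed.
End Generic.

(** * Normalised equations *)

Section Normalisation.
Variable K : numClosedFieldType.
Variables (n d : nat).
Local Notation vec := 'rV[K]_n.+1.
Local Notation form := (dhomog n.+1 K d).
Local Notation E := {ffun 'I_3 -> equations K n d}.

Lemma saturated_prod (h : 'I_3 -> E -> K) : (forall i, saturated (h i)) ->
  saturated (fun e => \prod_i h i e).
Proof.
move=> sh e e' ge ge' ee' /eqP/prodf_eq0[i _ /eqP hi]; apply/eqP/prodf_eq0; exists i => //.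
by rewrite (sh i e e').
Qed.

Lemma reduce_on (l : vec) k (F : form) x : x \in hyperplane l ->
  (reduce l k F).@[x 0] = l 0 k ^+ d * F.@[x 0].
Proof.
by rewrite mem_hyperplane => /eqP lx; rewrite reduce_eval lx scale0r subr0 form_scale.
Qed.

Variables (a b : 'I_3 -> 'I_n.+1) (x : 'I_3 -> vec).

Definition reduced_form (e : E) i : form := reduce (e i).1.1 (a i) (e i).2.

(** The equations are divided by values that are not zero at a given configuration.
    They become functions of the configuration ([normal_same]). *)
Definition normal_eqs (e : E) : E := [ffun i =>
  (((e i).1.1 0 (a i))^-1 *: (e i).1.1, ((e i).1.2 0 (b i))^-1 *: (e i).1.2,
   ((reduced_form e i).@[(x i) 0])^-1 *: reduced_form e i)].

Definition normal_den (e : E) : K :=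
  \prod_i ((e i).1.1 0 (a i) * ((e i).1.2 0 (b i) * (reduced_form e i).@[(x i) 0])).

Lemma normal_den_neq0 e i : normal_den e != 0 ->
  [/\ (e i).1.1 0 (a i) != 0, (e i).1.2 0 (b i) != 0 & (reduced_form e i).@[(x i) 0] != 0].
Proof. by move/prodf_neq0/(_ i isT); rewrite !mulf_eq0 !negb_or => /and3P[]. Qed.

Lemma normal_config e : good e -> normal_den e != 0 -> good (normal_eqs e) /\ config_of e = config_of (normal_eqs e).
Proof.
move=> ge de; have E : config_of e = config_of (normal_eqs e).
  apply: funext => i; have [la pb rx] := normal_den_neq0 i de.
  have gi := ge i; have [l0 p0 _ _ _ _] := gi.
  rewrite /config_of ffunE; rewrite [in LHS](surjective_pairing (e i)) [in LHS](surjective_pairing (e i).1).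
  apply/triple_eqP => //; rewrite ?scaler_eq0 ?negb_or ?invr_eq0 ?la ?pb //; split.
  - by exists ((e i).1.1 0 (a i))^-1; rewrite ?invr_eq0.
  - by exists ((e i).1.2 0 (b i))^-1; rewrite ?invr_eq0.
  exists ((reduced_form e i).@[(x i) 0] / (e i).1.1 0 (a i) ^+ d).
    by rewrite mulf_neq0 ?invr_eq0 ?expf_neq0.
  move=> y yW; rewrite fevalZ (reduce_on _ _ yW); move: (_ ^+ d) (expf_neq0 d la) => c c0.
  by field; rewrite rx c0.
split=> //; apply/good_configP; rewrite -E; exact/good_configP.
Qed.

Lemma normal_same e e' : good e -> good e' -> config_of e = config_of e' ->
  normal_den e != 0 -> normal_eqs e' = normal_eqs e.
Proof.
move=> ge ge' ee' de; apply/ffunP => i; have [la pb rx] := normal_den_neq0 i de.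
have [[c c0 lE] [k k0 pE] [f f0 FF]] := same_config ge ge' ee' i.
rewrite !ffunE /reduced_form lE pE (reduce_scale _ c f0 FF) fevalZ !scalerA.
have cf : c ^+ d / f != 0 by rewrite mulf_neq0 ?expf_neq0 ?invr_eq0.
have sc (s t : K) : s != 0 -> (s * t)^-1 * s = t^-1.
  by move=> s0; rewrite invfM mulrAC mulVf ?mul1r.
by rewrite ![fun_of_matrix (_ *: _) _ _]mxE !sc.
Qed.

Lemma pfun_normal_den : pfun normal_den.
Proof.
apply: pfun_prod => i _; apply: pfunM; first exact: pfun_eq_l.
by apply: pfunM; [exact: pfun_eq_p|exact: pfun_reduce].
Qed.

Lemma saturated_normal_den : saturated normal_den.
Proof.
apply: saturated_prod => i; apply: saturatedM; first exact: saturated_l.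
have sF := @saturated_reduce K n d i (a i) (@form_at K n.+1 d (x i)).
apply: saturatedM; last exact: sF.
by apply: (saturated_p (lam := fun y => y 0 (b i))) => c y; rewrite mxE.
Qed.

(** The product [normal_den] is a common denominator for all the coordinates of
    [normal_eqs]. *)
Lemma rfun_normal_eqs (h : E -> K) : pfun h -> rfun normal_den (fun e => h (normal_eqs e)).
Proof.
have rest i : pfun (fun e : E => \prod_(j | j != i) ((e j).1.1 0 (a j) * ((e j).1.2 0 (b j) * (reduced_form e j).@[(x j) 0]))).
  apply: pfun_prod => j _; apply: pfunM; first exact: pfun_eq_l.
  by apply: pfunM; [exact: pfun_eq_p|exact: pfun_reduce].
have split_den e i : normal_den e = (e i).1.1 0 (a i) * ((e i).1.2 0 (b i) * (reduced_form e i).@[(x i) 0]) *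
   \prod_(j | j != i) ((e j).1.1 0 (a j) * ((e j).1.2 0 (b j) * (reduced_form e j).@[(x j) 0])).
  by rewrite /normal_den (bigD1 i).
case=> q hq; apply: (@rfun_eq _ _ _ (fun e : E => q.@[fun i => coord (vbasis {:E}) i (normal_eqs e)])).
  by move=> v _; rewrite hq.
apply: rfun_meval; first exact: pfun_normal_den.
move=> j; apply: (equations_coordinates (P := rfun normal_den) _ _ _ _ _ _ (coord (vbasis {:E}) j)).
- by move=> c; exact/pfun_rfun/pfunC.
- by move=> f1 f2; apply: rfunD; exact: pfun_normal_den.
- by move=> f1 f2; apply: rfunM.
- move=> i k; apply: (rfun_div (g := fun e : E => (e i).1.1 0 (a i)) (k := fun e : E => (e i).1.1 0 k) (pfun_eq_l K d i (a i)) (pfun_eq_l K d i k)).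
    by move=> e de; have [la _ _] := normal_den_neq0 i de; rewrite ffunE mxE mulrAC mulVf ?mul1r.
  eexists; split; last by move=> e; rewrite (split_den e i) -mulrA; reflexivity.
  apply: pfunM => //; apply: pfunM; [exact: pfun_eq_p|exact: pfun_reduce].
- move=> i k; apply: (rfun_div (g := fun e : E => (e i).1.2 0 (b i)) (k := fun e : E => (e i).1.2 0 k) (pfun_eq_p K d i (b i)) (pfun_eq_p K d i k)).
    by move=> e de; have [_ pb _] := normal_den_neq0 i de; rewrite ffunE mxE mulrAC mulVf ?mul1r.
  eexists; split; last by move=> e; rewrite (split_den e i) mulrCA -mulrA; reflexivity.
  apply: pfunM => //; apply: pfunM; [exact: pfun_eq_l|exact: pfun_reduce].
move=> i y; apply: (rfun_div (g := fun e : E => (reduced_form e i).@[(x i) 0]) (k := fun e : E => (reduced_form e i).@[y 0]) (pfun_reduce d i (a i) (x i)) (pfun_reduce d i (a i) y)).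
  by move=> e de; have [_ _ rx] := normal_den_neq0 i de; rewrite ffunE fevalZ mulrAC mulVf ?mul1r.
eexists; split; last by move=> e; rewrite (split_den e i) mulrA mulrAC mulrC; reflexivity.
by apply: pfunM => //; apply: pfunM; [exact: pfun_eq_l|exact: pfun_eq_p].
Qed.
End Normalisation.

Lemma normal_exists (K : numClosedFieldType) n d (e : {ffun 'I_3 -> equations K n d}) : good e ->
  exists a b x, normal_den a b x e != 0.
Proof.
move=> ge; have pick i : exists t : 'I_n.+1 * 'I_n.+1 * 'rV[K]_n.+1,
   (e i).1.1 0 t.1.1 * ((e i).1.2 0 t.1.2 * (reduce (e i).1.1 t.1.1 (e i).2).@[t.2 0]) != 0.
  have [/rV0Pn[a la] /rV0Pn[b pb] _ [x xW Fx] _ _] := ge i.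
  by exists (a, b, x); rewrite /= reduce_on // !mulf_neq0 ?expf_neq0.
have [t ht] := choice pick.
exists (fun i => (t i).1.1), (fun i => (t i).1.2), (fun i => (t i).2).
by apply/prodf_neq0 => i _; exact: ht.
Qed.

(** * The upper bound on chains *)

Section UpperBound.
Variable K : numClosedFieldType.
Variables (n d : nat).
Hypothesis d3 : (3 <= d)%N.
Local Notation vec := 'rV[K]_n.+4.
Local Notation form := (dhomog n.+4 K d).
Local Notation E := {ffun 'I_3 -> equations K n.+3 d}.
Local Notation par := 'rV[K]_(chart_dim n d3).
Local Notation chart := (@chart K n d d3).
Local Notation dom := (@chart_dom K n d d3).
Local Notation cl := (config_closed K n.+3 d).
Local Notation Vint := (Vint K n.+3 d).

Lemma chart_pfun (h : E -> K) : pfun h -> pfun (fun u : par => h (chart u)).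
Proof.
apply: pfun_of_equations.
- by move=> i j; apply: pfun_model_l; exact: pfun_chart_D.
- by move=> i j; apply: pfun_model_p; exact: pfun_chart_D.
- by move=> i y; apply: pfun_model_F; [exact: pfun_chart_D|exact: pfun_chart_g].
Qed.

Lemma generic_fun_chart0 : generic_fun (chart 0) != 0.
Proof.
have D0 : chart_D (0 : par) = 1%:M by apply: chart_D0; rewrite /par_l /par_p !linear0.
have h0 : chart_h (0 : par) = 0.
  by rewrite /chart_h /combination big1 // => i _; rewrite /par_g linear0 mxE scale0r.
have lE i : (chart 0 i).1.1 = delta_mx 0 (hidx n i).
  by rewrite ffunE /= D0; apply/rowP => j; rewrite !mxE eqxx.
have pE i : (chart 0 i).1.2 = apex K n i.
  by rewrite ffunE /= D0 adj1 mulmx1.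
have FE : (chart 0 1).2 = fsubst (1%:M *m lin1_mx (@proj K n 1)) (special K n d3).
  by rewrite /chart D0 h0 addr0 ffunE.
have dE i x : dot (delta_mx 0 i) x = x 0 i :> K by rewrite dotC dot_delta.
have cE : cross (delta_mx 0 (o0 n)) (delta_mx 0 (o1 n)) = delta_mx 0 (o2 n) :> vec.
  apply: vec_eq => [||||j hj]; rewrite !mxE /= ?mulr0 ?mul0r ?mulr1 ?subr0 //.
  by rewrite !(tail_index hj) -val_eqE /= !(tail_index hj).
rewrite /generic_fun !lE !pE !hidxE cE !dE !mulf_neq0 //.
- by apply/prodf_neq0 => i _; rewrite lE mxE !eqxx oner_neq0.
- by rewrite mxE !eqxx oner_neq0.
- by rewrite !mxE /= (_ : _ - _ = 1) ?oner_neq0 //; ring.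
rewrite FE fsubst_eval mul1mx mulmx_proj.
rewrite (_ : proj 1 _ = delta_mx 0 (o2 n)).
  by rewrite (pivot_coef d3) ?special_pivot ?oner_neq0 //; exact: special_cylindrical.
by apply: vec_eq; rewrite ?mxE //= => j hj; rewrite !mxE !(tail_index hj).
Qed.

(** The locus lies in the union of [C] and of the zeros of [generic_fun], by
    [chart_surj]; it is irreducible, and [generic_fun] is not zero at the origin
    of the chart. *)
Lemma Vint_chart_dense (C : set ('I_3 -> triple K n.+3)) : cl C ->
  (forall u : par, dom u -> C (config_of (chart u))) -> Vint `<=` C.
Proof.
move=> cC hC; have [G cG hG] := closed_zeros (pfun_generic_fun K n d) (@saturated_generic_fun K n d).
have [_ irr] := @Vint_irreducible K n d d3.
have [] := irr C G cC cG; last 2 first.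
- by [].
- have d0 : dom 0.
    split; first by rewrite chart_D0 ?unitmx1 // /par_l /par_p !linear0.
    rewrite /chart_h /combination big1 => [|i _]; last by rewrite /par_g linear0 mxE scale0r.
    have [eps eps0 h] := nonsingular_near d3 (0 : form).
    by rewrite addr0 -[X in nonsingular X]addr0 -[X in _ + X](scaler0 _ 0); apply: h; rewrite normr0.
  move=> sub; have := sub _ (chart_Vint d0); move/(hG _ (chart_good d0))/eqP.
  by rewrite (negbTE generic_fun_chart0).
move=> L vL; have [e [H [LE ve]]] := Vint_equations vL.
have [g0|g0] := eqVneq (generic_fun e) 0.
  by right; rewrite LE; apply/(hG _ (ve_good ve)).
by left; have [u du uE] := chart_surj d3 ve g0; rewrite LE uE; apply: hC.
Qed.

(** The regular functions around a configuration are the polynomials in its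
    normalised equations, restricted to the locus where these are defined. *)
Lemma Vint_chain_length k Z : irreducible_chain cl Vint k Z -> (k <= chart_dim n d3)%N.
Proof.
move: k Z; apply: (@dimension_upper_bound K _ cl) => L0 [gL0 _ _ _ _].
have [e0 LE0 ge0] := good_surj gL0.
have [a [b [x de0]]] := normal_exists ge0.
pose den : E -> K := normal_den a b x; pose nu : E -> E := normal_eqs a b x.
have pd : pfun den := pfun_normal_den d a b x.
have sd : saturated den := @saturated_normal_den K n.+3 d a b x.
have [C0 cC0 hC0] := closed_zeros pd sd.
pose Rg : set (_ -> K) := [set f | exists2 q : E -> K, pfun q &
  forall e, good e -> den e != 0 -> f (config_of e) = q (nu e)].
have VE L : Vint L -> exists2 e : E, L = config_of e & good e.
  by case=> gL _ _ _ _; exact: good_surj.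
have zeros (q : E -> K) : pfun q -> exists2 C, cl C &
    forall e, good e -> (C (config_of e) <-> den e = 0 \/ q (nu e) = 0).
  move=> pq; have [k [h [ph hE]]] := rfun_normal_eqs a b x pq.
  have zE e : den e != 0 -> (h e == 0) = (q (nu e) == 0).
    by move=> de; rewrite -hE // mulf_eq0 expf_eq0 (negbTE de) andbF.
  have s : saturated (fun e => den e * h e).
    move=> e e' ge ge' ee' /eqP; rewrite mulf_eq0; have [d0 _|dn0 /=] := eqVneq (den e) 0.
      by rewrite (sd e e') // mul0r.
    rewrite zE // => /eqP q0; have [->|dn0'] := eqVneq (den e') 0; first by rewrite mul0r.
    apply/eqP; rewrite mulf_eq0 (negbTE dn0') zE //=.
    by rewrite /nu (normal_same ge ge' ee' dn0) -/(nu e) q0.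
  have [C cC hC] := closed_zeros (pfunM pd ph) s; exists C => // e ge; rewrite (hC e ge); split.
    move/eqP; rewrite mulf_eq0; have [->|dn0 /=] := eqVneq (den e) 0; first by left.
    by rewrite zE // => /eqP; right.
  have [-> _|dn0] := eqVneq (den e) 0; first by rewrite mul0r.
  by case=> [d0|q0]; [rewrite d0 mul0r|apply/eqP; rewrite mulf_eq0 zE // q0 eqxx orbT].
exists C0, Rg; split => //; first by rewrite LE0 => /(hC0 _ ge0)/eqP; rewrite (negbTE de0).
have offE e : good e -> ~ C0 (config_of e) -> den e != 0.
  by move=> ge nC; apply/eqP => /(hC0 _ ge).
split.
- by move=> c; exists (fun=> c) => //; exact: pfunC.
- move=> f g [p pp hp] [q pq hq]; exists (fun e => p e + q e); first exact: pfunD.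
  by move=> e ge de; rewrite hp // hq.
- move=> f g [p pp hp] [q pq hq]; exists (fun e => p e * q e); first exact: pfunM.
  by move=> e ge de; rewrite hp // hq.
- move=> f [q pq hq]; have [C cC hC] := zeros q pq; exists C => // _ /VE[e -> ge].
  rewrite (hC e ge) (hC0 e ge); have [->|dn0] := eqVneq (den e) 0; first by split=> _; left.
  by rewrite hq.
- move=> C _ cC /VE[e -> ge] /(offE e ge) de nC.
  have [A [I AE] hA] := cC.
  have cA e' : good e' -> (C (config_of e') <-> A e').
    by move=> ge'; apply: hA; exact/good_configP.
  have [gn nE] := normal_config ge de.
  have [q Iq q0] : exists2 q, I q & q.@[fun i => coord (vbasis {:E}) i (nu e)] != 0.
    apply: contrapT => none; apply: nC; rewrite nE; apply/(cA _ gn); rewrite AE => q Iq.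
    by apply: contrapT => /eqP q0; apply: none; exists q.
  have [rep repE] : exists rep : ('I_3 -> triple K n.+3) -> E,
      forall e' : E, good e' -> good (rep (config_of e')) /\ config_of e' = config_of (rep (config_of e')).
    have : forall L, exists r : E, (exists2 e' : E, L = config_of e' & good e') -> good r /\ L = config_of r.
      move=> L; have [[e' LE ge']|no] := pselect (exists2 e' : E, L = config_of e' & good e').
        by exists e'.
      by exists e.
    case/choice => rep repE; exists rep => e' ge'; exact: (repE _ (ex_intro2 _ _ e' erefl ge')).
  pose Q e' := q.@[fun i => coord (vbasis {:E}) i e'].
  have fE e' : good e' -> den e' != 0 -> Q (nu (rep (config_of e'))) = Q (nu e').
    by move=> ge' de'; have [gr rE] := repE e' ge'; rewrite /nu (normal_same ge' gr rE de').
  exists (fun L => Q (nu (rep L))).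
    by exists Q => //; exists q.
  split; first by rewrite fE.
  move=> _ /VE[e' -> ge'] /(offE e' ge') de' Ce'; rewrite fE //.
  have [gn' nE'] := normal_config ge' de'; move: Ce'; rewrite nE' => /(cA _ gn'); rewrite AE.
  by apply.
move=> k f mk Rf.
have /choice[q hq] : forall i, exists q : E -> K, pfun q /\ forall e, good e -> den e != 0 -> f i (config_of e) = q (nu e).
  by move=> i; have [q pq hq] := Rf i; exists q.
have [|||P P0 hP] := @rfun_dependence K par (fun u => den (chart u)) k (fun i u => q i (nu (chart u))).
- exact: chart_pfun.
- move=> i; have [e [h [ph hE]]] := rfun_normal_eqs a b x (hq i).1.
  by exists e, (fun u => h (chart u)); split; [exact: chart_pfun|move=> u; exact: hE].
- by rewrite dimvf /dim /= mul1n.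
exists P => //.
have [|C cC hC] := zeros (fun e => P.@[fun i => q i e]).
  by apply: pfun_meval => i; exact: (hq i).1.
have sub : Vint `<=` C.
  apply: Vint_chart_dense => // u du; apply/(hC _ (chart_good du)).
  by have [->|dn0] := eqVneq (den (chart u)) 0; [left|right; exact: hP].
move=> L vL; have [e LE ge] := VE L vL; rewrite LE => /(offE e ge) de.
have := sub L vL; rewrite LE => /(hC e ge)[d0|]; first by rewrite d0 eqxx in de.
move=> <-; apply: meval_eq => i; exact: (hq i).2.
Qed.
End UpperBound.

(** * Counting parameters *)

Section Count.
Variables (n d : nat).

Lemma mdeg_split (mu : 'X_{1..n.+4}) : mdeg mu =
  (mu (o0 n) + mu (o1 n) + mu (o2 n) + mu (o3 n) + \sum_(i < n) mu (rshift 4 i))%N.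
Proof.
rewrite mdegE 4!big_ord_recl !addnA; congr (mu _ + mu _ + mu _ + mu _ + _)%N; try exact: val_inj.
by apply: eq_bigr => i _; congr (mu _); apply: val_inj.
Qed.

Lemma index_split (P : 'I_n.+4 -> Prop) : P (o0 n) -> P (o1 n) -> P (o2 n) -> P (o3 n) ->
  (forall i : 'I_n, P (rshift 4 i)) -> forall i, P i.
Proof.
move=> p0 p1 p2 p3 pt i; case: (split_ordP (i : 'I_(4 + n))) => j ->; last exact: pt.
case: j => -[|[|[|[|//]]]] hj.
- have -> : lshift n (Ordinal hj) = o0 n :> 'I_n.+4 by apply: val_inj.
  by [].
- have -> : lshift n (Ordinal hj) = o1 n :> 'I_n.+4 by apply: val_inj.
  by [].
- have -> : lshift n (Ordinal hj) = o2 n :> 'I_n.+4 by apply: val_inj.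
  by [].
- have -> : lshift n (Ordinal hj) = o3 n :> 'I_n.+4 by apply: val_inj.
  by [].
Qed.

Definition tail_bound k := if k == 0%N then d else (d - k.+1)%N.

(** The exponent of [y_2] is determined by the others and the degree; it is at
    least 1 if [k] is not 0, which accounts for [tail_bound]. *)
Lemma card_admissible_fibre k : (k < d)%N ->
  #|[pred a : admissible_index n d | monomial a (o3 n) == k]| = 'C(n + tail_bound k, n).
Proof.
move=> kd; pose B := tail_bound k.
pose tl (a : admissible_index n d) : n.-tuple 'I_B.+1 := [tuple inord (monomial a (rshift 4 i)) | i < n].
have adm (a : admissible_index n d) : monomial a (o3 n) = k ->
    [/\ monomial a (o0 n) = 0%N, monomial a (o1 n) = 0%N,
     ((k != 0%N) + (B - \sum_(i < n) monomial a (rshift 4 i)) = monomial a (o2 n))%N &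
     (\sum_(i < n) monomial a (rshift 4 i) <= B)%N].
  move=> ak; have /and4P[/eqP md /eqP a0 /eqP a1 a23] := valP a.
  move: md a23; rewrite -/(monomial a) mdeg_split ak a0 a1 /B /tail_bound.
  by split => //; move: md a23; case: (k) => [|k'] /=; lia.
have tlE a i : monomial a (o3 n) = k -> tnth (tl a) i = monomial a (rshift 4 i) :> nat.
  move=> /adm[_ _ _ le]; rewrite tnth_mktuple inordK // ltnS.
  by apply: leq_trans le; rewrite (bigD1 i) //= leq_addr.
rewrite -card_partial_ord_partitions -(card_in_imset (f := tl)); last first.
  move=> a a' /eqP ak /eqP ak' tt'; apply: monomial_inj; apply/mnmP.
  have tE i : monomial a (rshift 4 i) = monomial a' (rshift 4 i) by rewrite -!tlE // tt'.
  have [a0 a1 a2 _] := adm a ak; have [a0' a1' a2' _] := adm a' ak'.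
  apply: index_split; rewrite ?a0 ?a1 ?ak ?a0' ?a1' ?ak' // -a2 -a2'.
  by congr (_ + (_ - _))%N; apply: eq_bigr.
apply: eq_card => t; rewrite [RHS]inE big_tuple; apply/imsetP/idP => [[a /eqP ak ->]|le].
  have [_ _ _ le] := adm a ak; apply: leq_trans le; apply: eq_leq.
  by apply: eq_bigr => i _; exact: tlE.
(* The monomial with exponent [k] of [y_3] and exponents [t] of [y_4, ...]. *)
pose F (i : 'I_n.+4) : nat := if (i < 2)%N then 0%N else if i == 2 :> nat
  then ((k != 0%N) + (B - \sum_(i < n) tnth t i))%N else if i == 3 :> nat then k
  else if split (i : 'I_(4 + n)) is inr j then tnth t j else 0%N.
pose mu := [multinom F i | i < n.+4].
have muE i : mu (rshift 4 i) = tnth t i.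
  by rewrite mnmE /F /= -[rshift 4 i]/(unsplit (inr i : 'I_4 + 'I_n)%type) unsplitK.
have md : mdeg mu = d.
  rewrite mdeg_split; under eq_bigr do rewrite muE.
  rewrite !mnmE /F /=; move: le; move: (\sum_(i < n) _)%N => S; rewrite /B /tail_bound.
  by case: (k) kd => [|k'] /=; lia.
have mub : (mdeg mu < d.+1)%N by rewrite md.
have mua : admissible d mu.
  apply/and4P; split; rewrite ?md // !mnmE /F //=.
  by rewrite addn_gt0 lt0b orbAC orNb.
pose a : admissible_index n d := Sub (BMultinom mub) mua.
have ak : monomial a (o3 n) = k by rewrite [LHS]mnmE.
exists a; first exact/eqP.
by apply: eq_from_tnth => i; apply: val_inj; rewrite /= tlE // -muE.
Qed.

Hypothesis d3 : (3 <= d)%N.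

Lemma card_admissible : #|admissible_index n d| =
  ('C(n + d, n) + \sum_(1 <= k < d) 'C(n + d - k - 1, n))%N.
Proof.
have lt (a : admissible_index n d) : (monomial a (o3 n) < d)%N.
  have /and4P[/eqP md _ _ a23] := valP a.
  by move: md a23; rewrite mdeg_split -/(monomial a); lia.
rewrite -sum1_card (partition_big (fun a => Ordinal (lt a)) predT) //=.
transitivity (\sum_(k < d) 'C(n + tail_bound k, n))%N.
  apply: eq_bigr => k _; rewrite -card_admissible_fibre // -sum1_card; apply: eq_bigl => a.
  by rewrite inE.
rewrite -(big_mkord xpredT (fun k => 'C(n + tail_bound k, n))) big_ltn ?(leq_trans _ d3) //.
congr (_ + _)%N; apply: eq_big_nat => k /andP[k1 kd].
rewrite /tail_bound gtn_eqF //; congr 'C(_, _); lia.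
Qed.

Lemma chart_dimE : chart_dim n d3 = (3 * n.+3 + (n.+3 - 1) + 2 * (n.+3 - 2) + 'C(n.+3 + d - 3, n.+3 - 3)
      + (\sum_(1 <= k < d) 'C(n.+3 + d - k - 4, n.+3 - 3)) - 1)%N.
Proof.
rewrite /chart_dim card_free_index card_admissible.
have -> : (n.+3 - 3 = n)%N by lia.
have -> : (n.+3 + d - 3 = n + d)%N by lia.
have -> : (\sum_(1 <= k < d) 'C(n.+3 + d - k - 4, n) = \sum_(1 <= k < d) 'C(n + d - k - 1, n))%N.
  by apply: eq_big_nat => k /andP[k1 kd]; congr 'C(_, _); lia.
have : (0 < 'C(n + d, n))%N by rewrite bin_gt0 leq_addr.
by lia.
Qed.
End Count.

Local Close Scope classical_set_scope.
Theorem theorem7p4 (R : realType) (d N : nat) (hd : (3 <= d)%N) (hN : (3 <= N)%N) :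
  irreducible (config_closed R[i] N d) (Vint R[i] N d) /\
  has_dimension (config_closed R[i] N d) (Vint R[i] N d)
    (3 * N + (N - 1) + 2 * (N - 2) + 'C(N + d - 3, N - 3)
      + (\sum_(1 <= k < d) 'C(N + d - k - 4, N - 3)) - 1)%N.
Proof.
case: N hN => [|[|[|n]]] // _; split; first exact: (Vint_irreducible _ _ hd).
rewrite -(chart_dimE n hd); split; first exact: chart_chain.
exact: Vint_chain_length.
Qed.
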